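(* Consider the one-way normal-inverse-Gamma Markov grove (NIG-MG) model on the tree $\mathcal{T}$ with data $\mathcal{D}=\{\boldsymbol{d}_{j,k}:(j,k)\in\mathcal{T}\}$, as described in the context. Define mappings $\phi_{j,k},\xi_{j,k}:\{0,1\}\times\{0,1\}\to[0,+\infty)$ recursively from $j=J$ down to $j=0$ by $$\phi_{j,k}(s,r)=\begin{cases} m_{j,k}(s,r)\,\xi_{j+1,2k}(s,r)\,\xi_{j+1,2k+1}(s,r) & j=0,\ldots,J-1,\\ m_{j,k}(s,r) & j=J,\end{cases}$$ $$\xi_{j,k}(s,r)=\begin{cases}\sum_{s',r'\in\{0,1\}}\rho_{j,k}(s,s')\,\kappa_{j,k}(r,r')\,\phi_{j,k}(s',r') & j=1,\ldots,J,\\ \sum_{s',r'\in\{0,1\}}\rho_{0,0}(s')\,\kappa_{0,0}(r')\,\phi_{0,0}(s',r') & j=0.\end{cases}$$ Then the joint posterior of $\{z_{j,k},\boldsymbol\beta_{j,k},S_{j,k},R_{j,k},\sigma_{j,k}^2:(j,k)\in\mathcal{T}\}$ given $\mathcal{D}$ is as follows. (i) The marginal posterior of the hidden states $\{(S_{j,k},R_{j,k}):(j,k)\in\mathcal{T}\}$ is a Markov tree on the state space $\{0,1\}\times\{0,1\}$ with state transition probabilities $$\Pr(S_{j,k}=s',R_{j,k}=r'\mid S_{j-1,\lfloor k/2\rfloor}=s,R_{j-1,\lfloor k/2\rfloor}=r,\mathcal{D})=\rho_{j,k}(s,s')\,\kappa_{j,k}(r,r')\,\frac{\phi_{j,k}(s',r')}{\xi_{j,k}(s,r)},\quad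 j=1,\ldots,J,$$ and initial state probabilities $$\Pr(S_{0,0}=s,R_{0,0}=r\mid\mathcal{D})=\rho_{0,0}(s)\,\kappa_{0,0}(r)\,\frac{\phi_{0,0}(s,r)}{\xi_{0,0}(0,0)}.$$ (ii) Given the hidden states and $\mathcal{D}$, the triples $(z_{j,k},\boldsymbol\beta_{j,k},\sigma^2_{j,k})$ are independent across nodes, and for each node $$[\sigma_{j,k}^2\mid S_{j,k},R_{j,k},\mathcal{D}]\sim\text{Inv-Gamma}\left(\nu+1+\frac n2,\ \nu\sigma_0^2+\Upsilon_{j,k}(S_{j,k},R_{j,k})\right),$$ (iii) $$[(z_{j,k},\beta_{j,k}^{(2)},\ldots,\beta_{j,k}^{(G)})'\mid\sigma_{j,k}^2,S_{j,k},R_{j,k},\mathcal{D}]\sim\mathrm{N}\left(\boldsymbol\mu_{j,k}^*(S_{j,k},R_{j,k}),\ \sigma_{j,k}^2\, M(S_{j,k},R_{j,k})\circ[\Lambda_j^*(S_{j,k},R_{j,k})]^{-1}\right),$$ where $\circ$ denotes the Hadamard (entrywise) product.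
   Context: Tree. Fix an integer $J\ge 0$ and let $\mathcal{T}=\{(j,k): 0\le j\le J,\ 0\le k\le 2^j-1\}$ be the bifurcating tree with root $(0,0)$; the children of $(j,k)$ (for $j<J$) are $(j+1,2k)$ and $(j+1,2k+1)$, and the parent of $(j,k)$ (for $j\ge1$) is $(j-1,\lfloor k/2\rfloor)$. Markov tree (MT). For a finite state space $E$, an initial probability vector $q_{0,0}$ on $E$ and, for each $(j,k)$ with $j\ge1$, a stochastic matrix $q_{j,k}(\cdot,\cdot)$ on $E$, a collection $\{X_{j,k}:(j,k)\in\mathcal{T}\}$ of $E$-valued random variables is an MT with these initial and transition probabilities if for all $(x_{j,k})\in E^{\mathcal{T}}$, $\Pr(X_{j,k}=x_{j,k}\ \forall (j,k)\in\mathcal{T})=q_{0,0}(x_{0,0})\prod_{(j,k):\,j\ge1}q_{j,k}(x_{j-1,\lfloor k/2\rfloor},x_{j,k})$. Conventions. Normal laws may be degenerate (singular covariance); $\mathrm{N}(\mu,0)$ is the point mass at $\mu$. $\text{Inv-Gamma}(a,b)$ has density $\frac{b^a}{\Gamma(a)}x^{-a-1}e^{-b/x}$ on $(0,\infty)$. A prime on a vector or matrix denotes transpose; $\mathbf 1_m$ is the vector of $m$ ones. NIG-MG prior (one factor with $G\ge 2$ levels). Hyperparameters: $\nu>0$, $\sigma_0^2>0$, $\tau_j=2^{-\alpha j}\tau$, $\upsilon_j=2^{-\alpha j}\upsilon$ with $\alpha,\tau,\upsilon>0$; probability vectors $\rho_{0,0},\kappa_{0,0}$ on $\{0,1\}$;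 and $2\times2$ stochastic matrices $\rho_{j,k},\kappa_{j,k}$ (indexed by $\{0,1\}$) for $j\ge1$. The families $\{S_{j,k}\}$ and $\{R_{j,k}\}$ are independent $\{0,1\}$-valued MTs with initial/transition probabilities $\rho$ and $\kappa$ respectively. The $\sigma_{j,k}^2$ are independent $\text{Inv-Gamma}(\nu+1,\nu\sigma_0^2)$, independent of the hidden states. Given all hidden states and variances, all the $z_{j,k}$ and $\beta_{j,k}^{(g)}$ ($g=2,\dots,G$) are independent with $z_{j,k}\sim\mathrm{N}(0,S_{j,k}\tau_j\sigma_{j,k}^2)$ and $\beta_{j,k}^{(g)}\sim\mathrm{N}(0,R_{j,k}\upsilon_j\sigma_{j,k}^2)$. Set $\beta_{j,k}^{(1)}=0$ and $\boldsymbol\beta_{j,k}=(\beta_{j,k}^{(2)},\dots,\beta_{j,k}^{(G)})$. Data model. There are $n_g\geq 1$ replicates in group $g$, $n=\sum_{g=1}^G n_g$. Given all parameters and hidden states, $d_{j,k}^{(g,i)}=z_{j,k}+\beta_{j,k}^{(g)}+u_{j,k}^{(g,i)}$ for $g=1,\dots,G$, $i=1,\dots,n_g$, with $u_{j,k}^{(g,i)}\sim\mathrm{N}(0,\sigma_{j,k}^2)$ independent over $g,i,j,k$. Let $\boldsymbol d_{j,k}=(d_{j,k}^{(1,1)},\dots,d_{j,k}^{(G,n_G)})'\in\mathbb{R}^n$. Matrices. $\boldsymbol e_g\in\{0,1\}^n$ has $h$th entry $1$ iff the $h$th observation belongs to group $g$. For $s,r\in\{0,1\}$: $X(s,r)=(s\mathbf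 1_n,r\boldsymbol e_2,\dots,r\boldsymbol e_G)$ ($n\times G$), $\Lambda_j=\mathrm{diag}(1/\tau_j,1/\upsilon_j,\dots,1/\upsilon_j)$ ($G-1$ copies of $1/\upsilon_j$), $$M(s,r)=\begin{pmatrix} s & sr\mathbf 1_{G-1}'\\ sr\mathbf 1_{G-1}& r\mathbf 1_{G-1}\mathbf 1_{G-1}'\end{pmatrix},$$ $\Lambda_j^*(s,r)=X(s,r)'X(s,r)+\Lambda_j$, $\boldsymbol\mu_{j,k}^*(s,r)=[\Lambda_j^*(s,r)]^{-1}X(s,r)'\boldsymbol d_{j,k}$, and $\Upsilon_{j,k}(s,r)=\frac12\{\boldsymbol d_{j,k}'\boldsymbol d_{j,k}-[\boldsymbol\mu_{j,k}^*(s,r)]'\Lambda_j^*(s,r)\boldsymbol\mu_{j,k}^*(s,r)\}$. Node-specific marginal likelihood. $m_{j,k}(s,r)$ is the marginal density of $\boldsymbol d_{j,k}$ given $S_{j,k}=s,R_{j,k}=r$ (with $z_{j,k},\boldsymbol\beta_{j,k},\sigma_{j,k}^2$ integrated out); explicitly $$m_{j,k}(s,r)=\frac{(\nu\sigma_0^2)^{\nu+1}\Gamma(\nu+n/2+1)}{(2\pi)^{n/2}\Gamma(\nu+1)}\cdot\frac{|\Lambda_j|^{1/2}}{|\Lambda_j^*(s,r)|^{1/2}}\cdot[\nu\sigma_0^2+\Upsilon_{j,k}(s,r)]^{-\nu-n/2-1}.$$ *)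

(* Defs.v *)
From HB Require Import structures.
From mathcomp Require Import all_boot all_order all_algebra.
From mathcomp Require Import all_classical all_reals all_analysis measurable_realfun.

Set Implicit Arguments.
Unset Strict Implicit.
Unset Printing Implicit Defensive.

Import Order.TTheory GRing.Theory Num.Theory.
Import numFieldNormedType.Exports.

Local Open Scope classical_set_scope.
Local Open Scope ring_scope.

Definition node (J : nat) : Type := {j : 'I_J.+1 & 'I_(2 ^ j)}.

Definition lev (J : nat) (v : node J) : nat := tag v.
Definition pos (J : nat) (v : node J) : nat := tagged v.

Definition tree_root {J : nat} : node J :=
  @Tagged 'I_J.+1 ord0 (fun j => 'I_(2 ^ j)) (Ordinal (erefl : 0 < 2 ^ 0)%N).

(* The node (j, k); the value is the junk [tree_root] when (j, k) is not in the
   tree. *)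
Definition nodeat {J : nat} (j k : nat) : node J :=
  match insub j : option 'I_J.+1 with
  | None => tree_root
  | Some i => match insub k : option 'I_(2 ^ i) with
              | None => tree_root
              | Some l => @Tagged 'I_J.+1 i (fun j => 'I_(2 ^ j)) l
              end
  end.

Lemma nodeatK (J j k : nat) : (j <= J)%N -> (k < 2 ^ j)%N ->
  lev (@nodeat J j k) = j /\ pos (@nodeat J j k) = k.
Proof.
move=> jJ kj; rewrite /nodeat insubT /lev /pos /=.
by rewrite insubT.
Qed.

Definition parent (J : nat) (v : node J) : node J :=
  nodeat (lev v).-1 ((pos v) %/ 2).

Definition prob_vector (K : realType) (E : finType) (q : E -> K) : Prop :=
  (forall e, 0 <= q e) /\ \sum_(e : E) q e = 1.

(* [p x] stands for the probability of the configuration [x].  The matrix [q v]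
   is only used for nodes other than the root. *)
Definition markov_tree (K : realType) (J : nat) (E : finType)
    (p : (node J -> E) -> \bar K) (q0 : E -> K) (q : node J -> E -> E -> K)
    : Prop :=
  [/\ prob_vector q0,
      forall v : node J, (0 < lev v)%N -> forall e, prob_vector (q v e)
    & forall x : node J -> E,
        p x = (q0 (x tree_root) *
               \prod_(v : node J | (0 < lev v)%N) q v (x (parent v)) (x v))%:E].

(* The sets {X \in B}, B measurable. *)
Definition events d d' (Omega : measurableType d) (T : measurableType d')
    (X : Omega -> T) : set (set Omega) :=
  preimage_set_system setT X (@measurable d' T).

Definition events_fam d d' (Omega : measurableType d) (T : measurableType d')
    (I : Type) (X : I -> Omega -> T) : set (set Omega) :=
  \bigcup_(i in setT) events (X i).

(* [f] is a version of the conditional probability of [A] given the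
   sigma-algebra [F]. *)
Definition cond_prob d (Omega : measurableType d) (K : realType)
    (P : probability Omega K) (F : set (set Omega)) (A : set Omega)
    (f : Omega -> \bar K) : Prop :=
  (forall B : set (\bar K), measurable B -> F (f @^-1` B)) /\
  (forall C, F C -> P (C `&` A) = (\int[P]_(w in C) f w)%E).

(* The kernel [mu] is a version of the conditional law of [X] given [F]. *)
Definition cond_law d d' (Omega : measurableType d) (T : measurableType d')
    (K : realType) (P : probability Omega K) (F : set (set Omega))
    (X : Omega -> T) (mu : Omega -> set T -> \bar K) : Prop :=
  forall B : set T, measurable B ->
    cond_prob P F (X @^-1` B) (fun w => mu w B).

(* Given [F], the [X i] are independent and [X i] has law [mu i]. *)
Definition cond_indep_laws d d' (Omega : measurableType d)
    (T : measurableType d') (K : realType) (P : probability Omega K)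
    (F : set (set Omega)) (I : finType) (X : I -> Omega -> T)
    (mu : I -> Omega -> set T -> \bar K) : Prop :=
  forall B : I -> set T, (forall i, measurable (B i)) ->
    cond_prob P F [set w | forall i, B i (X i w)]
      (fun w => (\prod_(i : I) mu i w (B i))%E).

(* The sigma-algebras [G i] are independent given [F]. *)
Definition cond_indep d (Omega : measurableType d) (K : realType)
    (P : probability Omega K) (F : set (set Omega)) (I : finType)
    (G : I -> set (set Omega)) : Prop :=
  forall (A : I -> set Omega) (f : I -> Omega -> \bar K),
    (forall i, G i (A i)) -> (forall i, cond_prob P F (A i) (f i)) ->
    cond_prob P F [set w | forall i, A i w] (fun w => (\prod_(i : I) f i w)%E).

(* The library's [normal_prob] takes a standard deviation and is not a point
   mass when that is 0.  The value for v < 0 is irrelevant. *)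
Definition normal_law (K : realType) (m v : K) (A : set K) : \bar K :=
  if 0 < v then normal_prob m (Num.sqrt v) A else \d_m A.

Definition Gamma (K : realType) (a : K) : K :=
  Rintegral (@lebesgue_measure K) `]0, +oo[%classic
    (fun x => x `^ (a - 1) * expR (- x)).

Definition invgamma_pdf (K : realType) (a b x : K) : K :=
  if 0 < x then b `^ a / Gamma a * x `^ (- a - 1) * expR (- (b / x)) else 0.

Definition invgamma_law (K : realType) (a b : K) (A : set K) : \bar K :=
  (\int[@lebesgue_measure K]_(x in A) (invgamma_pdf a b x)%:E)%E.

(* Multivariate normal law, possibly degenerate: every linear form a'x is
   normal with mean a'm and variance a'Va. *)
Definition is_mvnormal (K : realType) (n : nat)
    (mu : probability (n.-tuple K) K) (m : 'cV[K]_n) (V : 'M[K]_n) : Prop :=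
  V^T = V /\
  forall a : 'cV[K]_n,
    0 <= (a^T *m V *m a) 0 0 /\
    forall B : set K, measurable B ->
      mu [set x : n.-tuple K | B (\sum_(i < n) a i 0 * tnth x i)] =
      normal_law ((a^T *m m) 0 0) ((a^T *m V *m a) 0 0) B.

(* [rho] and [kappa] are only used off the root.  [tau0] and [upsilon0] are the
   constants tau and upsilon in tau_j = 2^(-alpha j) tau and
   upsilon_j = 2^(-alpha j) upsilon. *)
Record hyper (K : realType) (J : nat) := Hyper {
  nu : K;
  sigma02 : K;
  alpha : K;
  tau0 : K;
  upsilon0 : K;
  rho0 : bool -> K;
  rho : node J -> bool -> bool -> K;
  kappa0 : bool -> K;
  kappa : node J -> bool -> bool -> K
}.

Definition tau (K : realType) (J : nat) (h : hyper K J) (j : nat) : K :=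
  2 `^ (- (alpha h * j%:R)) * tau0 h.

Definition upsilon (K : realType) (J : nat) (h : hyper K J) (j : nat) : K :=
  2 `^ (- (alpha h * j%:R)) * upsilon0 h.

(* Groups are numbered from 0: g : 'I_G is the group g+1 of the model.  Hence, in
   vectors and matrices indexed by 'I_G, the index 0 is that of z and the index
   g > 0 is that of the coefficient beta of group g. *)

Definition nobs (G : nat) (n_ : 'I_G -> nat) : nat := (\sum_(g < G) n_ g)%N.

(* [tagnat.sig] enumerates the pairs (g, i) lexicographically. *)
Definition dvec (K : realType) (G : nat) (n_ : 'I_G -> nat)
    (x : {g : 'I_G & 'I_(n_ g)} -> K) : 'cV[K]_(nobs n_) :=
  \col_(l < nobs n_) x (tagnat.sig l).

Definition Xmat (K : realType) (G : nat) (n_ : 'I_G -> nat) (s r : bool)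
    : 'M[K]_(nobs n_, G) :=
  \matrix_(l, g) if (g == 0%N :> nat) then s%:R
                 else r%:R * (tagnat.sig1 (l : 'I_(\sum_(g < G) n_ g)%N) == g)%:R.

Definition Lambda (K : realType) (J : nat) (h : hyper K J) (G : nat) (j : nat)
    : 'M[K]_G :=
  diag_mx (\row_(g < G) if (g == 0%N :> nat) then (tau h j)^-1
                        else (upsilon h j)^-1).

Definition Mmat (K : realType) (G : nat) (s r : bool) : 'M[K]_G :=
  \matrix_(a, b) if (a == 0%N :> nat) && (b == 0%N :> nat) then s%:R
                 else if (a == 0%N :> nat) || (b == 0%N :> nat) then s%:R * r%:R
                 else r%:R.

Definition hadamard (K : realType) (m n : nat) (A B : 'M[K]_(m, n))
    : 'M[K]_(m, n) := map2_mx *%R A B.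

Definition Lambda_star (K : realType) (J : nat) (h : hyper K J) (G : nat)
    (n_ : 'I_G -> nat) (j : nat) (s r : bool) : 'M[K]_G :=
  (Xmat K n_ s r)^T *m Xmat K n_ s r + Lambda h G j.

Definition mu_star (K : realType) (J : nat) (h : hyper K J) (G : nat)
    (n_ : 'I_G -> nat) (j : nat) (y : 'cV[K]_(nobs n_)) (s r : bool)
    : 'cV[K]_G :=
  invmx (Lambda_star h n_ j s r) *m (Xmat K n_ s r)^T *m y.

Definition Upsilon (K : realType) (J : nat) (h : hyper K J) (G : nat)
    (n_ : 'I_G -> nat) (j : nat) (y : 'cV[K]_(nobs n_)) (s r : bool) : K :=
  2^-1 * ((y^T *m y) 0 0 -
          ((mu_star h j y s r)^T *m Lambda_star h n_ j s r *m
           mu_star h j y s r) 0 0).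

Definition marg_lik (K : realType) (J : nat) (h : hyper K J) (G : nat)
    (n_ : 'I_G -> nat) (j : nat) (y : 'cV[K]_(nobs n_)) (s r : bool) : K :=
  let n2 : K := (nobs n_)%:R / 2 in
  (nu h * sigma02 h) `^ (nu h + 1) * Gamma (nu h + n2 + 1) /
    ((2 * pi) `^ n2 * Gamma (nu h + 1)) *
  (Num.sqrt (\det (Lambda h G j)) / Num.sqrt (\det (Lambda_star h n_ j s r))) *
  (nu h * sigma02 h + Upsilon h j y s r) `^ (- nu h - n2 - 1).

Definition xi_step (K : realType) (J : nat) (h : hyper K J)
    (f : node J -> bool -> bool -> K) (v : node J) (s r : bool) : K :=
  if lev v == 0%N then
    \sum_(s' : bool) \sum_(r' : bool) rho0 h s' * kappa0 h r' * f v s' r'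
  else
    \sum_(s' : bool) \sum_(r' : bool) rho h v s s' * kappa h v r r' * f v s' r'.

(* [i] is the height J - j of the node. *)
Fixpoint phi_rec (K : realType) (J : nat) (h : hyper K J)
    (m : node J -> bool -> bool -> K) (i : nat) (v : node J) (s r : bool) : K :=
  match i with
  | 0%N => m v s r
  | i'.+1 =>
      m v s r *
      xi_step h (phi_rec h m i') (nodeat (lev v).+1 (2 * pos v)) s r *
      xi_step h (phi_rec h m i') (nodeat (lev v).+1 (2 * pos v + 1)) s r
  end.

Section Recursion.
Context (K : realType) (J : nat) (h : hyper K J) (G : nat) (n_ : 'I_G -> nat)
  (y : node J -> 'cV[K]_(nobs n_)).

Definition phi (v : node J) (s r : bool) : K :=
  phi_rec h (fun v => marg_lik h (lev v) (y v)) (J - lev v)%N v s r.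

Definition xi (v : node J) (s r : bool) : K := xi_step h phi v s r.

Lemma phi_leaf (v : node J) (s r : bool) : lev v = J ->
  phi v s r = marg_lik h (lev v) (y v) s r.
Proof. by move=> vJ; rewrite /phi vJ subnn /= vJ. Qed.

Lemma phi_inner (v : node J) (s r : bool) : (lev v < J)%N ->
  phi v s r = marg_lik h (lev v) (y v) s r *
    xi (nodeat (lev v).+1 (2 * pos v)) s r *
    xi (nodeat (lev v).+1 (2 * pos v + 1)) s r.
Proof.
move=> vJ; have posv : (pos v < 2 ^ lev v)%N by rewrite /pos /lev ltn_ord.
have k0 : (2 * pos v < 2 ^ (lev v).+1)%N by rewrite expnS ltn_pmul2l.
have k1 : (2 * pos v + 1 < 2 ^ (lev v).+1)%N.
  by rewrite expnS addn1 mul2n mul2n -doubleS -leq_double in posv *.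
have [l0 _] := nodeatK vJ k0.
have [l1 _] := nodeatK vJ k1.
rewrite /phi -{1}(subnSK vJ) [LHS]/= /xi /xi_step l0 l1 /=.
by rewrite /phi l0 l1.
Qed.

Definition post_init (e : bool * bool) : K :=
  rho0 h e.1 * kappa0 h e.2 * (phi tree_root e.1 e.2 / xi tree_root false false).

Definition post_trans (v : node J) (e e' : bool * bool) : K :=
  rho h v e.1 e'.1 * kappa h v e.2 e'.2 * (phi v e'.1 e'.2 / xi v e.1 e.2).

End Recursion.

(* Main.v *)
Require Import Defs.
From HB Require Import structures.
From mathcomp Require Import all_boot all_order all_algebra.
From mathcomp Require Import all_classical all_reals all_analysis measurable_realfun.
From mathcomp Require Import ring.

(** Given the hidden states the nodes are independent, so everything rests on
   one node: completing the square in the joint Gaussian density of coefficients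
   and data, and then recognising an inverse gamma kernel in sigma^2, shows that
   (sigma^2, coefficients, data) has the law obtained by drawing the data with
   density m(s, r), then sigma^2 from the announced inverse gamma law, then the
   coefficients from the announced normal law.  When s = 0 or r = 0 the prior of
   the coefficients is degenerate; writing it as the image of a nondegenerate
   prior under the 0-1 diagonal matrix [mask s r] moves the degeneracy into the
   design matrix, X(s, r) = X(1, 1) mask(s, r), and the posterior is the image of
   a nondegenerate posterior under the same matrix.

   Densities are taken with respect to the standard Gaussian law of the noise
   instead of Lebesgue measure on R^n; the factor [gauss_pdf] by which they differ
   from m(s, r) does not depend on the hidden states and cancels.

   The weight of a hidden configuration given the data is its prior weight times
   the product of the m(s, r).  Since phi_v contains the factor xi_u for each
   child u of v, the product of the ratios phi_v / xi_v telescopes, so that this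
   weight is the weight of a Markov tree with the announced transitions.

   The conditional statements are verified on events of the form
   {hidden states = c} and {data in C}: every event of the conditioning
   sigma-algebra is a finite disjoint union of these. *)

(** Two obstacles shape the analytic half. First, the change of variables in several dimensions:
    [cholesky] writes the posterior precision as [T^T *m T] with T triangular, so that the
    substitution bringing the posterior to standard form peels off one coordinate at a time, each
    step being a one-dimensional affine substitution. The Jacobian is the product of the diagonal of
    T, which is also the square root of the determinant in m. Second, the posterior of the variance
    has parameters that move with the data, so its measurability in the data is not evident: it is
    read off the conjugacy identity, which turns an integral against it into one against the fixed
    prior.

    On the tree, sums over configurations are evaluated in breadth-first order: the transition into
    a node whose state the summand ignores can be exchanged for an independent draw.

    Part (iii) conditions on one variance besides the data, and a density from which that variance
    has been integrated out is then not enough; [joint_weight] keeps it. *)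

Set Implicit Arguments.
Unset Strict Implicit.
Unset Printing Implicit Defensive.

Import Order.TTheory GRing.Theory Num.Theory.
Import numFieldNormedType.Exports.

Local Open Scope classical_set_scope.
Local Open Scope ring_scope.

(** * Measures with densities *)

Section density.
Local Open Scope ereal_scope.
Context d (T : measurableType d) (K : realType).
Variables (m : {measure set T -> \bar K}) (w : T -> K).
Hypotheses (mw : measurable_fun setT w) (w0 : forall x, (0 <= w x)%R).

(** The two proofs are arguments so that the measure structure declared below can be inferred from
    the term itself. *)
Definition dens of measurable_fun setT w & (forall x, (0 <= w x)%R) :=
  fun A : set T => \int[m]_(x in A) (w x)%:E.

Local Notation mu := (dens mw w0).

Let dens0 : mu set0 = 0. Proof. by rewrite /dens integral_set0. Qed.

Let dens_ge0 A : 0 <= mu A.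
Proof. by apply: integral_ge0 => x _; rewrite lee_fin. Qed.

Let dens_sigma_additive : semi_sigma_additive mu.
Proof.
apply: semi_sigma_additive_nng_induced; first exact/measurable_EFinP.
by move=> x; rewrite lee_fin.
Qed.

HB.instance Definition _ := isMeasure.Build _ _ _ mu
  dens0 dens_ge0 dens_sigma_additive.

Import HBNNSimple.

Lemma integral_indicM (g : T -> \bar K) (A : set T) : measurable A ->
  \int[m]_x ((\1_A x)%:E * g x) = \int[m]_(x in A) g x.
Proof.
move=> mA; rewrite [RHS]integral_mkcond; apply: eq_integral => x _.
by rewrite patchE indicE; case: ifP => _; rewrite ?mul1e ?mul0e.
Qed.

(** For indicators this is the definition of [dens]; linearity gives simple functions, and monotone
    convergence on both sides the rest. *)
Lemma integral_dens (f : T -> \bar K) : measurable_fun setT f ->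
  (forall x, 0 <= f x) -> \int[mu]_x f x = \int[m]_x (f x * (w x)%:E).
Proof.
move=> mf f0; pose f_ := nnsfun_approx measurableT mf.
transitivity (limn (fun n => \int[mu]_x (f_ n x)%:E)).
  rewrite -monotone_convergence//.
  - apply: eq_integral => y _; apply/esym/cvg_lim => //.
    exact: cvg_nnsfun_approx.
  - by move=> n; exact/measurable_EFinP/measurable_funP.
  - by move=> n y _; rewrite lee_fin.
  - by move=> y _ k n kn; rewrite lee_fin; exact/lefP/nd_nnsfun_approx.
transitivity (limn (fun n => \int[m]_x ((f_ n x)%:E * (w x)%:E))); last first.
  rewrite -monotone_convergence//.
  - apply: eq_integral => y _; apply/cvg_lim => //.
    by apply: cvgeZr => //; exact: cvg_nnsfun_approx.
  - move=> n; apply: emeasurable_funM; last exact/measurable_EFinP.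
    exact/measurable_EFinP/measurable_funP.
  - by move=> n y _; rewrite mule_ge0// lee_fin.
  - move=> y _ k n kn; rewrite lee_wpmul2r ?lee_fin//.
    exact/lefP/nd_nnsfun_approx.
congr (limn _); apply/funext => n.
transitivity (\sum_(k \in range (f_ n)) k%:E * mu (f_ n @^-1` [set k])).
  under eq_integral do rewrite fimfunE -fsumEFin//.
  rewrite ge0_integral_fsum//; last 2 first.
  - by move=> y; exact/measurable_EFinP/measurable_funM.
  - by move=> y x _; rewrite nnfun_muleindic_ge0.
  apply: eq_fsbigr => r _.
  by rewrite integralZl_indic_nnsfun// integral_indic// setIT.
under [in RHS]eq_integral => x _.
  rewrite fimfunE -fsumEFin// ge0_mule_fsuml; last first.
    by move=> i; rewrite nnfun_muleindic_ge0.
  over.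
rewrite [RHS]ge0_integral_fsum//; last 2 first.
- move=> y; apply: emeasurable_funM; last exact/measurable_EFinP.
  exact/measurable_EFinP/measurable_funM.
- by move=> y x _; apply: mule_ge0; [exact: nnfun_muleindic_ge0|rewrite lee_fin].
(* Only values attained by the simple function occur, hence [r] is nonnegative and may leave the
   integral. *)
apply: eq_fsbigr => r; rewrite inE => -[z _ zr].
under [RHS]eq_integral do rewrite EFinM -muleA.
rewrite ge0_integralZl//.
- by rewrite integral_indicM.
- apply: emeasurable_funM; last exact/measurable_EFinP.
  exact/measurable_EFinP.
- by move=> x _; rewrite mule_ge0// lee_fin.
- by rewrite lee_fin -zr.
Qed.

End density.

Section transfer.
Local Open Scope ereal_scope.
Context d1 d2 d (T1 : measurableType d1) (T2 : measurableType d2)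
  (T : measurableType d) (K : realType).
Variables (m1 : {measure set T1 -> \bar K}) (m2 : {measure set T2 -> \bar K}).
Variables (Z1 : T1 -> T) (Z2 : T2 -> T) (w1 : T1 -> K) (w2 : T2 -> K).
Hypotheses (mZ1 : measurable_fun setT Z1) (mZ2 : measurable_fun setT Z2).
Hypotheses (mw1 : measurable_fun setT w1) (mw2 : measurable_fun setT w2).
Hypotheses (w10 : forall x, (0 <= w1 x)%R) (w20 : forall x, (0 <= w2 x)%R).

(** The assumption says that the image under [Z1] of the measure with density [w1] equals the image
    under [Z2] of the measure with density [w2]; both integrals are taken against this common
    measure on [T]. In most applications [w1] is the indicator of an event and [Z2] is the identity
    of a reference space. *)
Lemma integral_transfer :
  (forall B, measurable B ->
     \int[m1]_(x in Z1 @^-1` B) (w1 x)%:E = \int[m2]_(x in Z2 @^-1` B) (w2 x)%:E) ->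
  forall f : T -> \bar K, measurable_fun setT f -> (forall x, 0 <= f x) ->
  \int[m1]_x (f (Z1 x) * (w1 x)%:E) = \int[m2]_x (f (Z2 x) * (w2 x)%:E).
Proof.
move=> h f mf f0.
rewrite -(integral_dens m1 mw1 w10) /=; last 2 first.
- exact: measurableT_comp.
- by move=> x; exact: f0.
rewrite -(integral_dens m2 mw2 w20) /=; last 2 first.
- exact: measurableT_comp.
- by move=> x; exact: f0.
have := @ge0_integral_pushforward _ _ _ _ _ _ mZ1 (dens m1 mw1 w10) setT f measurableT mf (fun y _ => f0 y).
rewrite preimage_setT /= => <-.
have := @ge0_integral_pushforward _ _ _ _ _ _ mZ2 (dens m2 mw2 w20) setT f measurableT mf (fun y _ => f0 y).
rewrite preimage_setT /= => <-.
apply: eq_measure_integral => /= A mA _.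
by rewrite /pushforward /dens h.
Qed.

(** Uniqueness of finite measures that agree on a pi-system. Finiteness of the first one suffices,
    as [setT] belongs to [G]. *)
Lemma measure_pi_system (G : set (set T)) : measurable = <<s G >> -> setI_closed G ->
  G setT -> (\int[m1]_x (w1 x)%:E < +oo) ->
  (forall B, G B ->
     \int[m1]_(x in Z1 @^-1` B) (w1 x)%:E = \int[m2]_(x in Z2 @^-1` B) (w2 x)%:E) ->
  (forall B, measurable B ->
     \int[m1]_(x in Z1 @^-1` B) (w1 x)%:E = \int[m2]_(x in Z2 @^-1` B) (w2 x)%:E).
Proof.
move=> mG GI GT fin h B mB.
pose M1 := pushforward (dens m1 mw1 w10) (HB.pack_for {mfun T1 >-> T} Z1 (isMeasurableFun.Build _ _ _ _ _ mZ1)).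
pose M2 := pushforward (dens m2 mw2 w20) (HB.pack_for {mfun T2 >-> T} Z2 (isMeasurableFun.Build _ _ _ _ _ mZ2)).
apply: (measure_unique G (fun=> setT) mG GI _ _ M1 M2) => //.
by rewrite bigcup_const.
Qed.
End transfer.

(** * Finite powers of a probability *)

Section ipow.
Context d (T : measurableType d) (K : realType).

Definition consf n (p : T * n.-tuple T) : n.+1.-tuple T := [tuple of p.1 :: p.2].

Lemma measurable_consf n : measurable_fun setT (@consf n).
Proof. exact: measurable_cons. Qed.

HB.instance Definition _ n :=
  isMeasurableFun.Build _ _ _ _ (@consf n) (@measurable_consf n).

Variable mu : probability T K.

(** Built by adding a coordinate in front, so that Tonelli's theorem integrates one coordinate at a
    time and statements on tuples are proved by induction on the length. *)
Fixpoint ipow n : probability (n.-tuple T) K :=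
  match n with
  | 0%N => dirac [tuple]
  | n'.+1 => distribution (mu \x ipow n')%E (@consf n')
  end.

End ipow.

Section ipow_theory.
Local Open Scope ereal_scope.
Context d (T : measurableType d) (K : realType) (mu : probability T K).

Lemma integral_ipow0 (f : 0.-tuple T -> \bar K) : measurable_fun setT f ->
  \int[ipow mu 0]_t f t = f [tuple].
Proof. by move=> mf; rewrite integral_dirac// diracT mul1e. Qed.

Lemma integral_ipowS n (f : n.+1.-tuple T -> \bar K) : measurable_fun setT f ->
  (forall t, 0 <= f t) ->
  \int[ipow mu n.+1]_t f t = \int[mu]_x \int[ipow mu n]_t f (consf (x, t)).
Proof.
move=> mf f0.
have mfc : measurable_fun setT (f \o @consf _ _ n) by exact: measurableT_comp.
rewrite -(fubini_tonelli1 (f \o @consf _ _ n))//; last by move=> p; exact: f0.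
have := @ge0_integral_pushforward _ _ _ _ _ _ (@measurable_consf _ T n)
   (mu \x ipow mu n) setT f measurableT mf (fun y _ => f0 y).
by rewrite preimage_setT.
Qed.

Lemma measurable_ipow_inner n (f : n.+1.-tuple T -> \bar K) : measurable_fun setT f ->
  (forall t, 0 <= f t) ->
  measurable_fun setT (fun x => \int[ipow mu n]_t f (consf (x, t))).
Proof.
move=> mf f0.
have mfc : measurable_fun setT (f \o @consf _ _ n) by exact: measurableT_comp.
by apply: (measurable_fun_fubini_tonelli_F (f \o @consf _ _ n)) => // p; exact: f0.
Qed.

Lemma emeasurable_prod d' (U : measurableType d') I (s : seq I) (f : I -> U -> \bar K) :
  (forall i, measurable_fun setT (f i)) ->
  measurable_fun setT (fun t => \prod_(i <- s) f i t).
Proof.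
move=> mf; elim: s => [|i s ih].
  by under eq_fun do rewrite big_nil; exact: measurable_cst.
by under eq_fun do rewrite big_cons; exact: emeasurable_funM.
Qed.

Lemma prode_ge0' I (s : seq I) (f : I -> \bar K) :
  (forall i, 0 <= f i) -> 0 <= \prod_(i <- s) f i.
Proof. by move=> f0; elim: s => [|i s ih]; rewrite ?big_nil ?big_cons// mule_ge0. Qed.

(** Independence of the coordinates, by Tonelli's theorem applied to the first of them. *)
Lemma integral_ipow_prod n (f : 'I_n -> T -> \bar K) :
  (forall i, measurable_fun setT (f i)) -> (forall i x, 0 <= f i x) ->
  \int[ipow mu n]_t \prod_(i < n) f i (tnth t i) = \prod_(i < n) \int[mu]_x f i x.
Proof.
have mp k (g : 'I_k -> T -> \bar K) : (forall i, measurable_fun setT (g i)) ->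
    measurable_fun setT (fun t : k.-tuple T => \prod_(i < k) g i (tnth t i)).
  move=> mg; apply: emeasurable_prod => i.
  exact: measurableT_comp (mg i) (measurable_tnth i).
elim: n f => [|n ih] f mf f0.
  rewrite integral_ipow0 ?big_ord0//; exact: mp.
rewrite integral_ipowS; first last.
- by move=> t; exact: prode_ge0'.
- exact: mp.
rewrite big_ord_recl -(ih (fun i => f (lift ord0 i))) => [|i|i x] //.
rewrite -ge0_integralZr//; last first.
  by apply: integral_ge0 => t _; exact: prode_ge0'.
apply: eq_integral => x _.
rewrite -ge0_integralZl//; first last.
- by move=> t _; exact: prode_ge0'.
- by apply: (mp n (fun i => f (lift ord0 i))) => i.
apply: eq_integral => t _; rewrite big_ord_recl; congr (_ * _).
by apply: eq_bigr => i _; rewrite /consf /= tnthS.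
Qed.

Definition box n (B : 'I_n -> set T) : set (n.-tuple T) :=
  [set t | forall i, B i (tnth t i)].

Definition boxes n : set (set (n.-tuple T)) :=
  [set A | exists2 B : 'I_n -> set T, (forall i, measurable (B i)) & A = box B].

Lemma measurable_box n (B : 'I_n -> set T) : (forall i, measurable (B i)) ->
  measurable (box B).
Proof.
move=> mB.
have -> : box B = \bigcap_(i in setT) ((@tnth _ T ^~ i) @^-1` B i).
  by apply/seteqP; split => t /= h i //=; exact: h.
apply: fin_bigcap_measurable => // i _.
by rewrite -[X in measurable X]setTI; exact: measurable_tnth.
Qed.

(** The preimage of a measurable set under one coordinate is a box whose other sides are full;
    conversely a box is a finite intersection of such preimages. *)
Lemma boxesE n : measurable = <<s @boxes n >>.
Proof.
apply/seteqP; split.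
  apply: smallest_sub; first exact: smallest_sigma_algebra.
  rewrite -bigcup_seq; apply: bigcup_sub => i _ A [B mB <-].
  apply: sub_sigma_algebra; exists (fun j => if j == i then B else setT).
    by move=> j; case: ifP.
  rewrite setTI; apply/seteqP; split => t /=.
    by move=> Bt j /=; case: ifPn => // /eqP ->.
  by move=> /(_ i) /=; rewrite eqxx.
apply: smallest_sub; first exact: sigma_algebra_measurable.
by move=> A [B mB ->]; exact: measurable_box.
Qed.

Lemma boxesI n : setI_closed (@boxes n).
Proof.
move=> _ _ [A mA ->] [B mB ->]; exists (fun i => A i `&` B i).
  by move=> i; exact: measurableI.
apply/seteqP; split => t /=; first by move=> [h1 h2] i; split.
by move=> h; split => i; have [] := h i.
Qed.

Lemma boxesT n : @boxes n setT.
Proof. by exists (fun=> setT) => //; apply/seteqP; split => t. Qed.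

End ipow_theory.

Section multi.
Local Open Scope ereal_scope.
Context d (T : measurableType d) (K : realType) (I : finType).
Variable G : set (set T).
Hypotheses (mG : measurable = <<s G >>) (GI : setI_closed G) (GT : G setT).

Definition upd (E : I -> set T) (i : I) (A : set T) : I -> set T :=
  fun j => if j == i then A else E j.

(* Dynkin's argument, applied to one coordinate after the other. *)
Lemma measurable_families_eq (phi1 phi2 : (I -> set T) -> \bar K) :
  (forall E i, (forall j, measurable (E j)) ->
     exists M1 M2 : {measure set T -> \bar K}, [/\ M1 setT < +oo,
       forall A, measurable A -> M1 A = phi1 (upd E i A) &
       forall A, measurable A -> M2 A = phi2 (upd E i A)]) ->
  (forall E, (forall j, G (E j)) -> phi1 E = phi2 E) ->
  forall E, (forall j, measurable (E j)) -> phi1 E = phi2 E.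
Proof.
move=> hM hG E mE.
have Gm A : G A -> measurable A.
  by move=> GA; have -> : measurable A = <<s G >> A; [rewrite mG|exact: sub_sigma_algebra].
(* The list [s] holds the coordinates already allowed to be arbitrary measurable sets; the others
   still range over the generators. *)
suff: forall s : seq I, forall E, (forall j, measurable (E j)) ->
    (forall j, j \notin s -> G (E j)) -> phi1 E = phi2 E.
  by move=> /(_ (enum I)) -> // j; rewrite mem_enum.
elim => [|i s ih] {mE}E mE GE; first by apply: hG => j; exact: GE.
have [M1 [M2 [M1oo M1E M2E]]] := hM E i mE.
have EE : upd E i (E i) = E.
  by apply/funext => j; rewrite /upd; case: eqP => // ->.
rewrite -EE -M1E// -M2E//.
apply: (measure_unique G (fun=> setT)) => //; first by rewrite bigcup_const.
move=> A GA; have mA := Gm _ GA; rewrite M1E// M2E//.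
apply: ih => j; rewrite /upd; case: ifPn => // ji.
by move=> js; apply: GE; rewrite inE negb_or ji.
Qed.
End multi.

Definition image_measure d d' (T1 : measurableType d) (T2 : measurableType d')
    (K : realType) (m : {measure set T1 -> \bar K}) (f : T1 -> T2)
    (mf : measurable_fun setT f) : {measure set T2 -> \bar K} :=
  measure_function_pushforward__canonical__measure_function_Measure m mf.

Lemma integral_image d d' (T1 : measurableType d) (T2 : measurableType d')
    (K : realType) (m : {measure set T1 -> \bar K}) (f : T1 -> T2)
    (mf : measurable_fun setT f) (g : T2 -> \bar K) : measurable_fun setT g ->
  (forall x, 0 <= g x)%E ->
  (\int[image_measure m mf]_y g y = \int[m]_x g (f x))%E.
Proof.
move=> mg g0.
have := @ge0_integral_pushforward _ _ _ _ _ _ mf m setT g measurableT mg (fun y _ => g0 y).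
by rewrite preimage_setT.
Qed.

Section affine.
Local Open Scope ereal_scope.
Context (K : realType).
Local Notation leb := (@lebesgue_measure K).

(** The rescaled image of Lebesgue measure gives each half-open interval its length, which
    characterises Lebesgue measure. *)
Lemma lebesgue_measure_affine (t b : K) (A : set K) : (0 < t)%R -> measurable A ->
  t%:E * leb ((fun x => t * x - b)%R @^-1` A) = leb A.
Proof.
move=> t0 mA.
pose g (x : measurableTypeR K) : measurableTypeR K := (t * x - b)%R.
have mphi : measurable_fun setT g.
  by apply: measurable_funB => //; exact: measurable_funM.
pose M := mscale (NngNum (ltW t0)) (image_measure leb mphi).
rewrite -[LHS]/(M A); apply/esym/lebesgue_measure_unique => //= _ [[x y]] _ <-.
rewrite /M /mscale/= /image_measure/= /pushforward/= (_ : _ @^-1` _ = `](x + b) / t, (y + b) / t]%classic)%R; last first.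
  apply/seteqP; split => z /=; rewrite !in_itv/= ltrBrDr lerBlDr ltr_pdivrMr// ler_pdivlMr// mulrC//.
rewrite !lebesgue_measure_itv/= !lte_fin ltr_pM2r ?invr_gt0// ltrD2r.
case: ifPn => _; last by rewrite mule0.
by rewrite -!EFinD -EFinM; congr EFin; field; rewrite gt_eqF.
Qed.

Lemma integral_affine (t b : K) (f : K -> \bar K) : (0 < t)%R ->
  measurable_fun setT f -> (forall x, 0 <= f x) ->
  \int[leb]_x (f (t * x - b)%R * t%:E) = \int[leb]_x f x.
Proof.
move=> t0 mf f0.
pose g (x : measurableTypeR K) : measurableTypeR K := (t * x - b)%R.
have mphi : measurable_fun setT g.
  by apply: measurable_funB => //; exact: measurable_funM.
pose M := mscale (NngNum (ltW t0)) (image_measure leb mphi).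
transitivity (\int[M]_x f x); last first.
  apply: eq_measure_integral => A mA _; exact: lebesgue_measure_affine.
rewrite ge0_integral_mscale//= integral_image//=.
rewrite ge0_integralZr//; last 2 first.
- exact: measurableT_comp.
- by rewrite lee_fin ltW.
by rewrite muleC.
Qed.
End affine.

(** * Gaussian laws *)

Section gauss1.
Local Open Scope ereal_scope.
Context (K : realType).
Local Notation leb := (@lebesgue_measure K).

(** Moves laws from [measurableTypeR K], which carries Lebesgue measure and densities, to [K], over
    which the tuples and random variables are formed. *)
Definition idR (x : measurableTypeR K) : K := x.

Lemma measurable_idR : measurable_fun setT idR.
Proof. by move=> _ B mB; rewrite setTI. Qed.

HB.instance Definition _ := isMeasurableFun.Build _ _ _ _ idR measurable_idR.

Definition gauss1 : probability K K := distribution (normal_prob 0%R 1%R) idR.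

Lemma integral_normal (m s : K) (f : K -> \bar K) : measurable_fun setT f ->
  (forall x, 0 <= f x) ->
  \int[normal_prob m s]_x f x = \int[leb]_x (f x * (normal_pdf m s x)%:E).
Proof.
move=> mf f0.
have mw := measurable_normal_pdf m s.
have w0 := normal_pdf_ge0 m s.
by rewrite -(integral_dens leb mw w0)//; apply: eq_measure_integral.
Qed.

Lemma integral_gauss1 (f : K -> \bar K) : measurable_fun setT f ->
  (forall x, 0 <= f x) ->
  \int[gauss1]_x f x = \int[leb]_x (f x * (normal_pdf 0 1 x)%:E).
Proof.
move=> mf f0; rewrite -integral_normal//.
exact: (integral_image _ measurable_idR).
Qed.

(** The substitution y = t x - b written relative to the Gaussian law: the factor is the Jacobian t
    times the ratio of the standard normal densities at t x - b and at x. *)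
Lemma gauss1_change (t b : K) (f : K -> \bar K) : (0 < t)%R ->
  measurable_fun setT f -> (forall x, 0 <= f x) ->
  \int[gauss1]_x (f (t * x - b)%R * (t * expR (- (t * x - b) ^+ 2 / 2 + x ^+ 2 / 2))%:E)
  = \int[gauss1]_x f x.
Proof.
move=> t0 mf f0.
have mg : measurable_fun setT (fun x : K => (t * x - b)%R).
  by apply: measurable_funB => //; exact: measurable_funM.
rewrite !integral_gauss1//; last 2 first.
- apply: emeasurable_funM; first exact: measurableT_comp mf mg.
  apply/measurable_EFinP; apply: measurable_funM => //; apply: measurableT_comp => //.
  apply: measurable_funD; apply: measurable_funM => //.
    by apply: measurableT_comp => //; exact: measurable_funX.
- by move=> x; rewrite mule_ge0// lee_fin mulr_ge0 ?expR_ge0// ltW.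
rewrite -[RHS](integral_affine b t0)//; last 2 first.
- by apply: emeasurable_funM => //; apply/measurable_EFinP; exact: measurable_normal_pdf.
- by move=> x; rewrite mule_ge0// lee_fin normal_pdf_ge0.
apply: eq_integral => x _; rewrite -!muleA; congr (_ * _).
rewrite -!EFinM; congr EFin.
rewrite /normal_pdf oner_eq0 /normal_fun.
set p := normal_peak 1; transitivity (t * p * (expR (- (t * x - b) ^+ 2 / 2 + x ^+ 2 / 2) *
  expR (- (x - 0) ^+ 2 / (1 ^+ 2 *+ 2))))%R; first by ring.
rewrite -expRD [RHS]mulrC mulrA; congr (_ * expR _)%R.
by rewrite !subr0 expr1n; field.
Qed.

Lemma gauss1N (f : K -> \bar K) : measurable_fun setT f ->
  (forall x, 0 <= f x) -> \int[gauss1]_x f (- x)%R = \int[gauss1]_x f x.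
Proof.
move=> mf f0; have mN : measurable_fun setT (fun x : K => - x)%R by exact: oppr_measurable.
rewrite !integral_gauss1//; last by exact: measurableT_comp mf mN.
pose g (x : measurableTypeR K) : measurableTypeR K := (- x)%R.
have mg : measurable_fun setT g by exact: mN.
have mF : measurable_fun [set: measurableTypeR K] (fun x => f x * (normal_pdf 0 1 x)%:E).
  by apply: emeasurable_funM => //; apply/measurable_EFinP; exact: measurable_normal_pdf.
transitivity (\int[image_measure leb mg]_x (f x * (normal_pdf 0 1 x)%:E)).
  have F0 (x : measurableTypeR K) : 0 <= f x * (normal_pdf 0 1 x)%:E.
    by rewrite mule_ge0// lee_fin normal_pdf_ge0.
  rewrite (integral_image leb mg mF F0).
  apply: eq_integral => x _; congr (_ * EFin _).
  by rewrite /normal_pdf oner_eq0 /normal_fun !subr0 sqrrN.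
by apply: eq_measure_integral => A mA _; exact: lebesgue_measureN.
Qed.

(** Here [c] may be zero or negative: zero gives the point mass of [normal_law], and a sign is
    absorbed by the symmetry of the Gaussian law. Seeing every normal law as an image of one law
    treats the degenerate and nondegenerate cases together. *)
Lemma normal_lawE_sqr (b c : K) (B : set K) : measurable B ->
  \int[gauss1]_x (\1_B (b + c * x)%R)%:E = normal_law b (c ^+ 2) B.
Proof.
move=> mB.
have m1 (k : K) : measurable_fun setT (fun x : K => (\1_B (b + k * x)%R)%:E : \bar K).
  apply/measurable_EFinP; apply: measurableT_comp; first exact: measurable_indic.
  by apply: measurable_funD => //; exact: measurable_funM.
wlog c0 : c / (0 <= c)%R.
  move=> h; have [/h//|/ltW c0] := leP 0%R c.
  rewrite -sqrrN -h ?oppr_ge0// -[LHS]gauss1N//.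
  by apply: eq_integral => x _; rewrite mulrN mulNr.
rewrite /normal_law; have [->|c1] := eqVneq c 0%R.
  rewrite expr0n/= ltxx (eq_integral (cst (\1_B b)%:E)).
    by rewrite integral_cst//= -[RHS]mule1; congr (_ * _); exact: (probability_setT gauss1).
  by move=> x _; rewrite mul0r addr0.
have {c1}c0 : (0 < c)%R by rewrite lt_def c1.
rewrite exprn_gt0// sqrtr_sqr gtr0_norm// integral_gauss1//.
rewrite /normal_prob -(@integral_indicM _ (measurableTypeR K) _ leb _ _ mB).
rewrite -[RHS](integral_affine (- b) c0)//; last 2 first.
- apply: emeasurable_funM; apply/measurable_EFinP; first exact: measurable_indic.
  exact: measurable_normal_pdf.
- by move=> x; rewrite mule_ge0// lee_fin// normal_pdf_ge0.
apply: eq_integral => x _; rewrite opprK [(_ + b)%R]addrC -muleA; congr (_ * _).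
rewrite -EFinM; congr EFin; rewrite /normal_pdf oner_eq0 gt_eqF// /normal_fun subr0.
rewrite [(b + _)%R]addrC addrK mulrAC; congr (_ * expR _)%R; last first.
  by rewrite expr1n; field; rewrite gt_eqF.
rewrite /normal_peak expr1n mul1r -mulrnAr sqrtrM ?sqr_ge0// sqrtr_sqr gtr0_norm//.
have q0 : (Num.sqrt (pi *+ 2) != 0 :> K)%R by rewrite gt_eqF// sqrtr_gt0 pmulrn_lgt0// pi_gt0.
by field; rewrite q0 gt_eqF.
Qed.

Lemma normal_lawE (b v : K) (B : set K) : measurable B ->
  normal_law b v B = \int[gauss1]_x (\1_B (b + Num.sqrt v * x)%R)%:E.
Proof.
move=> mB; rewrite (normal_lawE_sqr b (Num.sqrt v) mB); have [v0|v0] := ltP 0%R v.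
  by rewrite sqr_sqrtr// ltW.
(* For v <= 0 the square root is 0 by convention, and both sides are the point mass at [b]. *)
have e0 : (0 ^+ 2 = 0 :> K)%R by rewrite expr0n.
by rewrite (ler0_sqrtr v0) e0 /normal_law ltxx ltNge v0.
Qed.

Lemma normal_law_dens (b v : K) (B : set K) : measurable B -> (0 < v)%R ->
  normal_law b v B = \int[gauss1]_x ((\1_B x)%:E *
    ((Num.sqrt v)^-1 * expR (- (x - b) ^+ 2 / (2 * v) + x ^+ 2 / 2))%:E).
Proof.
move=> mB v0; rewrite normal_lawE//; set r := Num.sqrt v.
have r0 : (0 < r)%R by rewrite sqrtr_gt0.
have mf : measurable_fun setT (fun x : K => (\1_B (b + r * x)%R)%:E : \bar K).
  apply/measurable_EFinP; apply: measurableT_comp; first exact: measurable_indic.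
  by apply: measurable_funD => //; exact: measurable_funM.
have ri0 : (0 < r^-1)%R by rewrite invr_gt0.
rewrite -(@gauss1_change r^-1 (r^-1 * b)%R _ ri0 mf); last by move=> x; rewrite lee_fin.
apply: eq_integral => x _.
  have -> : (b + r * (r^-1 * x - r^-1 * b) = x)%R by field; rewrite gt_eqF.
  congr (_ * (_ * expR _)%:E); rewrite -mulrBr exprMn exprVn sqr_sqrtr ?ltW//.
  by field; rewrite gt_eqF.
Qed.

Lemma gauss_square (v c y : K) : (0 < v)%R ->
  \int[gauss1]_x (expR (- (y - c * x) ^+ 2 / (2 * v)))%:E =
  (Num.sqrt v / Num.sqrt (v + c ^+ 2) * expR (- y ^+ 2 / (2 * (v + c ^+ 2))))%:E.
Proof.
move=> v0; have vc0 : (0 < v + c ^+ 2)%R by rewrite ltr_wpDr// sqr_ge0.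
set r := Num.sqrt v; set q := Num.sqrt (v + c ^+ 2).
have r0 : (0 < r)%R by rewrite sqrtr_gt0.
have q0 : (0 < q)%R by rewrite sqrtr_gt0.
have rv : (r ^+ 2 = v)%R by rewrite sqr_sqrtr// ltW.
have qv : (q ^+ 2 = v + c ^+ 2)%R by rewrite sqr_sqrtr// ltW.
(* With r^2 = v and q^2 = v + c^2, completing the square gives (y - c x)^2 / v + x^2 = (q x / r - c
   y / (r q))^2 + y^2 / q^2, whence the slope and the shift of the substitution. *)
have t0 : (0 < q / r)%R by rewrite divr_gt0.
have := @gauss1_change (q / r) (c * y / (r * q)) (cst 1) t0 (measurable_cst _) (fun _ => lee01).
rewrite [in RHS]/cst integral_cst// [X in _ * X](probability_setT gauss1) mul1e => h.
rewrite -[RHS]mule1 -h -ge0_integralZl//.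
- apply: eq_integral => x _; rewrite mul1e -EFinM; congr EFin.
  transitivity ((r / q * (q / r)) * (expR (- y ^+ 2 / (2 * (v + c ^+ 2))) *
    expR (- (q / r * x - c * y / (r * q)) ^+ 2 / 2 + x ^+ 2 / 2)))%R; last by ring.
  have -> : (r / q * (q / r) = 1)%R by field; rewrite !gt_eqF.
  rewrite mul1r -expRD.
  congr expR; rewrite -qv.
  rewrite -rv; apply/eqP; rewrite -subr_eq0; apply/eqP.
  (* The two exponents agree only through r^2 + c^2 = q^2; their difference is displayed as a
     multiple of r^2 + c^2 - q^2, so that [field] can treat r and q as independent. *)
  transitivity ((r ^+ 2 + c ^+ 2 - q ^+ 2) *
    (y ^+ 2 / (2 * r ^+ 2 * q ^+ 2) - x ^+ 2 / (2 * r ^+ 2)))%R.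
    by field; rewrite !gt_eqF.
  by rewrite qv rv subrr mul0r.
- apply: emeasurable_funM => //; apply/measurable_EFinP; apply: measurable_funM => //.
  apply: measurableT_comp => //; apply: measurable_funD; apply: measurable_funM => //.
  apply: measurableT_comp => //; apply: measurable_funX; apply: measurable_funB => //; exact: measurable_funM.
- by move=> x _; rewrite mule_ge0// lee_fin mulr_ge0 ?expR_ge0// ltW.
- by rewrite lee_fin mulr_ge0 ?expR_ge0// divr_ge0 ?ltW.
Qed.

(** For v > 0 the integrals are exchanged, and the density of the mixture at y is the Gaussian
    integral of [gauss_square]. For v = 0 this is [normal_lawE_sqr]. *)
Lemma normal_law_conv (b c v : K) (B : set K) : measurable B -> (0 <= v)%R ->
  \int[gauss1]_x normal_law (b + c * x) v B = normal_law b (v + c ^+ 2) B.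
Proof.
move=> mB; rewrite le_eqVlt => /predU1P[<-|v0].
  rewrite add0r -normal_lawE_sqr//; apply: eq_integral => x _.
  by rewrite /normal_law ltxx.
have vc0 : (0 < v + c ^+ 2)%R by rewrite ltr_wpDr// sqr_ge0.
set r := Num.sqrt v; set q := Num.sqrt (v + c ^+ 2).
have r0 : (0 < r)%R by rewrite sqrtr_gt0.
have q0 : (0 < q)%R by rewrite sqrtr_gt0.
under eq_integral do rewrite normal_law_dens//.
pose F (p : K * K) := (\1_B p.2)%:E *
  (r^-1 * expR (- (p.2 - (b + c * p.1)) ^+ 2 / (2 * v) + p.2 ^+ 2 / 2))%:E.
have mF : measurable_fun setT F.
  apply: emeasurable_funM; apply/measurable_EFinP.
    by apply: measurableT_comp => //; exact: measurable_indic.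
  apply: measurable_funM => //; apply: measurableT_comp => //.
  apply: measurable_funD; apply: measurable_funM => //; last exact: measurable_funX.
  apply: measurableT_comp => //; apply: measurable_funX; apply: measurable_funB => //.
  by apply: measurable_funD => //; exact: measurable_funM.
rewrite -[LHS]/(\int[gauss1]_x \int[gauss1]_y F (x, y)) fubini_tonelli//; last first.
  by move=> p; rewrite mule_ge0// lee_fin mulr_ge0 ?expR_ge0// invr_ge0 ltW.
rewrite normal_law_dens// -/q; apply: eq_integral => y _.
rewrite /F/= ge0_integralZl//; last 2 first.
- apply/measurable_EFinP; apply: measurable_funM => //; apply: measurableT_comp => //.
  apply: measurable_funD => //; apply: measurable_funM => //.
  apply: measurableT_comp => //; apply: measurable_funX; apply: measurable_funB => //.
  by apply: measurable_funD => //; exact: measurable_funM.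
- by move=> x _; rewrite lee_fin mulr_ge0 ?expR_ge0// invr_ge0 ltW.
congr (_ * _).
transitivity (\int[gauss1]_x ((r^-1 * expR (y ^+ 2 / 2))%:E *
   (expR (- ((y - b) - c * x) ^+ 2 / (2 * v)))%:E)).
  apply: eq_integral => x _; rewrite -EFinM expRD; congr EFin.
  by rewrite opprD addrA; ring.
rewrite ge0_integralZl//; last 2 first.
- apply/measurable_EFinP; apply: measurableT_comp => //; apply: measurable_funM => //.
  by apply: measurableT_comp => //; apply: measurable_funX; apply: measurable_funB => //; exact: measurable_funM.
- by rewrite lee_fin mulr_ge0 ?expR_ge0// invr_ge0 ltW.
rewrite (gauss_square _ _ v0) -/q -/r -EFinM expRD; congr EFin.
by field; rewrite !gt_eqF.
Qed.
End gauss1.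

Section gaussn.
Local Open Scope ereal_scope.
Context (K : realType).

Definition gauss n : probability (n.-tuple K) K := ipow (gauss1 K) n.

(** Measures live on tuples, linear algebra on column vectors; [colt] and [tofc] pass from one to
    the other. *)
Definition colt n (t : n.-tuple K) : 'cV[K]_n := \col_i tnth t i.
Definition tofc n (c : 'cV[K]_n) : n.-tuple K := [tuple c i 0%R | i < n].
Definition sqn n (v : 'cV[K]_n) : K := (\sum_i v i 0 ^+ 2)%R.

Lemma tofcK n : cancel (@tofc n) (@colt n).
Proof. by move=> c; apply/colP => i; rewrite mxE tnth_mktuple. Qed.

Lemma coltK n : cancel (@colt n) (@tofc n).
Proof. by move=> t; apply: eq_from_tnth => i; rewrite tnth_mktuple mxE. Qed.

Section mx_measurable.
Context d (U : measurableType d).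

Definition mx_measurable m n (A : U -> 'M[K]_(m, n)) :=
  forall i j, measurable_fun setT (fun u => A u i j).

Lemma mx_measurable_cst m n (A : 'M[K]_(m, n)) : mx_measurable (fun=> A).
Proof. by move=> i j. Qed.

Lemma mx_measurableM m n p (A : U -> 'M[K]_(m, n)) (B : U -> 'M[K]_(n, p)) :
  mx_measurable A -> mx_measurable B -> mx_measurable (fun u => A u *m B u).
Proof.
move=> mA mB i j; under eq_fun do rewrite mxE.
by apply: measurable_sum => k; exact: measurable_funM.
Qed.

Lemma mx_measurableD m n (A B : U -> 'M[K]_(m, n)) :
  mx_measurable A -> mx_measurable B -> mx_measurable (fun u => A u + B u)%R.
Proof. by move=> mA mB i j; under eq_fun do rewrite mxE; exact: measurable_funD. Qed.

Lemma mx_measurableN m n (A : U -> 'M[K]_(m, n)) :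
  mx_measurable A -> mx_measurable (fun u => - A u)%R.
Proof. by move=> mA i j; under eq_fun do rewrite mxE; exact: measurable_funN. Qed.

Lemma mx_measurableB m n (A B : U -> 'M[K]_(m, n)) :
  mx_measurable A -> mx_measurable B -> mx_measurable (fun u => A u - B u)%R.
Proof. by move=> mA mB; apply: mx_measurableD => //; exact: mx_measurableN. Qed.

Lemma mx_measurableZ m n (a : U -> K) (A : U -> 'M[K]_(m, n)) :
  measurable_fun setT a -> mx_measurable A -> mx_measurable (fun u => a u *: A u)%R.
Proof. by move=> ma mA i j; under eq_fun do rewrite mxE; exact: measurable_funM. Qed.

Lemma mx_measurable_tr m n (A : U -> 'M[K]_(m, n)) :
  mx_measurable A -> mx_measurable (fun u => (A u)^T).
Proof. by move=> mA i j; under eq_fun do rewrite mxE; exact: mA. Qed.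

Lemma measurable_tofc n (c : U -> 'cV[K]_n) :
  mx_measurable c -> measurable_fun setT (fun u => tofc (c u)).
Proof.
move=> mc; apply/measurable_fun_tnthP => i.
by rewrite (_ : _ \o _ = fun u => c u i 0%R)//; apply/funext => u /=; rewrite tnth_mktuple.
Qed.

Lemma mx_measurable_colt n (c : U -> n.-tuple K) :
  measurable_fun setT c -> mx_measurable (fun u => colt (c u)).
Proof.
move=> mc i j; under eq_fun do rewrite mxE.
by move/measurable_fun_tnthP: mc; exact.
Qed.

Lemma measurable_sqn n (c : U -> 'cV[K]_n) :
  mx_measurable c -> measurable_fun setT (fun u => sqn (c u)).
Proof. by move=> mc; apply: measurable_sum => i; exact: measurable_funX. Qed.

End mx_measurable.

(** The factor is the determinant of T times the ratio of the standard Gaussian densities at T t - b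
    and at t. As T is lower triangular, the first coordinate of T t - b depends on the first
    coordinate of t alone; once that one is fixed, the others undergo an affine map with a smaller
    triangular matrix, and the one-dimensional case handles the first. *)
Lemma gauss_change n (T : 'M[K]_n) (b : 'cV[K]_n) (f : n.-tuple K -> \bar K) :
  is_trig_mx T -> (forall i, 0 < T i i)%R ->
  measurable_fun setT f -> (forall t, 0 <= f t) ->
  \int[gauss n]_t (f (tofc (T *m colt t - b)) *
     (\prod_i T i i * expR (- sqn (T *m colt t - b) / 2 + sqn (colt t) / 2))%:E)
  = \int[gauss n]_t f t.
Proof.
have mcst k (A : 'M[K]_k) (c : 'cV[K]_k) : mx_measurable (fun t : k.-tuple K => A *m colt t - c)%R.
  apply: mx_measurableB; last exact: mx_measurable_cst.
  by apply: mx_measurableM; [exact: mx_measurable_cst|exact: mx_measurable_colt].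
have mexp k (A : 'M[K]_k) (c : 'cV[K]_k) : measurable_fun setT (fun t : k.-tuple K =>
   (\prod_i A i i * expR (- sqn (A *m colt t - c) / 2 + sqn (colt t) / 2))%:E).
  apply/measurable_EFinP; apply: measurable_funM => //; apply: measurableT_comp => //.
  apply: measurable_funD; apply: measurable_funM => //.
    by apply: measurableT_comp => //; exact: measurable_sqn.
  by apply: measurable_sqn; exact: mx_measurable_colt.
have mint k (A : 'M[K]_k) (c : 'cV[K]_k) (g : k.-tuple K -> \bar K) :
   measurable_fun setT g -> measurable_fun setT (fun t : k.-tuple K =>
   g (tofc (A *m colt t - c)) *
   (\prod_i A i i * expR (- sqn (A *m colt t - c) / 2 + sqn (colt t) / 2))%:E).
  move=> mg; apply: emeasurable_funM; last exact: mexp.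
  by apply: measurableT_comp mg _; exact: measurable_tofc.
elim: n T b f => [|n ih] T b f trT T0 mf f0.
  rewrite !integral_ipow0//; last exact: mint.
  rewrite big_ord0 mul1r /sqn !big_ord0 oppr0 !mul0r addr0 expR0 mule1.
  by congr f; apply: eq_from_tnth => -[].
have posT k (A : 'M[K]_k) (x : K) : (forall i, 0 < A i i)%R -> 0 <= (\prod_i A i i * expR x)%:E.
  by move=> A0; rewrite lee_fin mulr_ge0 ?expR_ge0// prodr_ge0// => i _; exact: ltW.
rewrite integral_ipowS; last 2 first.
- exact: mint.
- by move=> t; rewrite mule_ge0// posT.
rewrite [RHS](integral_ipowS _ mf f0).
pose T1 : 'M[K]_n := \matrix_(i, j) T (lift ord0 i) (lift ord0 j).
(* With the first coordinate frozen at x, its contribution through the first column of T becomes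
   part of the shift. *)
pose b1 x : 'cV[K]_n := \col_i (b (lift ord0 i) 0 - T (lift ord0 i) ord0 * x)%R.
have trT1 : is_trig_mx T1.
  by apply/is_trig_mxP => i j ij; rewrite mxE; apply: (is_trig_mxP trT); rewrite !lift0 ltnS.
have T10 i : (0 < T1 i i)%R by rewrite mxE.
have E0 x (t : n.-tuple K) : (T *m colt (consf (x, t)) - b)%R ord0 0%R = (T ord0 ord0 * x - b ord0 0%R)%R.
  rewrite !mxE big_ord_recl mxE /consf tnth0; congr (_ - _)%R.
  by rewrite big1 ?addr0// => i _; rewrite (is_trig_mxP trT) ?mul0r.
have E1 x (t : n.-tuple K) i : (T *m colt (consf (x, t)) - b)%R (lift ord0 i) 0%R =
    (T1 *m colt t - b1 x)%R i 0%R.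
  rewrite !mxE big_ord_recl mxE /consf tnth0 opprB addrA; congr (_ - _)%R.
  by rewrite addrC; congr (_ + _)%R; apply: eq_bigr => j _; rewrite !mxE tnthS.
have Etup x (t : n.-tuple K) : tofc (T *m colt (consf (x, t)) - b)%R =
   consf ((T ord0 ord0 * x - b ord0 0%R)%R, tofc (T1 *m colt t - b1 x)%R).
  apply: eq_from_tnth => i; rewrite tnth_mktuple; have [j ->|->] := unliftP ord0 i.
    by rewrite E1 /consf tnthS tnth_mktuple.
  by rewrite E0.
have Esq x (t : n.-tuple K) : sqn (T *m colt (consf (x, t)) - b)%R =
   ((T ord0 ord0 * x - b ord0 0) ^+ 2 + sqn (T1 *m colt t - b1 x))%R.
  by rewrite /sqn big_ord_recl E0; congr (_ + _)%R; apply: eq_bigr => i _; rewrite E1.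
have Esqt x (t : n.-tuple K) : sqn (colt (consf (x, t))) = (x ^+ 2 + sqn (colt t))%R.
  rewrite /sqn big_ord_recl mxE /consf tnth0; congr (_ + _)%R.
  by apply: eq_bigr => i _; rewrite !mxE tnthS.
pose F (y : K) := \int[gauss n]_s f (consf (y, s)).
have mF : measurable_fun setT F by exact: measurable_ipow_inner.
have F0 y : 0 <= F y by exact: integral_ge0.
have mfc y : measurable_fun setT (fun s => f (consf (y, s))).
  by apply: (measurableT_comp mf); apply: (measurableT_comp (@measurable_consf _ K n)); exact: pair1_measurable.
pose a := T ord0 ord0; pose b0 := b ord0 0%R.
rewrite -[RHS](@gauss1_change _ a b0 F (T0 ord0) mF F0).
apply: eq_integral => x _.
rewrite {1}/F -(ih T1 (b1 x) (fun s => f (consf ((a * x - b0)%R, s))) trT1 T10 (mfc _) (fun=> f0 _)).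
have mI : measurable_fun setT (fun t : n.-tuple K =>
    f (consf ((a * x - b0)%R, tofc (T1 *m colt t - b1 x)%R)) *
    (\prod_i T1 i i * expR (- sqn (T1 *m colt t - b1 x) / 2 + sqn (colt t) / 2))%:E).
  exact: (mint _ _ _ (fun s => f (consf ((a * x - b0)%R, s)))).
rewrite -(ge0_integralZr _ measurableT mI); last 2 first.
- by move=> t _; rewrite mule_ge0// posT.
- by rewrite lee_fin mulr_ge0 ?expR_ge0//; exact: ltW (T0 ord0).
apply: eq_integral => t _; rewrite Etup -muleA; congr (_ * _).
rewrite -EFinM Esq Esqt big_ord_recl; congr EFin.
under [in RHS]eq_bigr do rewrite mxE.
rewrite [RHS]mulrC mulrACA -expRD; congr (_ * expR _)%R.
by rewrite -/a -/b0; field.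
Qed.

(** Induction on the dimension: each coordinate adds its squared coefficient to the variance by
    [normal_law_conv], which allows zero coefficients. *)
Lemma gauss_linear n (b : K) (c : 'cV[K]_n) (B : set K) : measurable B ->
  \int[gauss n]_t (\1_B (b + \sum_i c i 0 * tnth t i)%R)%:E =
  normal_law b (\sum_i c i 0 ^+ 2)%R B.
Proof.
move=> mB; have mI k (a : K) (e : 'cV[K]_k) : measurable_fun setT
    (fun t : k.-tuple K => (\1_B (a + \sum_i e i 0 * tnth t i)%R)%:E : \bar K).
  apply/measurable_EFinP; apply: measurableT_comp; first exact: measurable_indic.
  apply: measurable_funD => //; apply: measurable_sum => i.
  by apply: measurable_funM => //; exact: measurable_tnth.
elim: n b c => [|n ih] b c.
  by rewrite integral_ipow0// !big_ord0 addr0 /normal_law ltxx.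
rewrite integral_ipowS; [|exact: mI|by move=> t; rewrite lee_fin].
rewrite big_ord_recl addrC -normal_law_conv//; last first.
  by rewrite sumr_ge0// => i _; exact: sqr_ge0.
apply: eq_integral => x _.
have := ih (b + c ord0 0 * x)%R (\col_i c (lift ord0 i) 0%R).
under [in X in _ = X -> _]eq_bigr do rewrite mxE.
move=> <-; apply: eq_integral => t _.
congr (\1_B _)%:E; rewrite -addrA; congr (_ + _)%R; rewrite big_ord_recl /consf tnth0.
by congr (_ + _)%R; apply: eq_bigr => i _; rewrite mxE tnthS.
Qed.

End gaussn.

(** * Cholesky factorisation *)

Section cholesky.
Context (K : realType).

Definition posdef n (A : 'M[K]_n) :=
  A^T = A /\ forall x : 'cV[K]_n, x != 0 -> 0 < (x^T *m A *m x) 0 0.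

Lemma mulmx_tr_diag n (x : 'cV[K]_n) : (x^T *m x) 0 0 = \sum_i x i 0 ^+ 2.
Proof. by rewrite mxE; apply: eq_bigr => i _; rewrite mxE expr2. Qed.

Lemma posdef_factor_unit n (T : 'M[K]_n) : is_trig_mx T -> (forall i, 0 < T i i) ->
  T \in unitmx.
Proof.
move=> trT T0; rewrite unitmxE det_trig// unitfE gt_eqF//.
by apply: prodr_gt0 => i _.
Qed.

(** The first row and column are split off, so that T is lower triangular in [T^T *m T], the form
    wanted by [gauss_change]. If T1 factors the lower right block, the part c of the first column of
    T below the diagonal solves T1^T c = w', and the square of the corner entry is the Schur
    complement a - c^T c. *)
Lemma cholesky n (A : 'M[K]_n) : posdef A ->
  exists T : 'M[K]_n, [/\ is_trig_mx T, forall i, 0 < T i i & T^T *m T = A].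
Proof.
elim: n A => [|n ih] A [As Ap].
  by exists 0; split; [exact: mx0_is_trig|case|apply/matrixP => -[]].
move: As Ap; rewrite -[A](@submxK _ 1 n 1 n).
set a := ulsubmx _; set w := ursubmx _; set w' := dlsubmx _; set A1 := drsubmx _.
rewrite (@tr_block_mx _ 1 n 1 n) => As Ap; have [_ ww' _ A1s] := @eq_block_mx _ 1 n 1 n _ _ _ _ _ _ _ _ As.
have {}Ap (x : 'cV[K]_(1 + n)) : x != 0 ->
    0 < (x^T *m (block_mx a w w' A1 : 'M[K]_(1 + n)) *m x) 0 0 by exact: Ap.
have w'E : w' = w^T by rewrite -ww' trmxK.
have [T1 [trT1 T10 T1A]] : exists T : 'M[K]_n,
    [/\ is_trig_mx T, forall i, 0 < T i i & T^T *m T = A1].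
  apply: ih; split => // x x0.
  have := Ap (col_mx 0 x); rewrite tr_col_mx mul_row_block.
  rewrite mul_row_col !trmx0 !mul0mx !mulmx0 !add0r; apply.
  by rewrite col_mx_eq0 negb_and x0 orbT.
have uT1 := posdef_factor_unit trT1 T10.
pose c := invmx T1^T *m w'.
have uT1t : T1^T \in unitmx by rewrite unitmx_tr.
have cE : T1^T *m c = w' by rewrite mulKVmx.
have wE : w = c^T *m T1 by rewrite -ww' -cE trmx_mul trmxK.
(* The Schur complement is the value of the form at the vector (1, x) with T1 x = - c, its minimum
   over vectors with first coordinate 1. *)
have t0 : 0 < a 0 0 - (c^T *m c) 0 0.
  have [x T1x] : exists x : 'cV_n, T1 *m x = - c.
    by exists (- invmx T1 *m c); rewrite mulNmx mulmxN mulKVmx.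
  have := Ap (col_mx 1%:M x); rewrite tr_col_mx mul_row_block.
  rewrite mul_row_col trmx1 !mul1mx mulmx1 -T1A -cE wE.
  have -> : a + x^T *m (T1^T *m c) + (c^T *m T1 + x^T *m (T1^T *m T1)) *m x = a - c^T *m c.
    have e1 : x^T *m T1^T = - c^T by rewrite -trmx_mul T1x linearN.
    rewrite mulmxDl !mulmxA e1 -!(mulmxA _ T1 x) T1x.
    by rewrite !mulNmx !mulmxN opprK addNr addr0.
  have nz : col_mx 1%:M x != 0 :> 'cV[K]_(1 + n) by rewrite col_mx_eq0 negb_and oner_eq0.
  by move=> /(_ nz); rewrite !mxE.
pose t := Num.sqrt (a 0 0 - (c^T *m c) 0 0).
exists (block_mx t%:M 0 c T1); split.
- by rewrite (@is_trig_block_mx _ 1 n 1 n)// mx11_is_trig eqxx trT1.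
- move=> i; case: (@splitP 1 n i) => j ij.
    have -> : i = lshift n j by exact: val_inj.
    by rewrite (@block_mxEul _ 1 n 1 n) mxE !ord1 eqxx mulr1n sqrtr_gt0.
  have -> : i = rshift 1 j by exact: val_inj.
  by rewrite (@block_mxEdr _ 1 n 1 n).
- rewrite (@tr_block_mx _ 1 n 1 n) (@mulmx_block _ 1 n 1 n 1 n).
  rewrite !trmx0 !mul0mx !mulmx0 !add0r T1A cE -wE.
  congr (@block_mx _ 1 n 1 n _ _ _ _); apply/matrixP => i j; rewrite !ord1.
  by rewrite mxE tr_scalar_mx -scalar_mxM mxE eqxx mulr1n -expr2 sqr_sqrtr ?ltW// subrK.
Qed.

Lemma posdef_unit n (A : 'M[K]_n) : posdef A -> A \in unitmx.
Proof.
move=> /cholesky[T [trT T0 <-]]; have uT := posdef_factor_unit trT T0.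
by rewrite unitmx_mul unitmx_tr uT.
Qed.
End cholesky.

(** * Inverse gamma laws *)

Section inversion.
Context (K : realType).
Local Notation leb := (@lebesgue_measure K).

(** The map x |-> b / x carries the n-th interval for the parameter 1 onto the n-th interval for the
    parameter b; both exhaustions serve in [integral_inversion]. *)
Lemma itv0y_bigcup (b : K) : 0 < b ->
  `]0, +oo[%classic = \bigcup_n `[b / n.+1%:R, b * n.+1%:R]%classic :> set K.
Proof.
move=> b0; apply/seteqP; split => x /=.
  rewrite in_itv/= andbT => x0.
  have [n] : exists n : nat, Num.max (x / b) (b / x) < n%:R.
    by exists (Num.trunc (Num.max (x / b) (b / x))).+1; exact: truncnS_gt.
  rewrite gt_max => /andP[h1 h2]; exists n => //=; rewrite in_itv/=.
  have h : n%:R <= n.+1%:R :> K by rewrite ler_nat.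
  rewrite ler_pdivrMr// mulrC -ler_pdivrMr// (le_trans (ltW h2))//=.
  by rewrite mulrC -ler_pdivrMr// (le_trans (ltW h1)).
move=> [n _] /=; rewrite !in_itv/= andbT => /andP[h _].
by apply: lt_le_trans h; rewrite divr_gt0.
Qed.

Lemma itvS_nd (b : K) : 0 < b ->
  nondecreasing_seq (fun n => `[b / n.+1%:R, b * n.+1%:R]%classic : set K).
Proof.
move=> b0; apply/nondecreasing_seqP => n; rewrite subsetEset => x /=.
rewrite !in_itv/= => /andP[h1 h2]; apply/andP; split.
  by apply: le_trans h1; rewrite ler_pM2l// lef_pV2 ?posrE// ler_nat.
by apply: (le_trans h2); rewrite ler_pM2l// ler_nat.
Qed.

Lemma continuous_div_sqr (b x : K) : x != 0 ->
  {for x, continuous (fun y : K => b / y ^+ 2)}.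
Proof.
move=> x0.
apply: (@continuousM K K (cst b) (fun y => (y ^+ 2)^-1)); first exact: cst_continuous.
apply: (@continuousV K K (fun y : K => y ^+ 2)); first by rewrite expf_neq0.
exact: exprn_continuous.
Qed.

(** Substitution by a decreasing function on compact intervals, then monotone convergence along the
    two exhaustions of the half-line. *)
Lemma integral_inversion (b : K) (G : K -> K) : 0 < b ->
  measurable_fun (`]0, +oo[%classic : set K) G ->
  (forall x : K, 0 < x -> {for x, continuous G}) -> (forall x, 0 <= G x) ->
  (\int[leb]_(x in `]0%R, +oo[) (G (b / x) * (b / x ^+ 2))%:E =
   \int[leb]_(x in `]0%R, +oo[) (G x)%:E)%E.
Proof.
move=> b0 mG cG G0.
pose F (y : K) := b / y.
have dF (x : K) : x != 0 -> is_derive x 1 F (- (b / x ^+ 2)).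
  move=> x0.
  have h := @is_deriveV K id x 1 1 x0 (is_derive_id x 1).
  rewrite /F; apply: is_derive_eq.
  by rewrite /GRing.scale/= mulr1 mulrN.
have cF (x : K) : 0 < x -> F x @[x --> x] --> F x.
  move=> x0; apply: differentiable_continuous; apply/derivable1_diffP.
  by have [] := dF x (lt0r_neq0 x0).
have cdF (x : K) : 0 < x -> F^`()%classic y @[y --> x] --> - (b / x ^+ 2).
  move=> x0; apply: (@cvg_trans _ ((fun y => - (b / y ^+ 2)) @ x)).
    apply: near_eq_cvg; near=> y.
    rewrite derive1E; have y0 : 0 < y by near: y; exact: lt_nbhsr.
    by have [_ ->] := dF y (lt0r_neq0 y0).
  have h : {for x, continuous (fun y : K => - (b / y ^+ 2))}.
    by apply: continuousN; exact: continuous_div_sqr (lt0r_neq0 x0).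
  exact: h.
pose N (n : nat) : K := n.+1%:R.
have N1 n : 1 <= N n by rewrite ler1n.
have N0 n : 0 < N n by exact: ltr0Sn.
have step n : (\int[leb]_(x in `[(1 / N n)%R, (1 * N n)%R]) (G (b / x) * (b / x ^+ 2))%:E =
   \int[leb]_(x in `[(b / N n)%R, (b * N n)%R]) (G x)%:E)%E.
  have FN : F (1 * N n) = b / N n by rewrite /F mul1r.
  have FNV : F (1 / N n) = b * N n by rewrite /F div1r invrK.
  have n0 : 0 < 1 / N n by rewrite divr_gt0.
  rewrite -FN -FNV (@integration_by_substitution_decreasing _ F G).
  - apply: eq_integral => x; rewrite inE/= in_itv/= => /andP[x1 _].
    congr EFin; rewrite fctE /= /F; congr (_ * _).
    have x0 : x != 0 by rewrite gt_eqF// (lt_le_trans _ x1).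
    by rewrite fctE -/F derive1E; have [_ ->] := dF x x0; rewrite opprK.
  - by rewrite div1r mul1r (le_trans _ (N1 n))// invf_le1.
  - move=> x y; rewrite !in_itv/= => /andP[x1 _] /andP[y1 _] xy.
    by rewrite /F ltr_pM2l// ltf_pV2// posrE (lt_le_trans n0).
  - move=> x; rewrite in_itv/= => /andP[x1 _].
    have x0 : 0 < x by exact: lt_trans x1.
    rewrite /continuous_at derive1E; have [_ ->] := dF x (lt0r_neq0 x0).
    exact: cdF.
  - by apply/cvg_ex; eexists; apply: cvg_at_right_filter; exact: cdF.
  - by apply/cvg_ex; eexists; apply: cvg_at_left_filter; apply: cdF; rewrite mul1r.
  - split.
    + move=> x; rewrite in_itv/= => /andP[x1 _].
      by have [] := dF x (lt0r_neq0 (lt_trans n0 x1)).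
    + by apply: cvg_at_right_filter; exact: cF.
    + by apply: cvg_at_left_filter; apply: cF; rewrite mul1r.
  - apply: continuous_in_subspaceT => x; rewrite inE/= in_itv/= FN => /andP[x1 _].
    by apply: cG; rewrite (lt_le_trans _ x1)// divr_gt0.
have sub0 (c : K) i : 0 < c -> `[c / N i, c * N i]%classic `<=` `]0, +oo[%classic.
  by move=> c0 x; rewrite (itv0y_bigcup c0) => ?; exists i.
have mI : measurable_fun (`]0, +oo[%classic : set K) (fun x => (G (b / x) * (b / x ^+ 2))%:E).
  apply/measurable_EFinP; apply: open_continuous_measurable_fun; first exact: interval_open.
  move=> x; rewrite inE/= in_itv/= andbT => x0.
  apply: (@continuousM K K (G \o F)); last exact: continuous_div_sqr (lt0r_neq0 x0).
  by apply: continuous_comp; [exact: cF|apply: cG; rewrite divr_gt0].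
have h1 := @ge0_nondecreasing_set_cvg_integral _ (measurableTypeR K) K _
  (fun x : K => (G (b / x) * (b / x ^+ 2))%:E) leb (itvS_nd ltr01)
  (fun i => measurable_itv _) (fun i => measurable_funS (measurable_itv `]0, +oo[) (sub0 1 i ltr01) mI).
have mGE : measurable_fun (`]0, +oo[%classic : set K) (fun x => (G x)%:E) by exact/measurable_EFinP.
have h2 := @ge0_nondecreasing_set_cvg_integral _ (measurableTypeR K) K _
  (fun x : K => (G x)%:E) leb (itvS_nd b0)
  (fun i => measurable_itv _) (fun i => measurable_funS (measurable_itv `]0, +oo[) (sub0 b i b0) mGE).
rewrite -(itv0y_bigcup ltr01) in h1; rewrite -(itv0y_bigcup b0) in h2.
have p1 (i : nat) (x : measurableTypeR K) : `[1 / i.+1%:R, 1 * i.+1%:R]%classic x ->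
    (0%R <= (G (b / x) * (b / x ^+ 2))%:E)%E.
  move=> ix; rewrite lee_fin mulr_ge0// divr_ge0 ?exprn_ge0 ?(ltW b0)//.
  by have := sub0 1 i ltr01 x ix; rewrite /= in_itv/= andbT => /ltW.
have p2 (i : nat) (x : measurableTypeR K) : `[b / i.+1%:R, b * i.+1%:R]%classic x ->
    (0%R <= (G x)%:E)%E by rewrite lee_fin.
rewrite -(cvg_lim (@ereal_hausdorff K) (h1 p1)) -(cvg_lim (@ereal_hausdorff K) (h2 p2)).
by apply: (f_equal (fun v : nat -> \bar K => lim (v @ \oo))); apply/funext => n; exact: step.
Unshelve. all: by end_near. Qed.

End inversion.

(** Powers are measurable on the whole line. For x <= 0 the inverse is the opposite of the power of
    - x, which covers x = 0 too, where both conventions give 0. *)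
Lemma measurable_inv (K : realType) : measurable_fun setT (@GRing.inv K).
Proof.
have -> : @GRing.inv K = fun x => if 0 < x then x `^ (-1) else - ((- x) `^ (-1)).
  apply/funext => x; case: ltP => x0; first by rewrite powR_inv1// ltW.
  by rewrite powR_inv1 ?oppr_ge0// invrN opprK.
apply: measurable_fun_ifT.
- by apply: measurable_fun_ltr => //; exact: measurable_cst.
- exact: measurable_powR.
- apply: measurable_funN.
  apply: (measurableT_comp (f := fun y : K => y `^ (-1)) (g := fun x : K => - x)).
    exact: measurable_powR.
  exact: oppr_measurable.
Qed.

Section invgamma.
Context (K : realType).
Local Notation leb := (@lebesgue_measure K).

Definition gamma_fun (a y : K) : K := if 0 < y then y `^ (a - 1) * expR (- y) else 0.

Lemma gamma_fun_ge0 a y : 0 <= gamma_fun a y.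
Proof. by rewrite /gamma_fun; case: ifP => // _; rewrite mulr_ge0 ?powR_ge0 ?expR_ge0. Qed.

Lemma measurable_gamma_fun a : measurable_fun setT (gamma_fun a).
Proof.
apply: measurable_fun_ifT => //.
  by apply: measurable_fun_ltr => //; exact: measurable_cst.
apply: measurable_funM; first exact: measurable_powR.
by apply: measurableT_comp => //; exact: oppr_measurable.
Qed.

Lemma continuous_gamma_fun a (x : K) : 0 < x -> {for x, continuous (gamma_fun a)}.
Proof.
move=> x0; apply: (@cvg_trans _ ((fun y => expR (ln y * (a - 1) - y)) @ x)).
  apply: near_eq_cvg; near=> y; have y0 : 0 < y by near: y; exact: lt_nbhsr.
  by rewrite /gamma_fun y0 /powR gt_eqF// -expRD mulrC.
rewrite /gamma_fun x0 /powR gt_eqF// -expRD [_ * ln x]mulrC.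
apply: (@continuous_comp _ _ _ (fun y : K => ln y * (a - 1) - y) expR); last exact: continuous_expR.
apply: (@continuousB K K); last exact: cvg_id.
apply: (@continuousM K K); last exact: cst_continuous.
exact: continuous_ln.
Unshelve. all: by end_near. Qed.

(** The function y^(a - 1) e^(- y / 2) is largest at y = 2 (a - 1), and the exponential in the
    constant is its value there; the factor 2 cancels the rate of the exponential density. *)
Lemma gamma_fun_le a y : 1 < a ->
  gamma_fun a y <= expR ((a - 1) * ln (2 * (a - 1)) - (a - 1)) * 2 * exponential_pdf 2^-1 y.
Proof.
move=> a1; have c0 : 0 < a - 1 by rewrite subr_gt0.
rewrite /gamma_fun; case: ifPn => [y0|_]; last first.
  by rewrite !mulr_ge0 ?expR_ge0// exponential_pdf_ge0.

rewrite (exponential_pdfE _ (ltW y0)) !mulrA mulfK// /powR gt_eqF// -!expRD ler_expR.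
have z0 : 0 < y / (2 * (a - 1)) by rewrite divr_gt0// mulr_gt0.
(* The bound is 1 + ln u <= u at u = y / (2 (a - 1)), multiplied by a - 1. *)
have := expR_ge1Dx (ln (y / (2 * (a - 1)))); rewrite lnK// ln_div ?posrE ?mulr_gt0//.
rewrite -subr_ge0 => h; rewrite -subr_ge0.
apply: (le_trans (mulr_ge0 (ltW c0) h)); rewrite le_eqVlt; apply/orP; left; apply/eqP.
by field; rewrite gt_eqF.
Qed.

Lemma gamma_fun_patch a : (fun y => (gamma_fun a y)%:E) =
  ((fun y => (y `^ (a - 1) * expR (- y))%:E) \_ `]0%R, +oo[)%E.
Proof.
apply/funext => y; rewrite patchE /gamma_fun; case: ifPn => y0.
  by rewrite ifT// inE/= in_itv/= andbT.
by rewrite ifF//; apply/negP; rewrite inE/= in_itv/= andbT; exact/negP.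
Qed.

Lemma integral_gamma_fun_lty (a : K) : 1 < a -> (\int[leb]_y (gamma_fun a y)%:E < +oo)%E.
Proof.
move=> a1; set c := expR ((a - 1) * ln (2 * (a - 1)) - (a - 1)) * 2.
have c0 : 0 <= c by rewrite mulr_ge0 ?expR_ge0.
have mpdf := @measurable_exponential_pdf K 2^-1.
apply: (@le_lt_trans _ _ (\int[leb]_y (c%:E * (exponential_pdf 2^-1 y)%:E))%E).
  apply: ge0_le_integral => //.
  - by move=> y _; rewrite lee_fin gamma_fun_ge0.
  - by apply/measurable_EFinP; exact: measurable_gamma_fun.
  - by apply/measurable_EFinP; exact: measurable_funM.
  - by move=> y _; rewrite -EFinM lee_fin gamma_fun_le.
rewrite ge0_integralZl_EFin//; last 2 first.
- by move=> y _; rewrite lee_fin exponential_pdf_ge0.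
- exact/measurable_EFinP.
by rewrite integral_exponential_pdf ?invr_gt0// mule1 ltry.
Qed.

(** [Gamma] takes [fine] of an extended integral, so it represents the integral only once finiteness
    is known. The range 1 < a contains all the shapes that occur, nu + 1 and nu + 1 + n / 2. *)
Lemma integral_gamma_fun (a : K) : 1 < a -> (\int[leb]_y (gamma_fun a y)%:E = (Gamma a)%:E)%E.
Proof.
move=> a1; rewrite /Gamma /Rintegral.
have -> : (\int[leb]_(y in `]0%R, +oo[) (y `^ (a - 1) * expR (- y))%:E =
    \int[leb]_y (gamma_fun a y)%:E)%E by rewrite gamma_fun_patch -integral_mkcond.
rewrite fineK// ge0_fin_numE; first exact: integral_gamma_fun_lty.
by apply: integral_ge0 => y _; rewrite lee_fin gamma_fun_ge0.
Qed.

Lemma Gamma_gt0 (a : K) : 1 < a -> 0 < Gamma a.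
Proof.
move=> a1; rewrite -lte_fin -integral_gamma_fun//.
(* On [1, 2] the integrand is at least e^(-2), because y^(a - 1) >= 1 there. *)
apply: (@lt_le_trans _ _ (\int[leb]_(y in `[1%R, 2%R]) (expR (- 2))%:E)%E).
  rewrite integral_cst//= lebesgue_measure_itv/= lte_fin ltr1n/= -EFinD -EFinM lte_fin.
  by rewrite mulr_gt0 ?expR_gt0// subr_gt0 ltr1n.
apply: (@le_trans _ _ (\int[leb]_(y in `[1%R, 2%R]) (gamma_fun a y)%:E)%E).
  apply: ge0_le_integral => //.
  - by apply/measurable_EFinP; apply: measurable_funTS; exact: measurable_gamma_fun.
  - move=> y; rewrite /= in_itv/= => /andP[y1 y2]; rewrite lee_fin /gamma_fun.
    rewrite (lt_le_trans ltr01 y1) -[leLHS]mul1r ler_pM ?expR_ge0 ?ler_expR ?lerN2//.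
    by rewrite -{1}(powRr0 y); apply: ler_powR => //; rewrite subr_ge0 ltW.
apply: ge0_subset_integral => //.
  by apply/measurable_EFinP; exact: measurable_gamma_fun.
by move=> y _; rewrite lee_fin gamma_fun_ge0.
Qed.

Lemma measurable_invgamma_pdf a b : measurable_fun setT (@invgamma_pdf K a b).
Proof.
apply: measurable_fun_ifT => //.
  by apply: measurable_fun_ltr => //; exact: measurable_cst.
apply: measurable_funM; first by apply: measurable_funM => //; exact: measurable_powR.
apply: measurableT_comp => //; apply: measurableT_comp; first exact: oppr_measurable.
by apply: measurable_funM => //; exact: measurable_inv.
Qed.

(** An inverse gamma variable is b divided by a gamma variable: the substitution x |-> b / x reduces
    the density to [gamma_fun a] up to the factor [Gamma a]. *)
Lemma integral_invgamma (a b : K) : 1 < a -> 0 < b ->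
  (\int[leb]_x (invgamma_pdf a b x)%:E = 1)%E.
Proof.
move=> a1 b0; have G0 := Gamma_gt0 a1.
transitivity (\int[leb]_x (((Gamma a)^-1)%:E *
   ((fun x => (gamma_fun a (b / x) * (b / x ^+ 2))%:E) \_ `]0%R, +oo[) x))%E.
  apply: eq_integral => x _; rewrite patchE /invgamma_pdf /gamma_fun; case: ifPn => x0.
    rewrite ifT; last by rewrite inE/= in_itv/= andbT.
    rewrite divr_gt0// -EFinM; congr EFin.
    rewrite powRM ?invr_ge0 ?ltW// -[x^-1]powR_inv1 ?ltW// -powRrM.
    have -> : b / x ^+ 2 = b `^ 1 * x `^ (- 2).
      by rewrite powRr1 ?ltW// powR_invn ?ltW.
    rewrite powR_inv1 ?ltW//.
    have -> : b `^ a = b `^ (a - 1) * b `^ 1 by rewrite -powRD ?subrK// (gt_eqF b0) implybT.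
    have -> : x `^ (- a - 1) = x `^ (-1 * (a - 1)) * x `^ (- 2).
      by rewrite -powRD ?(gt_eqF x0) ?implybT//; congr (_ `^ _); ring.
    by ring.
  rewrite ifF ?mule0//.
  by apply/negP; rewrite inE/= in_itv/= andbT; exact/negP.
have mg : measurable_fun (`]0, +oo[%classic : set K) (gamma_fun a).
  by apply: measurable_funTS; exact: measurable_gamma_fun.
have inv := integral_inversion b0 mg (@continuous_gamma_fun a) (gamma_fun_ge0 a).
have i1 : (\int[leb]_(x in `]0%R, +oo[) (gamma_fun a x)%:E = (Gamma a)%:E)%E.
  rewrite -integral_gamma_fun// [RHS](_ : _ = \int[leb]_x ((fun y => (gamma_fun a y)%:E) \_ `]0%R, +oo[) x)%E.
    by rewrite -integral_mkcond.
  apply: eq_integral => x _; rewrite patchE; case: ifPn => //.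
  rewrite notin_setE/= in_itv/= andbT => /negP x0.
  by rewrite /gamma_fun (negbTE x0).
rewrite ge0_integralZl_EFin//.
- by rewrite -integral_mkcond inv i1 -EFinM mulVf// gt_eqF.
- move=> x _; apply: erestrict_ge0 => {}x /=; rewrite in_itv/= andbT => x0.
  by rewrite lee_fin mulr_ge0 ?gamma_fun_ge0// divr_ge0 ?exprn_ge0// ltW.
- apply/(measurable_restrictT _ _).1 => //.
  apply: measurable_funTS; apply/measurable_EFinP; apply: measurable_funM.
    apply: measurableT_comp; first exact: measurable_gamma_fun.
    by apply: measurable_funM => //; exact: measurable_inv.
  apply: measurable_funM => //; apply: measurableT_comp; first exact: measurable_inv.
  exact: exprn_measurable.
- by rewrite invr_ge0 ltW.
Qed.

(** The factor x^(- n) e^(- c / x) is the Gaussian likelihood as a function of the variance, n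
    standing for half the number of observations; the constant is the ratio of the two normalising
    constants. *)
Lemma invgamma_conjugate (a b c n x : K) : 1 < a -> 0 < b -> 0 <= c -> 0 <= n ->
  invgamma_pdf a b x * (x `^ (- n) * expR (- (c / x))) =
  b `^ a * Gamma (a + n) / (Gamma a * (b + c) `^ (a + n)) *
  invgamma_pdf (a + n) (b + c) x :> K.
Proof.
move=> a1 b0 c0 n0; rewrite /invgamma_pdf; case: ifP => x0; last by rewrite mul0r mulr0.
have an1 : 1 < a + n by rewrite (lt_le_trans a1)// lerDl.
have G1 := Gamma_gt0 a1; have G2 := Gamma_gt0 an1.
have bc0 : 0 < (b + c) `^ (a + n) by rewrite powR_gt0// ltr_wpDr.
have -> : x `^ (- (a + n) - 1) = x `^ (- a - 1) * x `^ (- n).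
  by rewrite -powRD ?(gt_eqF x0) ?implybT//; congr (_ `^ _); ring.
have -> : expR (- ((b + c) / x)) = expR (- (b / x)) * expR (- (c / x)).
  by rewrite -expRD; congr expR; ring.
by field; rewrite !gt_eqF.
Qed.

End invgamma.

Section igp.
Context (K : realType).
Local Notation leb := (@lebesgue_measure K).
Local Open Scope ereal_scope.

Lemma invgamma_pdf_nneg (a b y : K) : (0 <= invgamma_pdf a b y)%R.
Proof.
rewrite /invgamma_pdf; case: ifP => // _.
rewrite !mulr_ge0 ?powR_ge0 ?expR_ge0// invr_ge0 /Gamma /Rintegral fine_ge0//.
by apply: integral_ge0 => x _; rewrite lee_fin mulr_ge0 ?powR_ge0 ?expR_ge0.
Qed.

Lemma mnormalizeE d (T : measurableType d) (mu : {measure set T -> \bar K})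
    (P : probability T K) (A : set T) : mu setT = 1 -> mnormalize mu P A = mu A.
Proof. by move=> mu1; rewrite /mnormalize mu1 onee_eq0/= invr1 mule1. Qed.

(* Normalizing makes this a probability for all parameters; the normalization is
   vacuous when [1 < a] and [0 < b]. *)
Definition igp0 (a b : K) : probability (measurableTypeR K) K :=
  mnormalize (dens leb (measurable_invgamma_pdf a b) (invgamma_pdf_nneg a b))
    (dirac (0%R : measurableTypeR K)).

Definition igp (a b : K) : probability K K := distribution (igp0 a b) (@idR K).

Lemma igpE (a b : K) (A : set K) : (1 < a)%R -> (0 < b)%R -> measurable A ->
  igp a b A = invgamma_law a b A.
Proof.
move=> a1 b0 mA; apply: mnormalizeE; exact: integral_invgamma.
Qed.

Lemma integral_igp (a b : K) (f : K -> \bar K) : (1 < a)%R -> (0 < b)%R ->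
  measurable_fun setT f -> (forall x, 0 <= f x) ->
  \int[igp a b]_x f x = \int[leb]_x (f x * (invgamma_pdf a b x)%:E).
Proof.
move=> a1 b0 mf f0.
have mw := measurable_invgamma_pdf a b; have w0 := invgamma_pdf_nneg a b.
rewrite -(integral_dens leb mw w0 mf f0).
transitivity (\int[igp0 a b]_x f x); first exact: (integral_image _ (@measurable_idR K)).
by apply: eq_measure_integral => A mA _; exact: igpE.
Qed.

(** An inverse gamma law charges only the positive numbers. This lets identities proved for a
    positive variance, such as [conjugacy_fixed], be integrated. *)
Lemma eq_integral_igp (a b : K) (f g : K -> \bar K) : (1 < a)%R -> (0 < b)%R ->
  measurable_fun setT f -> (forall x, 0 <= f x) ->
  measurable_fun setT g -> (forall x, 0 <= g x) ->
  (forall x, (0 < x)%R -> f x = g x) ->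
  \int[igp a b]_x f x = \int[igp a b]_x g x.
Proof.
move=> a1 b0 mf f0 mg g0 fg; rewrite !integral_igp//; apply: eq_integral => x _.
by rewrite /invgamma_pdf; case: ifPn => [/fg ->//|_]; rewrite !mule0.
Qed.

Lemma igp_conjugate (a b c n : K) (f : K -> \bar K) : (1 < a)%R -> (0 < b)%R ->
  (0 <= c)%R -> (0 <= n)%R ->
  measurable_fun setT f -> (forall x, 0 <= f x) ->
  \int[igp a b]_x (f x * (x `^ (- n) * expR (- (c / x)))%:E) =
  (b `^ a * Gamma (a + n) / (Gamma a * (b + c) `^ (a + n)))%:E *
  \int[igp (a + n) (b + c)]_x f x.
Proof.
move=> a1 b0 c0 n0 mf f0.
have an1 : (1 < a + n)%R by rewrite (lt_le_trans a1)// lerDl.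
have bc0 : (0 < b + c)%R by rewrite ltr_wpDr.
have mk : measurable_fun setT (fun x : K => (x `^ (- n) * expR (- (c / x)))%:E).
  apply/measurable_EFinP; apply: measurable_funM; first exact: measurable_powR.
  apply: measurableT_comp => //; apply: measurableT_comp; first exact: oppr_measurable.
  by apply: measurable_funM => //; exact: measurable_inv.
have k0 (x : K) : (0 <= x `^ (- n) * expR (- (c / x)))%R by rewrite mulr_ge0 ?powR_ge0 ?expR_ge0.
have mfk : measurable_fun setT (fun x : K => f x * (x `^ (- n) * expR (- (c / x)))%:E).
  exact: emeasurable_funM.
have fk0 x : 0 <= f x * (x `^ (- n) * expR (- (c / x)))%:E.
  by apply: mule_ge0; rewrite ?lee_fin.
etransitivity; first exact: (integral_igp a1 b0 mfk fk0).
rewrite (integral_igp an1 bc0 mf f0) -ge0_integralZl.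
- apply: eq_integral => x _; rewrite -muleA [RHS]muleCA; congr (_ * _).
  by rewrite -!EFinM mulrC invgamma_conjugate.
- exact: measurableT.
- apply: emeasurable_funM => //; apply/measurable_EFinP; exact: measurable_invgamma_pdf.
- by move=> x _; rewrite mule_ge0// lee_fin invgamma_pdf_nneg.
- rewrite lee_fin divr_ge0// mulr_ge0 ?powR_ge0// ltW// Gamma_gt0//.
Qed.

End igp.

(** * Conjugacy in the linear model *)

Section regression_algebra.
Context (K : realType) (n G : nat) (X : 'M[K]_(n, G)) (lam : 'I_G -> K).
Hypothesis lam0 : forall g, 0 < lam g.

Let L : 'M[K]_G := diag_mx (\row_g lam g).
Let A : 'M[K]_G := X^T *m X + L.

Definition reg_mean (y : 'cV[K]_n) : 'cV[K]_G := invmx A *m X^T *m y.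
(** By [reg_square], half of the minimum over t of |y - X t|^2 + sum_g lam_g t_g^2, attained at
    [reg_mean y]. *)
Definition reg_rss (y : 'cV[K]_n) : K :=
  2^-1 * ((y^T *m y) 0 0 - ((reg_mean y)^T *m A *m reg_mean y) 0 0).

Lemma quad_diag (x : 'cV[K]_G) : (x^T *m L *m x) 0 0 = \sum_g lam g * x g 0 ^+ 2.
Proof.
rewrite -mulmxA mxE; apply: eq_bigr => g _; rewrite mxE mul_diag_mx !mxE.
by rewrite expr2 mulrCA.
Qed.

Lemma quad_sqn m (B : 'M[K]_(m, G)) (x : 'cV[K]_G) :
  (x^T *m (B^T *m B) *m x) 0 0 = sqn (B *m x).
Proof. by rewrite /sqn -mulmx_tr_diag trmx_mul !mulmxA. Qed.

Lemma reg_posdef : posdef A.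
Proof.
split; first by rewrite linearD/= trmx_mul trmxK tr_diag_mx.
move=> x x0; rewrite mulmxDr mulmxDl mxE quad_sqn quad_diag.
have [g xg] : exists g, x g 0 != 0.
  apply/existsP; apply: contra_neqT x0; rewrite negb_exists => /forallP h.
  by apply/colP => g; rewrite mxE; apply/eqP; have := h g; rewrite negbK.
rewrite ltr_wpDl//; first by apply: sumr_ge0 => i _; exact: sqr_ge0.
rewrite (bigD1 g)//= ltr_wpDr//.
  by apply: sumr_ge0 => i _; rewrite mulr_ge0 ?sqr_ge0// ltW.
by rewrite mulr_gt0// lt_def sqr_ge0 sqrf_eq0 xg.
Qed.

Lemma reg_unit : A \in unitmx.
Proof. exact: posdef_unit reg_posdef. Qed.

(** Completing the square: the normal equations A m = X^T y, with m the mean, make the terms linear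
    in t match. *)
Lemma reg_square (y : 'cV[K]_n) (t : 'cV[K]_G) :
  sqn (y - X *m t) + \sum_g lam g * t g 0 ^+ 2 =
  2 * reg_rss y + ((t - reg_mean y)^T *m A *m (t - reg_mean y)) 0 0.
Proof.
set m := reg_mean y.
have eD (B C : 'M[K]_1) : (B + C) 0 0 = B 0 0 + C 0 0 by rewrite mxE.
have eN (B : 'M[K]_1) : (- B) 0 0 = - B 0 0 by rewrite mxE.
have Am : A *m m = X^T *m y by rewrite /m /reg_mean !mulmxA mulmxV ?mul1mx// reg_unit.
have mA : m^T *m A = y^T *m X.
  by have := congr1 trmx Am; rewrite !trmx_mul trmxK; have [-> _] := reg_posdef.
have tAm : t^T *m A *m m = t^T *m X^T *m y by rewrite -mulmxA Am mulmxA.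
rewrite /reg_rss mulrA divff// mul1r -/m.
have -> : ((t - m)^T *m A *m (t - m)) 0 0 =
    (t^T *m A *m t) 0 0 - (t^T *m X^T *m y) 0 0 - (y^T *m X *m t) 0 0 + (m^T *m A *m m) 0 0.
  have -> : (t - m)^T = t^T - m^T by rewrite linearB.
  by rewrite mulmxBr !mulmxBl tAm mA !(eD, eN); ring.
rewrite -quad_diag; have -> : sqn (y - X *m t) = (y^T *m y) 0 0 - (t^T *m X^T *m y) 0 0
   - (y^T *m X *m t) 0 0 + (t^T *m (X^T *m X) *m t) 0 0.
  rewrite /sqn -mulmx_tr_diag; have -> : (y - X *m t)^T = y^T - t^T *m X^T by rewrite linearB/= trmx_mul.
  by rewrite mulmxBl !mulmxBr !mulmxA !(eD, eN); ring.
have -> : (t^T *m A *m t) 0 0 = (t^T *m (X^T *m X) *m t) 0 0 + (t^T *m L *m t) 0 0.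
  by rewrite mulmxDr mulmxDl mxE.
by ring.
Qed.

(** At t = [reg_mean y] the last term of [reg_square] vanishes, and a sum of squares with positive
    weights remains. *)
Lemma reg_rss_ge0 (y : 'cV[K]_n) : 0 <= reg_rss y.
Proof.
have := reg_square y (reg_mean y); rewrite subrr mulmx0 [(0 : 'M[K]_(1, 1)) 0 0]mxE addr0 => h.
rewrite -(pmulr_rge0 _ (ltr0n _ 2)) -h addr_ge0//.
  by apply: sumr_ge0 => i _; exact: sqr_ge0.
by apply: sumr_ge0 => i _; rewrite mulr_ge0 ?sqr_ge0// ltW.
Qed.

End regression_algebra.

Section conjugacy.
Local Open Scope ereal_scope.
Context (K : realType) (n G : nat) (X : 'M[K]_(n, G)) (lam : 'I_G -> K) (T : 'M[K]_G).
Hypotheses (lam0 : forall g, (0 < lam g)%R) (trT : is_trig_mx T)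
  (T0 : forall g, (0 < T g g)%R)
  (TA : T^T *m T = (X^T *m X + diag_mx (\row_g lam g))%R).

Definition prior_coef (s : K) (e : G.-tuple K) : 'cV[K]_G :=
  \col_g (Num.sqrt (s / lam g) * tnth e g)%R.

(** The covariance of T^(-1) e is (T^T T)^(-1), so for standard Gaussian [e] this is a draw from the
    normal law with mean [reg_mean] and covariance s times the inverse of the posterior
    precision. *)
Definition post_coef (s : K) (y : n.-tuple K) (e : G.-tuple K) : 'cV[K]_G :=
  (reg_mean X lam (colt y) + Num.sqrt s *: (invmx T *m colt e))%R.

(** The part of the density of y, relative to the standard Gaussian law, that is free of s. The two
    products are the square roots of the determinants of the prior and posterior precision
    matrices. *)
Definition reg_weight (y : n.-tuple K) : K :=
  ((\prod_g Num.sqrt (lam g)) / (\prod_g T g g) * expR (sqn (colt y) / 2))%R.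

Lemma sqnZ m (r : K) (v : 'cV[K]_m) : sqn (r *: v)%R = (r ^+ 2 * sqn v)%R.
Proof. by rewrite /sqn mulr_sumr; apply: eq_bigr => i _; rewrite mxE exprMn. Qed.

Lemma measurable_sqrt : measurable_fun setT (@Num.sqrt K).
Proof. by apply: continuous_measurable_fun; exact: sqrt_continuous. Qed.

Lemma measurable_prior_coef : mx_measurable (fun p : K * G.-tuple K => prior_coef p.1 p.2).
Proof.
move=> i j; under eq_fun do rewrite mxE; apply: measurable_funM.
  apply: (measurableT_comp (f := fun x : K => Num.sqrt (x / lam i)) (g := fst)) => //.
  by apply: measurableT_comp; [exact: measurable_sqrt|exact: measurable_funM].
by apply: (measurableT_comp (f := fun t => tnth t i) (g := snd)) => //; exact: measurable_tnth.
Qed.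

Lemma measurable_post_coef :
  mx_measurable (fun p : K * n.-tuple K * G.-tuple K => post_coef p.1.1 p.1.2 p.2).
Proof.
apply: mx_measurableD.
  apply: mx_measurableM; first exact: mx_measurable_cst.
  apply: mx_measurable_colt; exact: (measurableT_comp measurable_snd measurable_fst).
apply: mx_measurableZ.
  apply: (measurableT_comp measurable_sqrt); exact: (measurableT_comp measurable_fst measurable_fst).
by apply: mx_measurableM; [exact: mx_measurable_cst|exact: mx_measurable_colt].
Qed.

(** The density of N(c, s I) relative to the standard Gaussian law, from [gauss_change] with a
    scalar matrix. *)
Lemma gauss_shift (m : nat) (s : K) (c : 'cV[K]_m) (f : m.-tuple K -> \bar K) : (0 < s)%R ->
  measurable_fun setT f -> (forall t, 0 <= f t) ->
  \int[gauss K m]_u f (tofc (c + Num.sqrt s *: colt u)%R) =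
  \int[gauss K m]_y (f y *
    ((Num.sqrt s)^-1 ^+ m * expR (- sqn (colt y - c) / (2 * s) + sqn (colt y) / 2))%:E).
Proof.
move=> s0 mf f0; set r := Num.sqrt s.
have r0 : (0 < r)%R by rewrite sqrtr_gt0.
have mg : measurable_fun setT (fun u : m.-tuple K => f (tofc (c + r *: colt u)%R)).
  apply: (measurableT_comp mf); apply: measurable_tofc; apply: mx_measurableD.
    exact: mx_measurable_cst.
  by apply: mx_measurableZ => //; exact: mx_measurable_colt.
have trS : is_trig_mx (r^-1%:M : 'M[K]_m) by exact: scalar_mx_is_trig.
have S0 i : (0 < (r^-1%:M : 'M[K]_m) i i)%R by rewrite mxE eqxx mulr1n invr_gt0.
have := @gauss_change K m (r^-1%:M) (r^-1 *: c)%R _ trS S0 mg (fun t => f0 _).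
move=> <-; apply: eq_integral => y _.
rewrite mul_scalar_mx tofcK -scalerBr scalerA divff ?gt_eqF// scale1r addrC subrK coltK.
congr (_ * (_ * expR _)%:E).
  under eq_bigr do rewrite mxE eqxx mulr1n.
  by rewrite prodr_const card_ord.
by rewrite sqnZ exprVn sqr_sqrtr ?ltW//; field; rewrite gt_eqF.
Qed.

Lemma gauss_scale (s : K) (f : G.-tuple K -> \bar K) : (0 < s)%R ->
  measurable_fun setT f -> (forall t, 0 <= f t) ->
  \int[gauss K G]_e f (tofc (prior_coef s e)) =
  \int[gauss K G]_t (f t * ((\prod_g Num.sqrt (lam g)) * (Num.sqrt s)^-1 ^+ G *
     expR (- (\sum_g lam g * tnth t g ^+ 2) / (2 * s) + sqn (colt t) / 2))%:E).
Proof.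
move=> s0 mf f0; set r := Num.sqrt s.
have r0 : (0 < r)%R by rewrite sqrtr_gt0.
have l0 g : (0 < Num.sqrt (lam g))%R by rewrite sqrtr_gt0.
have mg : measurable_fun setT (fun e : G.-tuple K => f (tofc (prior_coef s e))).
  apply: (measurableT_comp mf); apply: measurable_tofc => i j.
  under eq_fun do rewrite mxE; apply: measurable_funM => //; exact: measurable_tnth.
pose D : 'M[K]_G := diag_mx (\row_g (Num.sqrt (lam g) / r))%R.
have trD : is_trig_mx D by exact: diag_mx_is_trig.
have DE i : D i i = (Num.sqrt (lam i) / r)%R by rewrite !mxE eqxx mulr1n.
have D0 i : (0 < D i i)%R by rewrite DE divr_gt0.
rewrite -(@gauss_change K G D 0%R _ trD D0 mg (fun t => f0 _)).
apply: eq_integral => t _; congr (f _ * (_ * expR _)%:E).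
- apply: eq_from_tnth => g; rewrite !tnth_mktuple mxE tnth_mktuple subr0.
  rewrite mul_diag_mx !mxE sqrtrM ?ltW// sqrtrV ?ltW// -/r.
  by field; rewrite !gt_eqF.
- under eq_bigr do rewrite DE.
  by rewrite big_split/= prodr_const card_ord.
- rewrite subr0; have -> : sqn (D *m colt t) = ((\sum_g lam g * tnth t g ^+ 2) / s)%R.
    rewrite /sqn mulr_suml; apply: eq_bigr => g _.
    rewrite mul_diag_mx !mxE !exprMn exprVn !sqr_sqrtr ?ltW//; ring.
  by field; rewrite gt_eqF.
Qed.

Let mu y := reg_mean X lam (colt (y : n.-tuple K)).
Let rss y := reg_rss X lam (colt (y : n.-tuple K)).

(** The substitution is the inverse of [post_coef s y]; its matrix T / sqrt s is triangular and
    turns the quadratic form of the posterior precision, divided by s, into a squared norm. *)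
Lemma gauss_post (s : K) (y : n.-tuple K) (f : G.-tuple K -> \bar K) : (0 < s)%R ->
  measurable_fun setT f -> (forall t, 0 <= f t) ->
  \int[gauss K G]_e f (tofc (post_coef s y e)) =
  \int[gauss K G]_t (f t * ((\prod_g T g g) * (Num.sqrt s)^-1 ^+ G *
     expR (- ((colt t - mu y)^T *m (T^T *m T) *m (colt t - mu y)) 0 0 / (2 * s) + sqn (colt t) / 2))%:E).
Proof.
move=> s0 mf f0; set r := Num.sqrt s.
have r0 : (0 < r)%R by rewrite sqrtr_gt0.
have uT : T \in unitmx by exact: posdef_factor_unit.
have mg : measurable_fun setT (fun e : G.-tuple K => f (tofc (post_coef s y e))).
  apply: (measurableT_comp mf); apply: measurable_tofc; apply: mx_measurableD.
    exact: mx_measurable_cst.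
  apply: mx_measurableZ => //; apply: mx_measurableM; first exact: mx_measurable_cst.
  exact: mx_measurable_colt.
pose D : 'M[K]_G := (r^-1 *: T)%R.
have trD : is_trig_mx D.
  by apply/is_trig_mxP => i j ij; rewrite mxE (is_trig_mxP trT) ?mulr0.
have DE i : D i i = (T i i * r^-1)%R by rewrite !mxE mulrC.
have D0 i : (0 < D i i)%R by rewrite DE divr_gt0.
rewrite -(@gauss_change K G D (D *m mu y)%R _ trD D0 mg (fun t => f0 _)).
have E t : (D *m colt t - D *m mu y = r^-1 *: (T *m (colt t - mu y)))%R.
  by rewrite -mulmxBr -scalemxAl.
apply: eq_integral => t _; congr (f _ * (_ * expR _)%:E).
- rewrite /post_coef tofcK E -scalemxAr scalerA divff ?gt_eqF// scale1r mulKmx//.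
  by rewrite addrC subrK coltK.
- under eq_bigr do rewrite DE.
  by rewrite big_split/= prodr_const card_ord.
- rewrite E sqnZ exprVn sqr_sqrtr ?ltW// quad_sqn.
  by field; rewrite gt_eqF.
Qed.

(** The laws of the errors, of the prior and of the posterior coefficients are replaced by their
    densities relative to standard Gaussian laws, and the order of integration is exchanged. What
    remains is a pointwise identity between exponents, which is [reg_square]. *)
Lemma conjugacy_fixed (s : K) (f : G.-tuple K * n.-tuple K -> \bar K) : (0 < s)%R ->
  measurable_fun setT f -> (forall t, 0 <= f t) ->
  \int[gauss K G]_e \int[gauss K n]_u
     f (tofc (prior_coef s e), tofc (X *m prior_coef s e + Num.sqrt s *: colt u)%R) =
  \int[gauss K n]_y ((reg_weight y * (s `^ (- (n%:R / 2)) * expR (- (rss y / s))))%:E *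
     \int[gauss K G]_e f (tofc (post_coef s y e), y)).
Proof.
move=> s0 mf f0; set r := Num.sqrt s.
have r0 : (0 < r)%R by rewrite sqrtr_gt0.
pose w1 (p : G.-tuple K * n.-tuple K) : K := (r^-1 ^+ n *
  expR (- sqn (colt p.2 - X *m colt p.1) / (2 * s) + sqn (colt p.2) / 2))%R.
have mw1 : measurable_fun setT w1.
  apply: measurable_funM => //; apply: measurableT_comp => //; apply: measurable_funD.
    apply: measurable_funM => //; apply: measurableT_comp; first exact: oppr_measurable.
    apply: measurable_sqn; apply: mx_measurableB; first exact: mx_measurable_colt.
    by apply: mx_measurableM; [exact: mx_measurable_cst|exact: mx_measurable_colt].
  by apply: measurable_funM => //; apply: measurable_sqn; exact: mx_measurable_colt.
have w10 p : (0 <= w1 p)%R by rewrite mulr_ge0 ?expR_ge0// exprn_ge0// invr_ge0 ltW.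
pose w2 (t : G.-tuple K) : K := ((\prod_g Num.sqrt (lam g)) * r^-1 ^+ G *
     expR (- (\sum_g lam g * tnth t g ^+ 2) / (2 * s) + sqn (colt t) / 2))%R.
have mw2 : measurable_fun setT w2.
  apply: measurable_funM => //; apply: measurableT_comp => //; apply: measurable_funD.
    apply: measurable_funM => //; apply: measurableT_comp; first exact: oppr_measurable.
    apply: measurable_sum => g; apply: measurable_funM => //; apply: measurable_funX.
    exact: measurable_tnth.
  by apply: measurable_funM => //; apply: measurable_sqn; exact: mx_measurable_colt.
have l0 : (0 <= \prod_g Num.sqrt (lam g))%R by rewrite prodr_ge0// => g _; exact: sqrtr_ge0.
have w20 t : (0 <= w2 t)%R.
  by rewrite !mulr_ge0 ?expR_ge0// exprn_ge0// invr_ge0 ltW.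
have mfw : measurable_fun setT (fun p => f p * (w1 p)%:E).
  by apply: emeasurable_funM => //; exact/measurable_EFinP.
have fw0 p : 0 <= f p * (w1 p)%:E by rewrite mule_ge0// lee_fin.
have f2 t : measurable_fun setT (fun y => f (t, y)) by exact: measurableT_comp.
pose h (t : G.-tuple K) := \int[gauss K n]_y (f (t, y) * (w1 (t, y))%:E).
have mh : measurable_fun setT h by exact: (measurable_fun_fubini_tonelli_F _ mfw fw0).
have h0 t : 0 <= h t by apply: integral_ge0 => y _; exact: fw0.
transitivity (\int[gauss K G]_e h (tofc (prior_coef s e))).
  apply: eq_integral => e _.
  rewrite (gauss_shift _ s0 (f2 _) (fun=> f0 _)); apply: eq_integral => y _.
  by rewrite /w1/= tofcK.
rewrite (gauss_scale s0 mh h0).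
pose F p := f p * (w1 p)%:E * (w2 p.1)%:E.
have mF : measurable_fun setT F.
  apply: emeasurable_funM => //; apply/measurable_EFinP.
  exact: (measurableT_comp mw2 measurable_fst).
have F0 p : 0 <= F p by rewrite /F mule_ge0// lee_fin.
transitivity (\int[gauss K G]_t \int[gauss K n]_y F (t, y)).
  apply: eq_integral => t _; rewrite /h -/(w2 t) -ge0_integralZr//.
    exact: (measurableT_comp mfw (pair1_measurable t)).
  by rewrite lee_fin.
rewrite (fubini_tonelli F mF F0); apply: eq_integral => y _.
have f1 : measurable_fun setT (fun t => f (t, y)) by exact: measurableT_comp.
rewrite (gauss_post y s0 f1 (fun=> f0 _)).
pose w3 (t : G.-tuple K) : K := ((\prod_g T g g) * r^-1 ^+ G *
  expR (- ((colt t - mu y)^T *m (T^T *m T) *m (colt t - mu y)) 0 0 / (2 * s) + sqn (colt t) / 2))%R.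
have mw3 : measurable_fun setT w3.
  apply: measurable_funM => //; apply: measurableT_comp => //; apply: measurable_funD.
    apply: measurable_funM => //; apply: measurableT_comp; first exact: oppr_measurable.
    have m1 : mx_measurable (fun t : G.-tuple K => colt t - mu y)%R.
      by apply: mx_measurableB; [exact: mx_measurable_colt|exact: mx_measurable_cst].
    have m2 : mx_measurable (fun t : G.-tuple K => (colt t - mu y)^T *m (T^T *m T))%R.
      by apply: mx_measurableM; [exact: mx_measurable_tr|exact: mx_measurable_cst].
    exact: (mx_measurableM m2 m1).
  by apply: measurable_funM => //; apply: measurable_sqn; exact: mx_measurable_colt.
have t0 : (0 < \prod_g T g g)%R by apply: prodr_gt0.
have w30 t : (0 <= w3 t)%R.
  by rewrite !mulr_ge0 ?expR_ge0 ?(ltW t0)// exprn_ge0// invr_ge0 ltW.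
rewrite -[RHS]ge0_integralZl//; last 3 first.
- by apply: emeasurable_funM => //; exact/measurable_EFinP.
- by move=> t _; rewrite mule_ge0// lee_fin w30.
- rewrite lee_fin !mulr_ge0 ?expR_ge0 ?powR_ge0// invr_ge0 ltW//.
apply: eq_integral => t _; rewrite /F [RHS]muleCA -muleA; congr (_ * _).
rewrite -!EFinM -/(w3 t); congr EFin; rewrite /w1 /w2 /w3 /reg_weight /=.
have sq := reg_square X lam0 (colt y) (colt t); rewrite -/(mu y) -/(rss y) -TA in sq.
have -> : (s `^ (- (n%:R / 2)) = r^-1 ^+ n)%R.
  by rewrite powRN [(n%:R / 2)%R]mulrC powRrM (powR12_sqrt (ltW s0)) powR_mulrn ?(ltW r0)// exprVn.
set q := fun_of_matrix ((colt t - mu y)^T *m _ *m _)%R _ _ in sq *.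
(* [reg_square] trades the squared residual for [rss], the posterior form [q] and the prior form. *)
have -> : (- sqn (colt y - X *m colt t) / (2 * s) + sqn (colt y) / 2 =
  - (2 * rss y + q - \sum_g lam g * tnth t g ^+ 2) / (2 * s) + sqn (colt y) / 2)%R.
  congr (- _ / _ + _)%R; rewrite -sq -addrA -[LHS]addr0; congr (_ + _)%R.
  by rewrite -sumrB big1// => g _; rewrite mxE subrr.
set q2 := (\sum_g _)%R.
transitivity ((r^-1 ^+ n * r^-1 ^+ G * \prod_g Num.sqrt (lam g)) *
  (expR (- (2 * rss y + q - q2) / (2 * s) + sqn (colt y) / 2) *
   expR (- q2 / (2 * s) + sqn (colt t) / 2)))%R; first by ring.
transitivity ((r^-1 ^+ n * r^-1 ^+ G * \prod_g Num.sqrt (lam g)) *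
  (expR (sqn (colt y) / 2) * expR (- (rss y / s)) * expR (- q / (2 * s) + sqn (colt t) / 2)))%R.
  by congr (_ * _)%R; rewrite -!expRD; congr expR; field; rewrite gt_eqF.
by field; rewrite !gt_eqF.
Qed.

End conjugacy.

Section node_law.
Local Open Scope ereal_scope.
Context (K : realType) (n G : nat) (X : 'M[K]_(n, G)) (lam : 'I_G -> K) (T : 'M[K]_G).
Hypotheses (lam0 : forall g, (0 < lam g)%R) (trT : is_trig_mx T)
  (T0 : forall g, (0 < T g g)%R)
  (TA : T^T *m T = (X^T *m X + diag_mx (\row_g lam g))%R).
Variables (a b : K).
Hypotheses (a1 : (1 < a)%R) (b0 : (0 < b)%R).

Let rss y := reg_rss X lam (colt (y : n.-tuple K)).

(** The marginal density of the data relative to the standard Gaussian law; the second factor is the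
    constant of [igp_conjugate]. *)
Definition node_density (y : n.-tuple K) : K :=
  (reg_weight lam T y * (b `^ a * Gamma (a + n%:R / 2) /
    (Gamma a * (b + rss y) `^ (a + n%:R / 2))))%R.

Definition post_int (y : n.-tuple K) (f : K * G.-tuple K -> \bar K) : \bar K :=
  \int[igp (a + n%:R / 2) (b + rss y)]_s
    \int[gauss K G]_e f (s, tofc (post_coef X lam T s y e)).

Definition post_inner (f : K * (G.-tuple K * n.-tuple K) -> \bar K) (p : K * n.-tuple K) :=
  \int[gauss K G]_e f (p.1, (tofc (post_coef X lam T p.1 p.2 e), p.2)).

Lemma measurable_post_inner f : measurable_fun setT f -> (forall t, 0 <= f t) ->
  measurable_fun setT (post_inner f).
Proof.
move=> mf f0.
pose g (q : (K * n.-tuple K) * G.-tuple K) :=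
  (q.1.1, (tofc (post_coef X lam T q.1.1 q.1.2 q.2), q.1.2)).
have mg : measurable_fun setT g.
  apply: measurable_fun_pair; first exact: (measurableT_comp measurable_fst measurable_fst).
  apply: measurable_fun_pair; last exact: (measurableT_comp measurable_snd measurable_fst).
  by apply: measurable_tofc; exact: measurable_post_coef.
by apply: (measurable_fun_fubini_tonelli_F (f \o g)); [exact: measurableT_comp|move=> q; exact: f0].
Qed.

Lemma measurable_rss : measurable_fun setT rss.
Proof.
apply: measurable_funM => //.
have mc := @mx_measurable_colt K _ _ n _ (@measurable_id _ (n.-tuple K) setT).
have mm : mx_measurable (fun y : n.-tuple K => reg_mean X lam (colt y)).
  by apply: mx_measurableM => //; exact: mx_measurable_cst.
apply: measurable_funB.
  exact: (mx_measurableM (mx_measurable_tr mc) mc).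
apply: (mx_measurableM _ mm); apply: mx_measurableM; first exact: mx_measurable_tr.
exact: mx_measurable_cst.
Qed.

Lemma measurable_node_density : measurable_fun setT node_density.
Proof.
apply: measurable_funM.
  apply: measurable_funM => //; apply: measurableT_comp => //; apply: measurable_funM => //.
  by apply: measurable_sqn; exact: mx_measurable_colt.
apply: measurable_funM => //; apply: (measurableT_comp (@measurable_inv K)).
apply: measurable_funM => //; apply: (measurableT_comp (measurable_powR _)).
by apply: measurable_funD => //; exact: measurable_rss.
Qed.

Let an1 : (1 < a + n%:R / 2)%R.
Proof. by rewrite (lt_le_trans a1)// lerDl divr_ge0. Qed.

Let br0 y : (0 < b + rss y)%R.
Proof. by rewrite ltr_wpDr//; exact: reg_rss_ge0. Qed.

Lemma reg_weight_gt0 (y : n.-tuple K) : (0 < reg_weight lam T y)%R.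
Proof.
rewrite mulr_gt0 ?expR_gt0// divr_gt0//; last exact: prodr_gt0.
by apply: prodr_gt0 => g _; rewrite sqrtr_gt0.
Qed.

Lemma node_density_gt0 y : (0 < node_density y)%R.
Proof.
rewrite mulr_gt0 ?reg_weight_gt0// divr_gt0// mulr_gt0 ?powR_gt0// ?Gamma_gt0//.
Qed.

(** Two disintegrations of one joint law: variance, coefficients, then data on the left; data, then
    variance and coefficients on the right. [conjugacy_fixed] is applied under the integral over s,
    and [igp_conjugate] then turns the remaining factor in s into the posterior of s. *)
Lemma node_conjugacy (f : K * (G.-tuple K * n.-tuple K) -> \bar K) :
  measurable_fun setT f -> (forall t, 0 <= f t) ->
  \int[igp a b]_s \int[gauss K G]_e \int[gauss K n]_u
     f (s, (tofc (prior_coef lam s e), tofc (X *m prior_coef lam s e + Num.sqrt s *: colt u)%R)) =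
  \int[gauss K n]_y ((node_density y)%:E * post_int y (fun q => f (q.1, (q.2, y)))).
Proof.
move=> mf f0.
pose k (p : K * n.-tuple K) : K :=
  (reg_weight lam T p.2 * (p.1 `^ (- (n%:R / 2)) * expR (- (rss p.2 / p.1))))%R.
have k0 p : (0 <= k p)%R.
  by rewrite mulr_ge0 ?(ltW (reg_weight_gt0 _))// mulr_ge0 ?powR_ge0 ?expR_ge0.
have mk : measurable_fun setT k.
  apply: measurable_funM.
    apply: measurable_funM => //; apply: measurableT_comp => //; apply: measurable_funM => //.
    by apply: measurable_sqn; exact: mx_measurable_colt.
  apply: measurable_funM; first exact: (measurableT_comp (measurable_powR _) measurable_fst).
  apply: measurableT_comp => //; apply: measurableT_comp; first exact: oppr_measurable.
  apply: measurable_funM; first exact: (measurableT_comp measurable_rss measurable_snd).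
  exact: (measurableT_comp (@measurable_inv K) measurable_fst).
have mC := measurable_post_inner mf f0.
have C0 p : 0 <= post_inner f p by apply: integral_ge0 => e _; exact: f0.
pose F p := (k p)%:E * post_inner f p.
have mF : measurable_fun setT F.
  by apply: emeasurable_funM => //; exact/measurable_EFinP.
have F0 p : 0 <= F p by rewrite mule_ge0// lee_fin.
transitivity (\int[igp a b]_s \int[gauss K n]_y F (s, y)).
  pose g (q : (K * G.-tuple K) * n.-tuple K) := (q.1.1,
    (tofc (prior_coef lam q.1.1 q.1.2),
     tofc (X *m prior_coef lam q.1.1 q.1.2 + Num.sqrt q.1.1 *: colt q.2)%R)).
  have mpc : mx_measurable (fun q : (K * G.-tuple K) * n.-tuple K => prior_coef lam q.1.1 q.1.2).
    by move=> i j; exact: (measurableT_comp (measurable_prior_coef lam i j) measurable_fst).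
  have mg : measurable_fun setT g.
    apply: measurable_fun_pair; first exact: (measurableT_comp measurable_fst measurable_fst).
    apply: measurable_fun_pair; apply: measurable_tofc => //.
    apply: mx_measurableD; first by apply: mx_measurableM => //; exact: mx_measurable_cst.
    apply: mx_measurableZ; last exact: mx_measurable_colt.
    apply: (measurableT_comp (@measurable_sqrt K)).
    exact: (measurableT_comp measurable_fst measurable_fst).
  have mfg : measurable_fun setT (f \o g) by exact: measurableT_comp.
  have m1 : measurable_fun setT (fun q : K * G.-tuple K => \int[gauss K n]_u (f \o g) (q, u)).
    by apply: (measurable_fun_fubini_tonelli_F (f \o g)) => // q; exact: f0.
  apply: eq_integral_igp => //.
  - apply: (measurable_fun_fubini_tonelli_F (fun q : K * G.-tuple K => \int[gauss K n]_u (f \o g) (q, u))) => // q.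
    by apply: integral_ge0 => u _; exact: f0.
  - by move=> s; apply: integral_ge0 => e _; apply: integral_ge0 => u _; exact: f0.
  - exact: (measurable_fun_fubini_tonelli_F F).
  - by move=> s; apply: integral_ge0 => y _.
  - move=> s s0; have mfs : measurable_fun setT (fun p => f (s, p)) by exact: measurableT_comp.
    exact: (conjugacy_fixed lam0 trT T0 TA s0 mfs (fun=> f0 _)).
rewrite (fubini_tonelli F mF F0); apply: eq_integral => y _.
have mCy : measurable_fun setT (fun s => post_inner f (s, y)) by exact: measurableT_comp.
transitivity ((reg_weight lam T y)%:E * \int[igp a b]_s (post_inner f (s, y) *
    (s `^ (- (n%:R / 2)) * expR (- (rss y / s)))%:E)).
  rewrite -ge0_integralZl//.
  - by apply: eq_integral => s _; rewrite /F /k/= EFinM -muleA [X in _ = _ * X]muleC.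
  - apply: emeasurable_funM => //; apply/measurable_EFinP; apply: measurable_funM.
      exact: measurable_powR.
    apply: measurableT_comp => //; apply: measurableT_comp; first exact: oppr_measurable.
    by apply: measurable_funM => //; exact: measurable_inv.
  - by move=> s _; rewrite mule_ge0// lee_fin mulr_ge0 ?powR_ge0 ?expR_ge0.
  - by rewrite lee_fin ltW// reg_weight_gt0.
rewrite [X in _ * X](igp_conjugate a1 b0 (reg_rss_ge0 X lam0 (colt y)) _ mCy (fun=> C0 _)); last first.
  by rewrite divr_ge0.
by rewrite muleA -EFinM.
Qed.

End node_law.

(** * Markov trees *)

Section swap.
Context (K : comRingType) (V E : finType).

Definition setc (x : {ffun V -> E}) (v : V) (e : E) : {ffun V -> E} :=
  [ffun u => if u == v then e else x u].

Lemma setcK x v : setc x v (x v) = x.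
Proof. by apply/ffunP => u; rewrite ffunE; case: eqP => // ->. Qed.

Lemma setc_id x v e f : setc (setc x v e) v f = setc x v f.
Proof. by apply/ffunP => u; rewrite !ffunE; case: eqP. Qed.

(** Since F, a and b ignore the coordinate v of x, summing over that coordinate leaves F in both
    cases. The proof adds a dummy coordinate e weighted by the other kernel and exchanges it with
    the coordinate v, which is an involution. *)
Lemma sum_swap_coordinate (v : V) (F : {ffun V -> E} -> K) (a b : {ffun V -> E} -> E -> K) :
  (forall x e, F (setc x v e) = F x) ->
  (forall x e, a (setc x v e) =1 a x) -> (forall x e, b (setc x v e) =1 b x) ->
  (forall x, \sum_e a x e = 1) -> (forall x, \sum_e b x e = 1) ->
  \sum_x F x * a x (x v) = \sum_x F x * b x (x v).
Proof.
move=> FE aE bE a1 b1.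
transitivity (\sum_x \sum_e F x * a x (x v) * b x e).
  by apply: eq_bigr => x _; rewrite -mulr_sumr b1 mulr1.
transitivity (\sum_x \sum_e F x * b x (x v) * a x e); last first.
  by apply: eq_bigr => x _; rewrite -mulr_sumr a1 mulr1.
rewrite !pair_bigA /=.
pose i (p : {ffun V -> E} * E) := (setc p.1 v p.2, p.1 v).
have iK : involutive i.
  by move=> [x e]; rewrite /i /= setc_id setcK ffunE eqxx.
rewrite (reindex_inj (inv_inj iK)); apply: eq_bigr => -[x e] _ /=.
by rewrite FE aE bE ffunE eqxx mulrAC.
Qed.
End swap.

Section tree.
Variable J : nat.
Local Notation node := (node J).

Lemma pos_lt (v : node) : (pos v < 2 ^ lev v)%N.
Proof. by rewrite /pos /lev ltn_ord. Qed.

Lemma lev_le (v : node) : (lev v <= J)%N.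
Proof. by rewrite /lev -ltnS ltn_ord. Qed.

Lemma node_inj (u v : node) : lev u = lev v -> pos u = pos v -> u = v.
Proof.
case: u v => [j k] [j' k']; rewrite /lev /pos /= => /val_inj jj.
by case: _ / jj k' => k' kk; congr existT; exact: val_inj.
Qed.

(* The breadth-first numbering, for which parents come before their children. *)
Definition rk (v : node) : nat := (2 ^ lev v + pos v)%N.

Lemma rk_inj : injective rk.
Proof.
move=> u v uv.
(* The binary expansion of [rk w] has lev w + 1 digits, so the rank determines the level. *)
have h (w : node) : trunc_log 2 (rk w) = lev w.
  apply: trunc_log_eq => //; rewrite /rk leq_addr expnS mul2n -addnn ltn_add2l.
  exact: pos_lt.
have l : lev u = lev v by rewrite -!h uv.
apply: node_inj => //; apply/eqP; rewrite -(eqn_add2l (2 ^ lev u)).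
by rewrite -/(rk u) uv /rk l.
Qed.

Lemma parentE (v : node) : (0 < lev v)%N ->
  lev (parent v) = (lev v).-1 /\ pos (parent v) = (pos v %/ 2)%N.
Proof.
move=> v0; apply: nodeatK; first by rewrite (leq_trans (leq_pred _))// lev_le.
by rewrite ltn_divLR// -expnSr prednK// pos_lt.
Qed.

Lemma rk_parent (v : node) : (0 < lev v)%N -> (rk (parent v) < rk v)%N.
Proof.
move=> v0; have [l p] := parentE v0; rewrite /rk l p.
rewrite -addSn leq_add// ?leq_div//.
by rewrite -[X in (_ < 2 ^ X)%N](prednK v0) ltn_exp2l.
Qed.

Lemma lev0_root (v : node) : lev v = 0%N -> v = tree_root.
Proof.
move=> v0; apply: node_inj => //; have := pos_lt v; rewrite v0 expn0 ltnS leqn0 => /eqP ->.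
by [].
Qed.

(** The two children are told apart by the parity of their position, which lets one statement cover
    both. *)
Lemma childP (v u : node) (c : bool) : (lev v < J)%N ->
  u = nodeat (lev v).+1 (2 * pos v + c) <->
  [/\ (0 < lev u)%N, parent u = v & odd (pos u) = c].
Proof.
move=> vJ.
have k0 : (2 * pos v + c < 2 ^ (lev v).+1)%N.
  rewrite expnS (@leq_trans (2 * (pos v).+1))//; last by rewrite leq_pmul2l// pos_lt.
  by rewrite mulnS; case: c; rewrite ?addn1 ?addn0 addnC ?addn2 ?ltnS// ltnW.
have [lc pc] := nodeatK vJ k0.
split => [->|[u0 pu oc]].
  have c0 : (0 < lev (@nodeat J (lev v).+1 (2 * pos v + c)))%N by rewrite lc.
  split; [by []| |by rewrite pc oddD oddM/=; case: (c)].
  have [l p] := parentE c0; apply: node_inj; first by rewrite l lc.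
  rewrite p pc mulnC divnMDl// divn_small ?addn0//; by case: (c).
have [l p] := parentE u0; apply: node_inj.
  by rewrite lc -pu l prednK.
by rewrite pc -pu p -oc -[LHS](odd_double_half (pos u)) divn2 mul2n addnC.
Qed.

(** Each node other than the root is counted once, as a child of its parent; the nodes with children
    are those above the last level. *)
Lemma prod_children (K : comRingType) (g : node -> node -> K) :
  \prod_(u : node | (0 < lev u)%N) g u (parent u) =
  \prod_(v : node | (lev v < J)%N)
     (g (nodeat (lev v).+1 (2 * pos v)) v * g (nodeat (lev v).+1 (2 * pos v + 1)) v).
Proof.
rewrite (partition_big (@parent J) (fun v => (lev v < J)%N)); last first.
  move=> u u0; have [-> _] := parentE u0.
  by rewrite prednK// lev_le.
apply: eq_bigr => v vJ.
have [c0 p0 o0] := (childP _ false vJ).1 erefl; rewrite addn0 in c0 p0 o0.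
have [c1 p1 o1] := (childP _ true vJ).1 erefl; rewrite /= in c1 p1 o1.
rewrite (bigD1 (nodeat (lev v).+1 (2 * pos v)))/=; last by rewrite c0 p0 eqxx.
rewrite p0; congr (_ * _).
rewrite (bigD1 (nodeat (lev v).+1 (2 * pos v + 1)))/=; last first.
  rewrite c1 p1 eqxx/=; apply/eqP => cc.
  by move: o1; rewrite cc o0.
rewrite p1 big1 ?mulr1// => u /andP[/andP[/andP[u0 /eqP pu] n0] n1].
have := (childP u (odd (pos u)) vJ).2 (And3 u0 pu erefl).
case: (odd (pos u)) => /eqP; first by rewrite (negbTE n1).
by rewrite addn0 (negbTE n0).
Qed.

End tree.

(** * Sums over the configurations of a Markov tree *)

Section chain.
Context (K : realType) (J : nat) (E : finType) (q0 : E -> K) (q : node J -> E -> E -> K).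
Hypotheses (pq0 : prob_vector q0)
  (pq : forall v, (0 < lev v)%N -> forall e, prob_vector (q v e)).
Local Notation node := (node J).
Local Notation config := {ffun node -> E}.

Definition kern (x : config) (u : node) (e : E) : K :=
  if lev u == 0%N then q0 e else q u (x (parent u)) e.

Definition chain_weight (x : config) : K :=
  q0 (x tree_root) * \prod_(v : node | (0 < lev v)%N) q v (x (parent v)) (x v).

Lemma chain_weightE x : chain_weight x = \prod_u kern x u (x u).
Proof.
rewrite (bigD1 tree_root)//= /kern eqxx; congr (_ * _); apply: eq_big => v.
  rewrite lt0n; apply/idP/idP => [|vr].
    by apply: contra => /eqP ->.
  by apply: contra vr => /eqP /lev0_root ->.
by rewrite lt0n => /negbTE ->.
Qed.

Lemma kern1 x u : \sum_e kern x u e = 1.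
Proof.
rewrite /kern; have [u0|u0] := eqVneq (lev u) 0%N; first by case: pq0.
by have [|_ ->] := pq (_ : (0 < lev u)%N) (x (parent u)); rewrite ?lt0n.
Qed.

Definition indep_above (i : nat) (f : config -> K) :=
  forall x v e, (i < rk v)%N -> f (setc x v e) = f x.

(* Beyond rank [i] the transitions are replaced by independent draws from [q0],
   which leaves sums of functions of the first coordinates unchanged. *)
Definition trunc_weight (i : nat) (x : config) : K :=
  \prod_u (if (rk u <= i)%N then kern x u (x u) else q0 (x u)).

(** The kernel at u reads x only at the parent of u, whose rank is smaller. *)
Lemma kern_setc x v u e : (rk u <= rk v)%N -> kern (setc x v e) u =1 kern x u.
Proof.
move=> uv e'; rewrite /kern; case: ifPn => // u0; rewrite -lt0n in u0.
rewrite ffunE ifF//; apply/negbTE/eqP => pv.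
by have := rk_parent u0; rewrite pv ltnNge uv.
Qed.

Let rest (i : nat) (v : node) (x : config) : K :=
  \prod_(u | u != v) (if (rk u <= i)%N then kern x u (x u) else q0 (x u)).

Let rest_setc i v x e : (i <= rk v)%N -> rest i v (setc x v e) = rest i v x.
Proof.
move=> iv; apply: eq_bigr => u uv; rewrite ffunE (negbTE uv).
by case: ifP => // ui; rewrite kern_setc// (leq_trans ui).
Qed.

(** Ranks are distinct, so at most one node has rank i + 1, and f ignores its state. Its children
    have larger rank and are already truncated, so no other factor reads that state, and
    [sum_swap_coordinate] exchanges its transition for a draw from [q0]. *)
Lemma sum_trunc_weightS i f : indep_above i f ->
  \sum_x f x * trunc_weight i.+1 x = \sum_x f x * trunc_weight i x.
Proof.
move=> fi; have [v /eqP vi|nv] := pickP (fun v : node => rk v == i.+1); last first.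
  apply: eq_bigr => x _; congr (_ * _); apply: eq_bigr => u _.
  by rewrite leq_eqVlt nv.
have rE x : rest i.+1 v x = rest i v x.
  apply: eq_bigr => u uv; rewrite leq_eqVlt ltnS -vi; case: eqP => // /rk_inj /eqP.
  by rewrite (negbTE uv).
transitivity (\sum_x (f x * rest i.+1 v x) * kern x v (x v)).
  apply: eq_bigr => x _; rewrite /trunc_weight (bigD1 v)//= vi leqnn.
  by rewrite mulrAC mulrA.
transitivity (\sum_x (f x * rest i.+1 v x) * q0 (x v)); last first.
  apply: eq_bigr => x _; rewrite /trunc_weight (bigD1 v)//= vi ltnn rE.
  by rewrite mulrAC mulrA.
apply: (@sum_swap_coordinate K node E v (fun x => f x * rest i.+1 v x)
  (fun x => kern x v) (fun=> q0)) => //.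
- by move=> x e; rewrite rest_setc ?vi// fi// vi.
- by move=> x e; exact: kern_setc.
- by move=> x; exact: kern1.
- by move=> _; case: pq0.
Qed.

Lemma sum_trunc_weight i f : indep_above i f ->
  \sum_x f x * chain_weight x = \sum_x f x * trunc_weight i x.
Proof.
move=> fi; pose N := (\max_(v : node) rk v)%N.
have up k : \sum_x f x * trunc_weight (k + i) x = \sum_x f x * trunc_weight i x.
  elim: k => [|k ih]//; rewrite addSn sum_trunc_weightS// => x v e ki.
  by rewrite fi// (leq_ltn_trans _ ki)// leq_addl.
(* [N] bounds all ranks, so that nothing is truncated at N + i. *)
rewrite -(up N); apply: eq_bigr => x _; congr (_ * _).
rewrite chain_weightE; apply: eq_bigr => u _; rewrite ifT//.
by rewrite (leq_trans _ (leq_addr _ _))// /N leq_bigmax.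
Qed.

Lemma chain_weight_ge0 x : 0 <= chain_weight x.
Proof.
rewrite mulr_ge0//; first by case: pq0.
by apply: prodr_ge0 => v v0; have [+ _] := pq v0 (x (parent v)); exact.
Qed.

Lemma sum_chain_weight : \sum_x chain_weight x = 1.
Proof.
transitivity (\sum_x 1 * chain_weight x); first by apply: eq_bigr => x _; rewrite mul1r.
(* Ranks start at 1, so truncation at 0 replaces every transition by an independent draw. *)
rewrite (@sum_trunc_weight 0%N)//.
transitivity (\sum_(x : config) \prod_u q0 (x u)).
  apply: eq_bigr => x _; rewrite mul1r; apply: eq_bigr => u _.
  by rewrite leqn0 /rk addn_eq0 expn_eq0.
have /esym := @bigA_distr_bigA K 0 1 *%R +%R _ _ (fun (_ : node) e => q0 e).
by move=> ->; rewrite big1// => u _; case: pq0.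
Qed.

(** The Markov property in summed form. With the transitions after v truncated away, the factor at v
    is the kernel at e times the indicator of e, and this point mass can be exchanged for [q0]. *)
Lemma sum_chain_kern v e (f : config -> K) :
  (forall x u e, (rk v <= rk u)%N -> f (setc x u e) = f x) ->
  \sum_x f x * (x v == e)%:R * chain_weight x =
  \sum_x f x * kern x v e * chain_weight x.
Proof.
move=> fv.
have rv : (0 < rk v)%N by rewrite /rk addn_gt0 expn_gt0.
rewrite (@sum_trunc_weight (rk v) (fun x => f x * (x v == e)%:R)); last first.
  move=> x u e' vu; rewrite fv ?(ltnW vu)// ffunE ifF//.
  by apply/eqP => vu'; rewrite vu' ltnn in vu.
rewrite (@sum_trunc_weight (rk v).-1 (fun x => f x * kern x v e)); last first.
  by move=> x u e'; rewrite prednK// => vu; rewrite fv// kern_setc.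
have rE x : rest (rk v) v x = rest (rk v).-1 v x.
  apply: eq_bigr => u uv; rewrite leq_eqVlt -[X in (_ < X)%N](prednK rv) ltnS.
  by case: eqP => // /rk_inj /eqP; rewrite (negbTE uv).
transitivity (\sum_x (f x * kern x v e * rest (rk v) v x) * (x v == e)%:R).
  apply: eq_bigr => x _; rewrite /trunc_weight (bigD1 v)//= leqnn -/(rest _ v x).
  by case: eqP => [->|_]; rewrite ?mulr1 ?mulr0 ?mul0r// !mulrA.
transitivity (\sum_x (f x * kern x v e * rest (rk v) v x) * q0 (x v)); last first.
  apply: eq_bigr => x _; rewrite /trunc_weight (bigD1 v)//= leqNgt prednK// leqnn/=.
  by rewrite -/(rest _ v x) rE mulrAC mulrA.
apply: (@sum_swap_coordinate K node E v (fun x => f x * kern x v e * rest (rk v) v x)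
  (fun=> fun e' => (e' == e)%:R) (fun=> q0)) => //.
- by move=> x e'; rewrite rest_setc// fv// kern_setc.
- move=> _; rewrite (bigD1 e)//= eqxx big1 ?addr0// => e' /negbTE ->; by [].
- by move=> _; case: pq0.
Qed.

Lemma sum_chain_root e : \sum_(x : config) (x tree_root == e)%:R * chain_weight x = q0 e.
Proof.
have := @sum_chain_kern tree_root e (fun=> 1) (fun _ _ _ _ => erefl).
under eq_bigr do rewrite mul1r.
move=> ->; under eq_bigr do rewrite mul1r /kern eqxx.
by rewrite -mulr_sumr sum_chain_weight mulr1.
Qed.

Lemma sum_chain_transition v e e' : (0 < lev v)%N ->
  \sum_(x : config) (x (parent v) == e)%:R * (x v == e')%:R * chain_weight x =
  q v e e' * \sum_(x : config) (x (parent v) == e)%:R * chain_weight x.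
Proof.
move=> v0; rewrite (@sum_chain_kern v e' (fun x => (x (parent v) == e)%:R)); last first.
  move=> x u f vu; rewrite ffunE ifF//; apply/eqP => pu.
  by have := rk_parent v0; rewrite pu ltnNge vu.
rewrite mulr_sumr; apply: eq_bigr => x _; rewrite /kern ifF; last by rewrite gtn_eqF.
by case: eqP => [->|_]; rewrite ?mul1r ?mul0r// mulr0.
Qed.

End chain.

(** * Posterior weights of hidden configurations and the recursion *)

Section posterior_chain.
Context (K : realType) (J : nat) (h : hyper K J) (G : nat) (n_ : 'I_G -> nat)
  (y : node J -> 'cV[K]_(nobs n_)).
Hypotheses (prho0 : prob_vector (rho0 h)) (pkappa0 : prob_vector (kappa0 h))
  (prho : forall v : node J, (0 < lev v)%N -> forall e, prob_vector (rho h v e))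
  (pkappa : forall v : node J, (0 < lev v)%N -> forall e, prob_vector (kappa h v e)).
Local Notation m v := (marg_lik h (lev v) (y v)).
Hypothesis m0 : forall v s r, 0 < m v s r.

Lemma prob_vector_gt0 (E : finType) (a : E -> K) : prob_vector a -> exists e, 0 < a e.
Proof.
move=> [a0 a1]; apply/existsP; apply: contraT; rewrite negb_exists => /forallP a2.
suff : \sum_e a e = 0 by rewrite a1 => /eqP; rewrite oner_eq0.
by apply: big1 => e _; apply/le_anti; rewrite a0 andbT leNgt a2.
Qed.

Lemma prob_vector_mix_gt0 (a b : bool -> K) (f : bool -> bool -> K) :
  prob_vector a -> prob_vector b -> (forall s r, 0 < f s r) ->
  0 < \sum_(s : bool) \sum_(r : bool) a s * b r * f s r.
Proof.
move=> pa pb f0; have [s as0] := prob_vector_gt0 pa; have [r br0] := prob_vector_gt0 pb.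
have t0 s' r' : 0 <= a s' * b r' * f s' r'.
  by rewrite !mulr_ge0 ?(ltW (f0 _ _))//; [case: pa|case: pb].
rewrite (bigD1 s)//= ltr_wpDr//; first by apply: sumr_ge0 => s' _; apply: sumr_ge0 => r' _.
rewrite (bigD1 r)//= ltr_wpDr//; first by apply: sumr_ge0 => r' _.
by rewrite !mulr_gt0.
Qed.

Lemma xi_step_gt0 (f : node J -> bool -> bool -> K) v s r :
  (forall s r, 0 < f v s r) -> 0 < xi_step h f v s r.
Proof.
move=> f0; rewrite /xi_step; case: ifPn => [_|v0]; first exact: prob_vector_mix_gt0.
by rewrite -lt0n in v0; apply: prob_vector_mix_gt0 => //; [exact: prho|exact: pkappa].
Qed.

Lemma phi_gt0 v s r : 0 < phi h y v s r.
Proof.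
rewrite /phi; move: (J - lev v)%N => i; elim: i v s r => [|i ih] v s r /=; first exact: m0.
by apply: mulr_gt0; [apply: mulr_gt0; [exact: m0|]|]; apply: xi_step_gt0 => *; exact: ih.
Qed.

(** Justifies the divisions in the transitions: the marginal likelihoods are positive, and a
    probability vector has a positive entry. *)
Lemma xi_gt0 v s r : 0 < xi h y v s r.
Proof. by apply: xi_step_gt0 => *; exact: phi_gt0. Qed.

Lemma post_init_pv : prob_vector (post_init h y).
Proof.
have xr := xi_gt0 tree_root false false; split.
  move=> e; rewrite mulr_ge0 ?divr_ge0 ?(ltW (phi_gt0 _ _ _)) ?(ltW xr)//.
  by rewrite mulr_ge0//; [case: prho0|case: pkappa0].
rewrite /post_init; under eq_bigr do rewrite mulrA.
rewrite -mulr_suml -(pair_bigA _ (fun s r => rho0 h s * kappa0 h r * phi h y tree_root s r))/=.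
by rewrite -[X in X / _]/(xi h y tree_root false false) divff ?gt_eqF.
Qed.

Lemma post_trans_pv v e : (0 < lev v)%N -> prob_vector (post_trans h y v e).
Proof.
move=> v0; have xr := xi_gt0 v e.1 e.2; split.
  move=> e'; rewrite mulr_ge0 ?divr_ge0 ?(ltW (phi_gt0 _ _ _)) ?(ltW xr)//.
  by rewrite mulr_ge0//; [have [] := prho v0 e.1|have [] := pkappa v0 e.2].
rewrite /post_trans; under eq_bigr do rewrite mulrA.
rewrite -mulr_suml -(pair_bigA _ (fun s r => rho h v e.1 s * kappa h v e.2 r * phi h y v s r))/=.
rewrite [X in X / _](_ : _ = xi h y v e.1 e.2) ?divff ?gt_eqF//.
by rewrite /xi /xi_step ifF// gtn_eqF.
Qed.

Definition prior_weight (x : node J -> bool * bool) : K :=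
  (rho0 h (x tree_root).1 * \prod_(v : node J | (0 < lev v)%N) rho h v (x (parent v)).1 (x v).1) *
  (kappa0 h (x tree_root).2 * \prod_(v : node J | (0 < lev v)%N) kappa h v (x (parent v)).2 (x v).2).

Lemma post_weightE (x : node J -> bool * bool) :
  post_init h y (x tree_root) *
    \prod_(v : node J | (0 < lev v)%N) post_trans h y v (x (parent v)) (x v) =
  prior_weight x * \prod_v m v (x v).1 (x v).2 / xi h y tree_root false false.
Proof.
set M := \prod_v m v _ _; pose f v := phi h y v (x v).1 (x v).2.
(* The factor [xi] of a child u is taken at the state of its parent v, the form in which
   [prod_children] regroups edges by their upper end. *)
pose g u v := xi h y u (x v).1 (x v).2.
have fE : \prod_v f v = M *
    \prod_(u : node J | (0 < lev u)%N) g u (parent u).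
  rewrite (prod_children g) /M [X in _ * X]big_mkcond -big_split/=; apply: eq_bigr => v _.
  case: ifPn => vJ; first by rewrite /f phi_inner// mulrA.
  rewrite mulr1 /f phi_leaf//; apply/eqP; rewrite eqn_leq lev_le/=.
  by rewrite leqNgt.
have g0 : \prod_(u : node J | (0 < lev u)%N) g u (parent u) != 0.
  by apply/prodf_neq0 => u _; rewrite gt_eqF// xi_gt0.
have x0 : xi h y tree_root false false != 0 by rewrite gt_eqF// xi_gt0.
rewrite /post_init /post_trans; under eq_bigr do rewrite -/(f _) -/(g _ _).
rewrite -/(f tree_root) !big_split/= prodfV /prior_weight.
have fr : \prod_v f v = f tree_root * \prod_(v : node J | (0 < lev v)%N) f v.
  rewrite (bigD1 tree_root)//=; congr (_ * _); apply: eq_bigl => v.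
  by rewrite lt0n; apply/idP/idP; [apply: contra => /eqP /lev0_root ->|apply: contra => /eqP ->].
have -> : M = f tree_root * \prod_(v : node J | (0 < lev v)%N) f v /
   \prod_(u : node J | (0 < lev u)%N) g u (parent u) by rewrite -fr fE mulfK.
by field; rewrite x0 g0.
Qed.

End posterior_chain.

(** * Conditioning *)

Section product_generator.
Context d1 d2 (T1 : measurableType d1) (T2 : measurableType d2).
Variables (G1 : set (set T1)) (G2 : set (set T2)).
Hypotheses (mG1 : measurable = <<s G1 >>) (mG2 : measurable = <<s G2 >>)
  (G1T : G1 setT) (G2T : G2 setT).

Definition rectangles : set (set (T1 * T2)) :=
  [set C | exists2 A, G1 A & exists2 B, G2 B & C = A `*` B].

Let G1m A : G1 A -> measurable A.
Proof. by move=> GA; have -> : measurable A = <<s G1 >> A; [rewrite mG1|exact: sub_sigma_algebra]. Qed.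
Let G2m A : G2 A -> measurable A.
Proof. by move=> GA; have -> : measurable A = <<s G2 >> A; [rewrite mG2|exact: sub_sigma_algebra]. Qed.

(** A cylinder over a generator of one factor is a rectangle, because the generators of the other
    factor include the whole space. *)
Lemma rectanglesE : measurable = <<s rectangles >>.
Proof.
apply/seteqP; split; last first.
  apply: smallest_sub; first exact: sigma_algebra_measurable.
  by move=> C [A GA [B GB ->]]; apply: measurableX; [exact: G1m|exact: G2m].
apply: smallest_sub; first exact: smallest_sigma_algebra.
have sa (T : Type) (Gf : set (set T)) (f : T1 * T2 -> T) :
    (forall A, Gf A -> <<s rectangles >> (f @^-1` A)) ->
    forall A, <<s Gf >> A -> <<s rectangles >> (f @^-1` A).
  move=> h; apply: (@smallest_sub _ (sigma_algebra setT) _ [set A | <<s rectangles >> (f @^-1` A)]) => //.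
  split => /=.
  - by rewrite preimage_set0; exact: sigma_algebra0.
  - by move=> A hA; rewrite setTD preimage_setC -setTD; exact: sigma_algebraCD.
  - by move=> F hF; rewrite preimage_bigcup; exact: sigma_algebra_bigcup.
rewrite subUset; split => _ [A mA <-]; rewrite setTI.
- move: A mA; rewrite mG1; apply: sa => A GA; apply: sub_sigma_algebra.
  exists A => //; exists setT => //; apply/seteqP; split => -[x y] //=.
  by case.
- move: A mA; rewrite mG2; apply: sa => A GA; apply: sub_sigma_algebra.
  exists setT => //; exists A => //; apply/seteqP; split => -[x y] //=.
  by case.
Qed.

Lemma rectanglesI : setI_closed G1 -> setI_closed G2 -> setI_closed rectangles.
Proof.
move=> I1 I2 _ _ [A GA [B GB ->]] [A' GA' [B' GB' ->]]; rewrite -setXI.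
by exists (A `&` A'); [exact: I1|exists (B `&` B') => //; exact: I2].
Qed.

Lemma rectanglesT : rectangles setT.
Proof. by exists setT => //; exists setT => //; rewrite setXTT. Qed.

End product_generator.

Section measurable_generator.
Context d (T : measurableType d).

Lemma sigma_measurableE : @measurable d T = <<s measurable >>.
Proof. by rewrite sigma_algebra_id//; exact: sigma_algebra_measurable. Qed.

End measurable_generator.

Section sub_sigma_algebra.
Context d d' (Omega : measurableType d) (T : measurableType d').

(** Measurability for a sigma-algebra given as a mere set of events, the form used in [cond_prob];
    [smeasurableP] converts it to ordinary measurability when the sigma-algebra is generated. *)
Definition smeasurable (F : set (set Omega)) (X : Omega -> T) :=
  forall B, measurable B -> F (X @^-1` B).

Lemma smeasurableP (Gen : set (set Omega)) (X : Omega -> T) :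
  smeasurable <<s Gen >> X <->
  measurable_fun [set: g_sigma_algebraType Gen] (X : g_sigma_algebraType Gen -> T).
Proof.
split => [h _ B mB|h B mB]; first by rewrite setTI; exact: h.
by rewrite -[X in <<s _ >> X]setTI; exact: h.
Qed.

Lemma sub_g_sigma (Gen : set (set Omega)) : Gen `<=` measurable ->
  <<s Gen >> `<=` measurable.
Proof. by move=> h; apply: smallest_sub => //; exact: sigma_algebra_measurable. Qed.

End sub_sigma_algebra.

Section conditional.
Local Open Scope ereal_scope.
Context d (Omega : measurableType d) (K : realType) (P : probability Omega K).

Lemma integral_mul_indic d' (U : measurableType d') (m : {measure set U -> \bar K})
    (E D : set U) (g : U -> \bar K) :
  \int[m]_(x in E) (g x * (\1_D x)%:E) = \int[m]_(x in E `&` D) g x.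
Proof.
rewrite integral_mkcondr; apply: eq_integral => x _.
by rewrite patchE indicE; case: ifP => _; rewrite ?mule1 ?mule0.
Qed.

Lemma measurable_gen_fun d' (T : measurableType d') (Gen : set (set Omega)) (X : Omega -> T) :
  Gen `<=` measurable -> smeasurable <<s Gen >> X -> measurable_fun setT X.
Proof. by move=> h mX _ B mB; rewrite setTI; apply: (sub_g_sigma h); exact: mX. Qed.

(* Conditioning on [Gen] an integral over [C `&` A]. *)
Lemma cond_prob_freeze (Gen : set (set Omega)) (A C : set Omega) (f : Omega -> \bar K) (g : Omega -> K) :
  Gen `<=` measurable -> measurable A -> <<s Gen >> C -> (forall w, (0 <= g w)%R) ->
  cond_prob P <<s Gen >> A (EFin \o g) ->
  smeasurable <<s Gen >> f -> (forall w, 0 <= f w) ->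
  \int[P]_(w in C `&` A) f w = \int[P]_(w in C) (f w * (g w)%:E).
Proof.
move=> Gm mA FC g0 [mg hg] mf f0.
have mC := sub_g_sigma Gm FC.
have mf' := measurable_gen_fun Gm mf.
have mg' : measurable_fun setT g by apply/measurable_EFinP; exact: measurable_gen_fun mg.
have mCA : measurable (C `&` A) by exact: measurableI.
have mw1 : measurable_fun setT (\1_(C `&` A) : Omega -> K) by exact: measurable_indic.
have mw2 : measurable_fun setT (fun w => g w * \1_C w)%R by exact: measurable_funM.
have w10 w : (0 <= \1_(C `&` A) w :> K)%R by [].
have w20 w : (0 <= g w * \1_C w)%R by rewrite mulr_ge0.
have h B : measurable B -> \int[P]_(x in f @^-1` B) (\1_(C `&` A) x)%:E =
    \int[P]_(x in f @^-1` B) (g x * \1_C x)%:E.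
  move=> mB; have FB : <<s Gen >> (f @^-1` B `&` C).
    have := @measurableI _ (g_sigma_algebraType Gen) _ _ (mf B mB) FC; exact.
  have mfB : measurable (f @^-1` B) by apply: (sub_g_sigma Gm); exact: mf.
  transitivity (P (f @^-1` B `&` C `&` A)).
    rewrite integral_indic//.
    by congr (P _); rewrite setIC setIA.
  rewrite hg//.
  by under [RHS]eq_integral do rewrite EFinM; rewrite integral_mul_indic.
(* [integral_transfer] wants a function that is nonnegative on the whole extended line; the absolute
   value serves, since f is nonnegative. *)
have := integral_transfer mf' mf' mw1 mw2 w10 w20 h (@abse_measurable K setT) (@abse_ge0 K).
under eq_integral do rewrite gee0_abs//.
under [in X in _ = X -> _]eq_integral do rewrite gee0_abs//.
rewrite integral_mul_indic setTI => ->.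
under eq_integral do rewrite EFinM muleA.
by rewrite integral_mul_indic setTI.
Qed.

Section bayes.
Context d' (U : measurableType d') (m : {measure set U -> \bar K}) (Cf : finType)
  (H : Omega -> Cf) (Z : Omega -> U).
Hypotheses (mH : forall h, measurable [set x | H x = h]) (mZ : measurable_fun setT Z).

Lemma integral_mixture (A : set Omega) (a f : Cf -> U -> K) : measurable A ->
  (forall h, measurable_fun setT (a h)) -> (forall h z, (0 <= a h z)%R) ->
  (forall h C, measurable C ->
     P ([set x | H x = h] `&` Z @^-1` C `&` A) = \int[m]_(z in C) (a h z)%:E) ->
  (forall h, measurable_fun setT (f h)) -> (forall h z, (0 <= f h z)%R) ->
  \int[P]_(x in A) (f (H x) (Z x))%:E = \int[m]_z (\sum_h (f h z * a h z)%R)%:E.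
Proof.
move=> mA ma a0 ha mf f0.
have mHA h : measurable ([set x | H x = h] `&` A) by exact: measurableI.
rewrite -[LHS]integral_indicM//.
transitivity (\int[P]_x \sum_h (f h (Z x) * \1_([set x | H x = h] `&` A) x)%:E).
  apply: eq_integral => x _; rewrite (bigD1 (H x))//= big1 ?adde0; last first.
    move=> h hx; rewrite indicE memNset ?mulr0// => -[/= hH _].
    by rewrite hH eqxx in hx.
  rewrite -EFinM mulrC; congr (_ * _)%:E; rewrite !indicE; congr (nat_of_bool _)%:R.
  by apply/idP/idP; rewrite !inE => // -[].
have mfZ h : measurable_fun setT (fun x => f h (Z x)) by exact: measurableT_comp.
rewrite ge0_integral_sum//; last 2 first.
- move=> h; apply/measurable_EFinP; apply: measurable_funM => //.
- by move=> h x _; rewrite lee_fin mulr_ge0.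
under [RHS]eq_integral do rewrite -sumEFin.
rewrite ge0_integral_sum//; last 2 first.
- by move=> h; apply/measurable_EFinP; apply: measurable_funM.
- by move=> h x _; rewrite lee_fin mulr_ge0.
apply: eq_bigr => h _.
have mw1 : measurable_fun setT (\1_([set x | H x = h] `&` A) : Omega -> K) by exact: measurable_indic.
have w10 x : (0 <= \1_([set x | H x = h] `&` A) x :> K)%R by [].
have e B : measurable B -> \int[P]_(x in Z @^-1` B) (\1_([set x | H x = h] `&` A) x)%:E =
    \int[m]_(z in id @^-1` B) (a h z)%:E.
  move=> mB; have mZB : measurable (Z @^-1` B) by rewrite -[X in measurable X]setTI; exact: mZ.
  by rewrite integral_indic// -ha// setIAC.
have f0' z : 0 <= (f h z)%:E by rewrite lee_fin.
have mf' : measurable_fun setT (EFin \o f h) by exact/measurable_EFinP.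
exact: (integral_transfer mZ (@measurable_id _ _ setT) mw1 (ma h) w10 (a0 h) e mf' f0').
Qed.

(** Bayes' formula. The density of (H, Z) is [w] and its part on A is [a]; given [pi] of H and Z,
    the probability of A is a ratio of sums over a fibre of [pi]. The hypothesis on [phi] is this
    ratio cleared of its denominator. *)
Lemma bayes (A : set Omega) (w a phi : Cf -> U -> K) (Pi : finType) (pi : Cf -> Pi) (C : Pi -> set U) :
  measurable A ->
  (forall h, measurable_fun setT (w h)) -> (forall h z, (0 <= w h z)%R) ->
  (forall h, measurable_fun setT (a h)) -> (forall h z, (0 <= a h z)%R) ->
  (forall h, measurable_fun setT (phi h)) -> (forall h z, (0 <= phi h z)%R) ->
  (forall h C, measurable C ->
     P ([set x | H x = h] `&` Z @^-1` C) = \int[m]_(z in C) (w h z)%:E) ->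
  (forall h C, measurable C ->
     P ([set x | H x = h] `&` Z @^-1` C `&` A) = \int[m]_(z in C) (a h z)%:E) ->
  (forall p z, \sum_(h | pi h == p) phi h z * w h z = \sum_(h | pi h == p) a h z)%R ->
  (forall p, measurable (C p)) ->
  P ([set x | C (pi (H x)) (Z x)] `&` A) =
  \int[P]_(x in [set x | C (pi (H x)) (Z x)]) (phi (H x) (Z x))%:E.
Proof.
move=> mA mw w0 ma a0 mphi phi0 hw ha hpi mC.
have CE : [set x | C (pi (H x)) (Z x)] = \bigcup_(h in setT)
    ([set x | H x = h] `&` Z @^-1` C (pi h)).
  apply/seteqP; split => [x Cx|x [h _ [/= <-]]//].
  by exists (H x).
have mCC : measurable [set x | C (pi (H x)) (Z x)].
  rewrite CE; apply: fin_bigcup_measurable => // h _.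
  by apply: measurableI => //; rewrite -[X in measurable X]setTI; exact: mZ.
have m1 h : measurable_fun setT (\1_(C (pi h)) : U -> K) by exact: measurable_indic.
have E x : (\1_[set x | C (pi (H x)) (Z x)] x = \1_(C (pi (H x))) (Z x) :> K)%R.
  by rewrite !indicE; congr (nat_of_bool _)%:R; apply/idP/idP; rewrite !inE.
rewrite -integral_indic// -[RHS]integral_indicM//.
have -> : \int[P]_(x in A) (\1_[set x | C (pi (H x)) (Z x)] x)%:E = \int[P]_(x in A) (\1_(C (pi (H x))) (Z x))%:E.
  by apply: eq_integral => x _; rewrite E.
rewrite (@integral_mixture A a (fun h => \1_(C (pi h))))//.
under [RHS]eq_integral do rewrite E -EFinM.
rewrite (@integral_mixture setT w (fun h z => \1_(C (pi h)) z * phi h z)%R)//; last 3 first.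
- by move=> h B mB; rewrite setIT hw.
- by move=> h; exact: measurable_funM.
- by move=> h z; rewrite mulr_ge0.
apply: eq_integral => z _; congr EFin.
rewrite (partition_big pi predT)//= [RHS](partition_big pi predT)//=.
apply: eq_bigr => p _.
transitivity (\sum_(h | pi h == p) \1_(C p) z * a h z)%R.
  by apply: eq_bigr => h /eqP ->.
rewrite -mulr_sumr -hpi mulr_sumr; apply: eq_bigr => h /eqP ->.
by rewrite mulrA.
Qed.
End bayes.

End conditional.

Section cond_prob_unique.
Local Open Scope ereal_scope.
Context d (Omega : measurableType d) (K : realType) (P : probability Omega K)
  (Gen : set (set Omega)).
Hypothesis Gm : Gen `<=` measurable.
Local Notation Coarse := (g_sigma_algebraType Gen).

(** The identity into the space with the smaller sigma-algebra; the image of P under it is the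
    restriction of P, for which integrands are determined almost everywhere by their integrals. *)
Definition coarsen (x : Omega) : Coarse := x.

Lemma measurable_coarsen : measurable_fun setT coarsen.
Proof. by move=> _ B mB; rewrite setTI; exact: (sub_g_sigma Gm). Qed.

Let Q : {measure set Coarse -> \bar K} := image_measure P measurable_coarsen.

Lemma integral_coarsen (f : Omega -> \bar K) (E : set Coarse) : measurable E ->
  measurable_fun [set: Coarse] (f : Coarse -> \bar K) ->
  \int[Q]_(x in E) f x = \int[P]_(x in E) f x.
Proof.
move=> mE mf; rewrite integralE [RHS]integralE.
have pos g : measurable_fun [set: Coarse] (g : Coarse -> \bar K) -> (forall x, 0 <= g x) ->
    \int[Q]_(x in E) g x = \int[P]_(x in E) g x.
  move=> mg g0; exact: (@ge0_integral_pushforward _ _ _ _ _ _ measurable_coarsen P E g mE (measurable_funTS mg) (fun y _ => g0 y)).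
by congr (_ - _); apply: pos => //; [exact: measurable_funepos|exact: measurable_funeneg].
Qed.

(** Needed for [cond_indep], which speaks of arbitrary versions of the conditional probabilities. *)
Lemma cond_prob_ae_unique (A : set Omega) (f g : Omega -> \bar K) : measurable A ->
  cond_prob P <<s Gen >> A f -> cond_prob P <<s Gen >> A g ->
  {ae P, forall x, f x = g x}.
Proof.
move=> mA [/smeasurableP mf hf] [/smeasurableP mg hg].
have E : forall E : set Coarse, measurable E -> \int[Q]_(x in E) f x = \int[Q]_(x in E) g x.
  by move=> E mE; rewrite !integral_coarsen// -hf// hg.
have fi : Q.-integrable setT (f : Coarse -> \bar K).
  apply/integrableP; split => //; apply/abse_integralP => //.
  rewrite integral_coarsen// -hf; last exact: (@measurableT _ Coarse).
  by rewrite setTI gee0_abs// (le_lt_trans (probability_le1 P mA))// ltry.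
have [N [mN N0 sN]] := integral_ae_eq measurableT fi mg (fun D _ mD => E D mD).
exists N; split => //; first exact: (sub_g_sigma Gm).
by move=> x /= fg; apply: sN => /= h; apply: fg; exact: h.
Qed.

End cond_prob_unique.

Section sigma_structure.
Context (Omega : Type) d (U : measurableType d) (Pi : Type) (pi : Omega -> Pi) (Z : Omega -> U).

(* Every event of the sigma-algebra generated by a discrete [pi] and by [Z] has
   this form. *)
Definition structured (C : set Omega) :=
  exists2 D : Pi -> set U, (forall p, measurable (D p)) & C = [set x | D (pi x) (Z x)].

Lemma structured_sigma (Gen : set (set Omega)) : Gen `<=` structured ->
  <<s Gen >> `<=` structured.
Proof.
move=> hG; apply: smallest_sub => //; split.
- by exists (fun=> set0) => //; apply/seteqP; split.
- move=> A [D mD ->]; exists (fun p => ~` D p); first by move=> p; exact: measurableC.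
  by rewrite setTD.
- move=> F hF; pose D n := projT1 (cid2 (hF n)).
  have DE n : (forall p, measurable (D n p)) /\ F n = [set x | D n (pi x) (Z x)].
    by rewrite /D; case: (cid2 _) => /= D' h1 h2; split.
  exists (fun p => \bigcup_n D n p).
    by move=> p; apply: bigcup_measurable => n _; exact: (DE n).1.
  apply/seteqP; split => x /= [n _]; have [_ Fn] := DE n; rewrite ?Fn => h; exists n => //.
  by rewrite Fn.
Qed.

Lemma structured_Z (B : set U) : measurable B -> structured (Z @^-1` B).
Proof. by move=> mB; exists (fun=> B). Qed.

Lemma structured_pi (B : set Pi) : structured (pi @^-1` B).
Proof.
exists (fun p => [set z | B p]); last by [].
move=> p; have [Bp|Bp] := pselect (B p).
  by rewrite (_ : [set _ | _] = setT)//; apply/seteqP; split.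
by rewrite (_ : [set _ | _] = set0)//; apply/seteqP; split.
Qed.

End sigma_structure.

(** * The law of one node *)

Section node_parameters.
Context (K : realType) (J G : nat) (n_ : 'I_G -> nat) (h : hyper K J).
Hypotheses (hnu : 0 < nu h) (hsigma02 : 0 < sigma02 h)
    (htau : 0 < tau0 h) (hupsilon : 0 < upsilon0 h).
Local Notation n := (nobs n_).

Lemma tau_gt0 j : 0 < tau h j.
Proof. by rewrite /tau mulr_gt0// powR_gt0. Qed.

Lemma upsilon_gt0 j : 0 < upsilon h j.
Proof. by rewrite /upsilon mulr_gt0// powR_gt0. Qed.

Definition prec (j : nat) (g : 'I_G) : K :=
  if g == 0%N :> nat then (tau h j)^-1 else (upsilon h j)^-1.

Lemma prec_gt0 j g : 0 < prec j g.
Proof. by rewrite /prec; case: ifP => _; rewrite invr_gt0 ?tau_gt0 ?upsilon_gt0. Qed.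

Definition mask (s r : bool) : 'M[K]_G :=
  diag_mx (\row_g if g == 0%N :> nat then s%:R else r%:R).

Lemma maskE s r (g : 'I_G) (c : 'cV[K]_G) :
  (mask s r *m c) g 0 = (if g == 0%N :> nat then s%:R else r%:R) * c g 0.
Proof. by rewrite mul_diag_mx !mxE. Qed.

Lemma maskM s r : mask s r *m mask s r = mask s r.
Proof.
apply/matrixP => i j; rewrite mul_diag_mx !mxE.
have [->|_] := eqVneq i j; last by rewrite mulr0n mulr0.
by case: ifP => _; rewrite !mulr1n; [case: s|case: r]; rewrite ?mulr1 ?mulr0.
Qed.

Lemma mask_tr s r : (mask s r)^T = mask s r.
Proof. exact: tr_diag_mx. Qed.

Lemma XmatE s r : Xmat K n_ s r = Xmat K n_ true true *m mask s r.
Proof.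
apply/matrixP => l g; rewrite mul_mx_diag !mxE; case: ifP => _; rewrite ?mul1r//.
by rewrite mulrC.
Qed.

Lemma Xmat_mask s r : Xmat K n_ s r *m mask s r = Xmat K n_ s r.
Proof. by rewrite XmatE -mulmxA maskM. Qed.

Lemma Lambda_starE j s r : Lambda_star h n_ j s r =
  (Xmat K n_ s r)^T *m Xmat K n_ s r + diag_mx (\row_g prec j g).
Proof. by []. Qed.

Lemma Lambda_star_posdef j s r : posdef (Lambda_star h n_ j s r).
Proof. exact: (reg_posdef _ (prec_gt0 j)). Qed.

Lemma Lambda_star_unit j s r : Lambda_star h n_ j s r \in unitmx.
Proof. exact: posdef_unit (Lambda_star_posdef j s r). Qed.

(** The Gram matrix is unchanged by the mask on either side, as X mask = X, and the prior precision
    is diagonal. The commutation passes to the inverse, so the posterior mean is supported on the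
    active coefficients. *)
Lemma mask_Lambda_star j s r :
  mask s r *m Lambda_star h n_ j s r = Lambda_star h n_ j s r *m mask s r.
Proof.
rewrite Lambda_starE mulmxDr mulmxDl; congr (_ + _).
  rewrite -mulmxA Xmat_mask mulmxA; congr (_ *m _).
  by rewrite -[in RHS]Xmat_mask trmx_mul mask_tr.
apply/matrixP => i k; rewrite mul_diag_mx mul_mx_diag !mxE.
have [->|_] := eqVneq i k; first by rewrite mulr1n mulrC.
by rewrite !mulr0n mulr0 mul0r.
Qed.

Lemma mask_inv_Lambda_star j s r :
  mask s r *m invmx (Lambda_star h n_ j s r) = invmx (Lambda_star h n_ j s r) *m mask s r.
Proof.
have u := Lambda_star_unit j s r; apply: (can_inj (mulKmx u)).
by rewrite !mulmxA -mask_Lambda_star mulmxV// mul1mx mulmxK.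
Qed.

Lemma mask_mu_star j y s r : mask s r *m mu_star h j y s r = mu_star h (n_ := n_) j y s r.
Proof.
have e : mask s r *m (Xmat K n_ s r)^T = (Xmat K n_ s r)^T.
  by rewrite -[in RHS]Xmat_mask trmx_mul mask_tr.
by rewrite /mu_star !mulmxA mask_inv_Lambda_star -(mulmxA _ (mask s r)) e.
Qed.

(** M(s, r) is the outer product of the diagonal of the mask with itself, because s and r are 0 or
    1. *)
Lemma hadamard_mask s r (B : 'M[K]_G) :
  hadamard (Mmat K G s r) B = mask s r *m B *m mask s r.
Proof.
apply/matrixP => i k; rewrite mul_mx_diag mul_diag_mx !mxE.
by do 2 case: eqP => _ /=; case: s; case: r; rewrite ?(mul1r, mul0r, mulr1, mulr0).
Qed.

Definition chol j s r : 'M[K]_G := projT1 (cid (cholesky (Lambda_star_posdef j s r))).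

Lemma cholP j s r : [/\ is_trig_mx (chol j s r), forall i, 0 < chol j s r i i &
  (chol j s r)^T *m chol j s r = Lambda_star h n_ j s r].
Proof. by rewrite /chol; case: (cid _). Qed.

Lemma chol_unit j s r : chol j s r \in unitmx.
Proof. by have [? ? _] := cholP j s r; exact: posdef_factor_unit. Qed.

Lemma invmx_Lambda_star j s r : invmx (Lambda_star h n_ j s r) =
  invmx (chol j s r) *m (invmx (chol j s r))^T.
Proof.
have [_ _ TA] := cholP j s r; have uT := chol_unit j s r.
have uA := Lambda_star_unit j s r.
apply: (can_inj (mulKmx uA)); rewrite mulmxV// -TA mulmxA mulmxK//.
by rewrite -trmx_mul mulVmx// trmx1.
Qed.

Let a := nu h + 1.
Let b := nu h * sigma02 h.

Lemma shape_gt1 : 1 < a. Proof. by rewrite /a ltrDr. Qed.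
Lemma rate_gt0 : 0 < b. Proof. by rewrite mulr_gt0. Qed.

Definition node_dens (j : nat) (s r : bool) (y : n.-tuple K) : K :=
  node_density (Xmat K n_ s r) (prec j) (chol j s r) a b y.

Lemma node_dens_gt0 j s r y : 0 < node_dens j s r y.
Proof.
have [trT T0 TA] := cholP j s r.
by apply: node_density_gt0 => //; [exact: prec_gt0|exact: shape_gt1|exact: rate_gt0].
Qed.

Lemma measurable_node_dens j s r : measurable_fun setT (node_dens j s r).
Proof. exact: measurable_node_density. Qed.

Definition gauss_pdf (y : n.-tuple K) : K :=
  ((2 * pi) `^ (n%:R / 2))^-1 * expR (- (sqn (colt y) / 2)).

Lemma gauss_pdf_gt0 y : 0 < gauss_pdf y.
Proof. by rewrite mulr_gt0 ?expR_gt0// invr_gt0 powR_gt0// mulr_gt0// pi_gt0. Qed.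

Lemma UpsilonE j y s r : Upsilon h (n_ := n_) j y s r = reg_rss (Xmat K n_ s r) (prec j) y.
Proof. by []. Qed.

Lemma mu_starE j y s r : mu_star h (n_ := n_) j y s r = reg_mean (Xmat K n_ s r) (prec j) y.
Proof. by []. Qed.

Lemma marg_likE j (y : n.-tuple K) s r :
  marg_lik h j (colt y) s r = node_dens j s r y * gauss_pdf y.
Proof.
have [trT T0 TA] := cholP j s r.
have p0 : 0 < (2 * pi : K) `^ (n%:R / 2) by rewrite powR_gt0// mulr_gt0// pi_gt0.
have G0 : 0 < Gamma a by rewrite Gamma_gt0// shape_gt1.
have bU : 0 < b + Upsilon h j (colt y) s r.
  by rewrite ltr_wpDr ?rate_gt0// UpsilonE reg_rss_ge0//; exact: prec_gt0.
(* The determinant of [T^T *m T] is the square of the product of the diagonal of T. *)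
have d1 : Num.sqrt (\det (Lambda_star h n_ j s r)) = \prod_g chol j s r g g.
  rewrite -TA det_mulmx det_tr -expr2 sqrtr_sqr det_trig// ger0_norm//.
  by apply: prodr_ge0 => g _; exact: ltW.
have d2 : Num.sqrt (\det (Lambda h G j)) = \prod_g Num.sqrt (prec j g).
  rewrite det_diag -[RHS]ger0_norm; last by apply: prodr_ge0 => g _; exact: sqrtr_ge0.
  rewrite -sqrtr_sqr -prodrXl; congr Num.sqrt; apply: eq_bigr => g _.
  by rewrite mxE -/(prec j g) sqr_sqrtr// ltW// prec_gt0.
have t0 : 0 < \prod_g chol j s r g g by apply: prodr_gt0.
rewrite /marg_lik d1 d2 /node_dens /node_density /reg_weight /gauss_pdf -UpsilonE -/b -/a.
have -> : nu h + n%:R / 2 + 1 = a + n%:R / 2 by rewrite /a; ring.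
have -> : (b + Upsilon h j (colt y) s r) `^ (- nu h - n%:R / 2 - 1) =
    ((b + Upsilon h j (colt y) s r) `^ (a + n%:R / 2))^-1.
  by rewrite -powRN; congr (_ `^ _); rewrite /a; ring.
have U0 : 0 < (b + Upsilon h j (colt y) s r) `^ (a + n%:R / 2) by rewrite powR_gt0.
rewrite expRN; have e0 := expR_gt0 (sqn (colt y) / 2).
by field; rewrite !gt_eqF.
Qed.

Lemma marg_lik_gt0 j (y : 'cV[K]_n) s r : 0 < marg_lik h j y s r.
Proof. by rewrite -(tofcK y) marg_likE mulr_gt0 ?node_dens_gt0 ?gauss_pdf_gt0. Qed.

(** The mask sets the coefficients of inactive effects to zero, which makes the law of this vector
    degenerate as announced. *)
Definition coef_of (j : nat) (s r : bool) (x : K) (y : n.-tuple K) (e : G.-tuple K) : G.-tuple K :=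
  tofc (mask s r *m post_coef (Xmat K n_ s r) (prec j) (chol j s r) x y e).

Lemma measurable_coef_of j s r :
  measurable_fun setT (fun p : K * n.-tuple K * G.-tuple K => coef_of j s r p.1.1 p.1.2 p.2).
Proof.
apply: measurable_tofc; apply: mx_measurableM; first exact: mx_measurable_cst.
exact: measurable_post_coef.
Qed.

Lemma measurable_coef_of_inner j s r x y : measurable_fun setT (coef_of j s r x y).
Proof. exact: (measurableT_comp (measurable_coef_of j s r) (pair1_measurable (x, y))). Qed.

HB.instance Definition _ j s r x y :=
  isMeasurableFun.Build _ _ _ _ (coef_of j s r x y) (measurable_coef_of_inner j s r x y).

Definition coef_law j s r x y : probability (G.-tuple K) K :=
  distribution (gauss K G) (coef_of j s r x y).

Lemma coef_lawE j s r x y (B : set (G.-tuple K)) : measurable B ->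
  coef_law j s r x y B = (\int[gauss K G]_e (\1_B (coef_of j s r x y e))%:E)%E.
Proof.
move=> mB; have mc := measurable_coef_of_inner j s r x y.
have mB' : measurable (coef_of j s r x y @^-1` B) by rewrite -[X in measurable X]setTI; exact: mc.
rewrite -[LHS]/(gauss K G (coef_of j s r x y @^-1` B)) -[X in gauss K G X]setIT -integral_indic//.
Qed.

(** The vector is the mean plus sqrt x D e with D = mask T^(-1), so a linear form in it is a
    constant plus a linear form in e, whose law is given by [gauss_linear]. The covariance x D D^T
    is the Hadamard product by [hadamard_mask]. *)
Lemma coef_law_mvnormal j s r x (y : n.-tuple K) : 0 < x ->
  is_mvnormal (coef_law j s r x y) (mu_star h j (colt y) s r)
    (x *: hadamard (Mmat K G s r) (invmx (Lambda_star h n_ j s r))).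
Proof.
move=> x0; have [trT T0 TA] := cholP j s r; set T := chol j s r in trT T0 TA *.
set V := _ *: _; pose D := mask s r *m invmx T.
have VE : V = x *: (D *m D^T).
  rewrite /V hadamard_mask invmx_Lambda_star -/T /D trmx_mul mask_tr; congr (_ *: _).
  by rewrite !mulmxA.
split; first by rewrite VE linearZ/= trmx_mul trmxK.
move=> a'; pose c : 'cV[K]_G := Num.sqrt x *: (D^T *m a').
have aVa : (a'^T *m V *m a') 0 0 = \sum_i c i 0 ^+ 2.
  have cT : c^T = Num.sqrt x *: (a'^T *m D) by rewrite /c linearZ/= trmx_mul trmxK.
  rewrite -mulmx_tr_diag cT /c -[in RHS]scalemxAl -[in RHS]scalemxAr scalerA -expr2 sqr_sqrtr ?ltW//.
  by rewrite VE -scalemxAr -scalemxAl !mulmxA.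
split; first by rewrite aVa; apply: sumr_ge0 => i _; exact: sqr_ge0.
move=> B mB; rewrite aVa -gauss_linear//.
have ml : measurable_fun setT (fun t : G.-tuple K => \sum_(i < G) a' i 0 * tnth t i).
  by apply: measurable_sum => i; apply: measurable_funM => //; exact: measurable_tnth.
have mB' : measurable [set t : G.-tuple K | B (\sum_(i < G) a' i 0 * tnth t i)].
  by rewrite -[X in measurable X]setTI; exact: ml.
rewrite coef_lawE//; apply: eq_integral => e _; congr EFin; rewrite !indicE.
congr (nat_of_bool _)%:R; rewrite [LHS](_ : _ = (\sum_(i < G) a' i 0 * tnth (coef_of j s r x y e) i \in B)); last first.
  by apply/idP/idP; rewrite !inE.
congr (_ \in B).
transitivity ((a'^T *m (mask s r *m post_coef (Xmat K n_ s r) (prec j) T x y e)) 0 0).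
  by rewrite mxE; apply: eq_bigr => i _; rewrite mxE tnth_mktuple.
rewrite /post_coef mulmxDr -mu_starE mask_mu_star mulmxDr mxE; congr (_ + _).
rewrite -!scalemxAr !mulmxA -(mulmxA a'^T) -/D.
have -> : Num.sqrt x *: (a'^T *m D *m colt e) = c^T *m colt e.
  by rewrite /c linearZ/= trmx_mul trmxK -scalemxAl.
by rewrite mxE; apply: eq_bigr => i _; rewrite !mxE.
Qed.

End node_parameters.

Section normal_law.
Local Open Scope ereal_scope.
Context (K : realType).

Lemma prod_EFin (I : Type) (s : seq I) (Q : pred I) (f : I -> K) :
  \prod_(i <- s | Q i) (f i)%:E = (\prod_(i <- s | Q i) f i)%:E.
Proof. by rewrite (big_morph EFin (@EFinM K) erefl). Qed.

(** Through [normal_lawE] the case distinction on the variance disappears and the law becomes an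
    integral with a parameter, measurable in it by Tonelli's theorem. *)
Lemma measurable_normal_law (c : K) (B : set K) : measurable B ->
  measurable_fun setT (fun x : K => normal_law 0%R (c * x)%R B).
Proof.
move=> mB.
have -> : (fun x : K => normal_law 0%R (c * x)%R B) =
   (fun x => \int[gauss1 K]_e (\1_B (0 + Num.sqrt (c * x) * e)%R)%:E).
  by apply/funext => x; rewrite normal_lawE.
pose f (p : K * K) := (\1_B (0 + Num.sqrt (c * p.1) * p.2)%R)%:E : \bar K.
apply: (measurable_fun_fubini_tonelli_F f); last by move=> p; rewrite lee_fin.
apply/measurable_EFinP; apply: measurableT_comp; first exact: measurable_indic.
apply: measurable_funD => //; apply: measurable_funM => //.
apply: (measurableT_comp (@measurable_sqrt K)); exact: measurable_funM.
Qed.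

Lemma measurable_normal_law1 (B : set K) : measurable B ->
  measurable_fun setT (fun x : K => normal_law 0%R x B).
Proof.
move=> mB; rewrite (_ : (fun _ => _) = (fun x => normal_law 0%R (1 * x)%R B)).
  exact: measurable_normal_law.
by apply/funext => x; rewrite mul1r.
Qed.

Lemma normal_law_ge0 (m v : K) (B : set K) : measurable B -> 0 <= normal_law m v B.
Proof. by move=> mB; rewrite normal_lawE//; apply: integral_ge0 => x _; rewrite lee_fin. Qed.

Lemma normal_law_le1 (m v : K) (B : set K) : measurable B -> normal_law m v B <= 1.
Proof.
move=> mB; rewrite /normal_law; case: ifP => _; first exact: probability_le1.
by rewrite diracE lee_fin; case: (_ \in _).
Qed.

Lemma normal_law_fineK (m v : K) (B : set K) : measurable B ->
  (fine (normal_law m v B))%:E = normal_law m v B.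
Proof.
move=> mB; rewrite fineK// ge0_fin_numE ?normal_law_ge0//.
by rewrite (le_lt_trans (normal_law_le1 _ _ _))// ltry.
Qed.

Lemma indic_forall (Omega : Type) (I : finType) (T : Type) (A : I -> set T) (f : I -> Omega -> T) w :
  (\1_[set w | forall i, A i (f i w)] w)%:E = \prod_i (\1_(A i) (f i w))%:E :> \bar K.
Proof.
rewrite prod_EFin; congr EFin; rewrite indicE.
have [h|] := boolP (w \in _).
  by rewrite big1// => i _; rewrite indicE mem_set//; rewrite inE in h.
rewrite notin_setE/= => /existsNP[i hi]; rewrite (bigD1 i)//= indicE memNset//.
by rewrite mul0r.
Qed.

End normal_law.

Lemma indic_setX (K : realType) (T1 T2 : Type) (A : set T1) (B : set T2) p :
  (\1_(A `*` B) p)%:E = ((\1_A p.1)%:E * (\1_B p.2)%:E)%E :> \bar K.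
Proof. by rewrite !indicE in_setX -EFinM -natrM mulnb. Qed.

Lemma integral_indicT d (T : measurableType d) (K : realType) (m : {measure set T -> \bar K})
  (E : set T) : measurable E -> (\int[m]_x (\1_E x)%:E = m E)%E.
Proof. by move=> mE; rewrite integral_indic// setIT. Qed.

Section prior_node.
Local Open Scope ereal_scope.
Context (K : realType) (J G : nat) (n_ : 'I_G -> nat) (h : hyper K J).
Local Notation n := (nobs n_).
Local Notation shape := (nu h + 1)%R.
Local Notation rate := (nu h * sigma02 h)%R.

(** Turns a variance and independent standard noise into variance, coefficients and errors under the
    prior with states s and r. *)
Definition prior_map (j : nat) (s r : bool) (p : K * (G.-tuple K * n.-tuple K)) :
    K * (G.-tuple K * n.-tuple K) :=
  (p.1, (tofc (mask K G s r *m prior_coef (prec h j) p.1 p.2.1),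
         tofc (Num.sqrt p.1 *: colt p.2.2)%R)).

Lemma measurable_prior_map j s r : measurable_fun setT (prior_map j s r).
Proof.
have m2 : measurable_fun [set: K * (G.-tuple K * n.-tuple K)] (fun p => p.2.1).
  exact: (measurableT_comp measurable_fst measurable_snd).
have m3 : measurable_fun [set: K * (G.-tuple K * n.-tuple K)] (fun p => p.2.2).
  exact: (measurableT_comp measurable_snd measurable_snd).
apply: measurable_fun_pair => //; apply: measurable_fun_pair; apply: measurable_tofc.
  apply: mx_measurableM; first exact: mx_measurable_cst.
  move=> i k; exact: (measurableT_comp (measurable_prior_coef (prec h j) i k) (measurable_fun_pair measurable_fst m2)).
apply: mx_measurableZ; first exact: (measurableT_comp (@measurable_sqrt K) measurable_fst).
exact: mx_measurable_colt.
Qed.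

Definition noise : probability (G.-tuple K * n.-tuple K)%type K := gauss K G \x gauss K n.

Definition prior_base : probability (K * (G.-tuple K * n.-tuple K))%type K := igp shape rate \x noise.

Lemma integral_prior_base (f : K * (G.-tuple K * n.-tuple K) -> \bar K) :
  measurable_fun setT f -> (forall p, 0 <= f p) ->
  \int[prior_base]_p f p =
  \int[igp shape rate]_s \int[gauss K G]_e \int[gauss K n]_t f (s, (e, t)).
Proof.
move=> mf f0; rewrite /prior_base.
etransitivity; first exact: (fubini_tonelli1 (m1 := igp shape rate) (m2 := noise) f mf f0).
apply: eq_integral => s _.
have mfs : measurable_fun setT (fun q => f (s, q)) by exact: measurableT_comp.
exact: (fubini_tonelli1 (m1 := gauss K G) (m2 := gauss K n) _ mfs (fun q => f0 _)).
Qed.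

Definition prior_law (j : nat) (s r : bool) : {measure set (K * (G.-tuple K * n.-tuple K)) -> \bar K} :=
  image_measure prior_base (measurable_prior_map j s r).

Lemma integral_prior_law j s r (f : K * (G.-tuple K * n.-tuple K) -> \bar K) :
  measurable_fun setT f -> (forall p, 0 <= f p) ->
  \int[prior_law j s r]_p f p =
  \int[igp shape rate]_x \int[gauss K G]_e \int[gauss K n]_t f (prior_map j s r (x, (e, t))).
Proof.
move=> mf f0; rewrite integral_image// (integral_prior_base _ (fun p => f0 _))//.
by apply: measurableT_comp => //; exact: measurable_prior_map.
Qed.

Lemma prior_law_box j (s r : bool) (A : set K) (B : 'I_G -> set K) (C : 'I_n -> set K) :
  measurable A -> (forall g, measurable (B g)) -> (forall l, measurable (C l)) ->
  prior_law j s r (A `*` (box B `*` box C)) =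
  \int[igp shape rate]_x ((\1_A x)%:E *
    (\prod_(g < G) normal_law 0 ((if g == 0%N :> nat then s%:R * tau h j else r%:R * upsilon h j) * x)%R (B g) *
     \prod_(l < n) normal_law 0 x (C l))).
Proof.
move=> mA mB mC.
have mE : measurable (A `*` (box B `*` box C)).
  by do !apply: measurableX => //; exact: measurable_box.
transitivity (\int[prior_law j s r]_p (\1_(A `*` (box B `*` box C)) p)%:E).
  exact/esym/integral_indicT.
rewrite integral_prior_law; last 2 first.
- by apply/measurable_EFinP; exact: measurable_indic.
- by move=> p; rewrite lee_fin.
apply: eq_integral => x _.
pose FB (g : 'I_G) (e : K) : \bar K := (\1_(B g) (0 + Num.sqrt ((if g == 0%N :> nat then s%:R * tau h j else r%:R * upsilon h j) * x) * e)%R)%:E.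
pose FC (l : 'I_n) (t : K) : \bar K := (\1_(C l) (0 + Num.sqrt x * t)%R)%:E.
transitivity (\int[gauss K G]_e \int[gauss K n]_t ((\1_A x)%:E * (\prod_(g < G) FB g (tnth e g) * \prod_(l < n) FC l (tnth t l)))).
  apply: eq_integral => e _; apply: eq_integral => t _.
  rewrite !indic_setX; congr (_ * (_ * _)).
    etransitivity; first exact: (@indic_forall K _ _ _ B (fun i t => tnth t i)).
    apply: eq_bigr => g _; rewrite tnth_mktuple maskE mxE /FB add0r mulrA; congr (\1_(B g) (_ * _)%R)%:E.
    (* The mask multiplies outside the square root, the states inside; the two agree since the
       states are 0 or 1. *)
    rewrite /prec; case: ifP => _; rewrite invrK.
      by case: (s); rewrite ?mul1r ?mul0r ?sqrtr0// mulrC.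
    by case: (r); rewrite ?mul1r ?mul0r ?sqrtr0// mulrC.
  etransitivity; first exact: (@indic_forall K _ _ _ C (fun i t => tnth t i)).
  by apply: eq_bigr => l _; rewrite tnth_mktuple !mxE /FC add0r.
have mFB g : measurable_fun setT (FB g).
  apply/measurable_EFinP; apply: measurableT_comp; first exact: measurable_indic.
  by apply: measurable_funD => //; exact: measurable_funM.
have mFC l : measurable_fun setT (FC l).
  apply/measurable_EFinP; apply: measurableT_comp; first exact: measurable_indic.
  by apply: measurable_funD => //; exact: measurable_funM.
have FB0 g y : 0 <= FB g y by rewrite lee_fin.
have FC0 l y : 0 <= FC l y by rewrite lee_fin.
have mPB : measurable_fun setT (fun e : G.-tuple K => \prod_(g < G) FB g (tnth e g)).
  by apply: emeasurable_prod => g; exact: measurableT_comp (mFB g) (measurable_tnth g).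
have mPC : measurable_fun setT (fun t : n.-tuple K => \prod_(l < n) FC l (tnth t l)).
  by apply: emeasurable_prod => l; exact: measurableT_comp (mFC l) (measurable_tnth l).
have PB0 e : 0 <= \prod_(g < G) FB g (tnth e g) by apply: prode_ge0' => g.
have PC0 t : 0 <= \prod_(l < n) FC l (tnth t l) by apply: prode_ge0' => l.
transitivity (\int[gauss K G]_e ((\1_A x)%:E * (\prod_(g < G) FB g (tnth e g) * \prod_(l < n) normal_law 0%R x (C l)))).
  apply: eq_integral => e _.
  rewrite ge0_integralZl//; last 2 first.
  - by apply: emeasurable_funM.
  - by move=> t _; rewrite mule_ge0.
  rewrite ge0_integralZl//; congr (_ * (_ * _)).
  etransitivity; first exact: (@integral_ipow_prod _ _ _ (gauss1 K) n FC).
  by apply: eq_bigr => l _; rewrite normal_lawE.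
have N0 : 0 <= \prod_(l < n) normal_law 0%R x (C l).
  by apply: prode_ge0' => l; exact: normal_law_ge0.
rewrite ge0_integralZl//; last 2 first.
- by apply: emeasurable_funM.
- by move=> t _; rewrite mule_ge0.
rewrite ge0_integralZr//; congr (_ * (_ * _)).
etransitivity; first exact: (@integral_ipow_prod _ _ _ (gauss1 K) G FB).
by apply: eq_bigr => g _; rewrite normal_lawE.
Qed.

End prior_node.

Section posterior_node.
Local Open Scope ereal_scope.
Context (K : realType) (J G : nat) (n_ : 'I_G -> nat) (h : hyper K J).
Hypotheses (hnu : (0 < nu h)%R) (hsigma02 : (0 < sigma02 h)%R)
    (htau : (0 < tau0 h)%R) (hupsilon : (0 < upsilon0 h)%R).
Local Notation n := (nobs n_).
Local Notation shape := (nu h + 1)%R.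
Local Notation rate := (nu h * sigma02 h)%R.
Variables (j : nat) (s r : bool).
Local Notation dens := (node_dens (n_ := n_) htau hupsilon j s r).
Local Notation X := (Xmat K n_ s r).

Definition post_igp (y : n.-tuple K) : probability _ K :=
  igp (shape + n%:R / 2) (rate + Upsilon h j (colt y) s r).

Lemma post_shape_gt1 : (1 < shape + n%:R / 2)%R.
Proof. by rewrite (lt_le_trans (shape_gt1 hnu))// lerDl divr_ge0. Qed.

Lemma post_rate_gt0 (y : 'cV[K]_n) : (0 < rate + Upsilon h j y s r)%R.
Proof.
rewrite ltr_wpDr ?rate_gt0// UpsilonE reg_rss_ge0// => g; exact: prec_gt0.
Qed.

Lemma post_igpE y A : measurable A -> post_igp y A =
  invgamma_law (shape + n%:R / 2) (rate + Upsilon h j (colt y) s r) A.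
Proof. by move=> mA; apply: igpE => //; [exact: post_shape_gt1|exact: post_rate_gt0]. Qed.

(* The joint density of sigma^2 and the data with respect to the prior of sigma^2
   times the standard Gaussian law. *)
Definition sigma_weight (p : K * n.-tuple K) : K :=
  (reg_weight (prec h j) (chol n_ htau hupsilon j s r) p.2 *
   (p.1 `^ (- (n%:R / 2)) * expR (- (Upsilon h j (colt p.2) s r / p.1))))%R.

Lemma sigma_weight_ge0 p : (0 <= sigma_weight p)%R.
Proof.
have [trT T0 TA] := cholP n_ htau hupsilon j s r.
rewrite mulr_ge0 ?(ltW (reg_weight_gt0 _ _ _))// ?mulr_ge0 ?powR_ge0 ?expR_ge0//.
by move=> g; exact: prec_gt0.
Qed.

Lemma measurable_sigma_weight : measurable_fun setT sigma_weight.
Proof.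
apply: measurable_funM.
  apply: measurable_funM => //; apply: measurableT_comp => //; apply: measurable_funM => //.
  by apply: measurable_sqn; exact: mx_measurable_colt.
apply: measurable_funM; first exact: (measurableT_comp (measurable_powR _) measurable_fst).
apply: measurableT_comp => //; apply: measurableT_comp; first exact: oppr_measurable.
apply: measurable_funM.
  exact: (measurableT_comp (@measurable_rss _ _ _ X (prec h j)) measurable_snd).
exact: (measurableT_comp (@measurable_inv K) measurable_fst).
Qed.

(** This is [igp_conjugate] read from right to left: the posterior of the variance, scaled by the
    density of y, has density [sigma_weight] relative to the prior. *)
Lemma node_posterior (y : n.-tuple K) (g : K -> \bar K) :
  measurable_fun setT g -> (forall x, 0 <= g x) ->
  (dens y)%:E * \int[post_igp y]_x g x =
  \int[igp shape rate]_x (g x * (sigma_weight (x, y))%:E).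
Proof.
move=> mg g0; have [trT T0 TA] := cholP n_ htau hupsilon j s r.
have lam0 k : (0 < prec h j (k : 'I_G))%R by exact: prec_gt0.
have w0 := ltW (reg_weight_gt0 lam0 T0 y).
transitivity ((reg_weight (prec h j) (chol n_ htau hupsilon j s r) y)%:E *
    \int[igp shape rate]_x (g x *
      (x `^ (- (n%:R / 2)) * expR (- (Upsilon h j (colt y) s r / x)))%:E)).
  have c0 : (0 <= Upsilon h j (colt y) s r)%R by exact: reg_rss_ge0.
  have n0 : (0 <= n%:R / 2 :> K)%R by rewrite divr_ge0.
  rewrite [X in _ = _ * X](igp_conjugate (shape_gt1 hnu) (rate_gt0 hnu hsigma02) c0 n0 mg g0).
  by rewrite muleA -EFinM.
rewrite -ge0_integralZl//.
- by apply: eq_integral => x _; rewrite /sigma_weight/= EFinM muleCA.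
- apply: emeasurable_funM => //; apply/measurable_EFinP; apply: measurable_funM.
    exact: measurable_powR.
  apply: measurableT_comp => //; apply: measurableT_comp; first exact: oppr_measurable.
  by apply: measurable_funM => //; exact: measurable_inv.
- by move=> x _; rewrite mule_ge0// lee_fin mulr_ge0 ?powR_ge0 ?expR_ge0.
Qed.

(** The law [post_igp y] varies with y. By [node_posterior] the integral is one against the fixed
    prior with a jointly measurable density, divided by the positive density of y, so Tonelli's
    theorem applies. *)
Lemma measurable_post_igp (g : K * n.-tuple K -> \bar K) :
  measurable_fun setT g -> (forall p, 0 <= g p) ->
  measurable_fun setT (fun y => \int[post_igp y]_x g (x, y)).
Proof.
move=> mg g0.
have -> : (fun y => \int[post_igp y]_x g (x, y)) =
    (fun y => (dens y)^-1%:E * \int[igp shape rate]_x (g (x, y) * (sigma_weight (x, y))%:E)).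
  apply/funext => y.
  have mgy : measurable_fun setT (fun x => g (x, y)) by exact: measurableT_comp.
  rewrite -[X in _ = _ * X](node_posterior y mgy (fun x => g0 _)) muleA -EFinM mulVf ?mul1e//.
  by rewrite gt_eqF// node_dens_gt0.
apply: emeasurable_funM.
  apply/measurable_EFinP; apply: (measurableT_comp (@measurable_inv K)).
  exact: measurable_node_dens.
have mk : measurable_fun setT (fun p => g p * (sigma_weight p)%:E).
  by apply: emeasurable_funM => //; apply/measurable_EFinP; exact: measurable_sigma_weight.
apply: (measurable_fun_fubini_tonelli_G (fun p => g p * (sigma_weight p)%:E)) => // p.
by rewrite mule_ge0// lee_fin sigma_weight_ge0.
Qed.

Definition coef_int (E : set (K * G.-tuple K)) (p : K * n.-tuple K) : \bar K :=
  \int[gauss K G]_e (\1_E (p.1, coef_of htau hupsilon j s r p.1 p.2 e))%:E.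

Lemma coef_int_ge0 E p : 0 <= coef_int E p.
Proof. by apply: integral_ge0 => e _; rewrite lee_fin. Qed.

Lemma measurable_coef_pair :
  measurable_fun setT (fun q : (K * n.-tuple K) * G.-tuple K =>
    (q.1.1, coef_of htau hupsilon j s r q.1.1 q.1.2 q.2)).
Proof.
apply: measurable_fun_pair; last exact: measurable_coef_of.
exact: (measurableT_comp measurable_fst measurable_fst).
Qed.

Lemma coef_int_le1 E p : measurable E -> coef_int E p <= 1.
Proof.
move=> mE; rewrite -(probability_setT (gauss K G)) -[leRHS]integral_indicT//.
apply: ge0_le_integral => //.
- apply/measurable_EFinP; apply: measurableT_comp; first exact: measurable_indic.
  exact: (measurableT_comp measurable_coef_pair (pair1_measurable p)).
- by apply/measurable_EFinP; exact: measurable_indic.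
- by move=> e _; rewrite lee_fin !indicE in_setT; case: (_ \in _).
Qed.

Lemma measurable_coef_int E : measurable E -> measurable_fun setT (coef_int E).
Proof.
move=> mE.
apply: (measurable_fun_fubini_tonelli_F (fun q : (K * n.-tuple K) * G.-tuple K =>
    (\1_E (q.1.1, coef_of htau hupsilon j s r q.1.1 q.1.2 q.2))%:E)).
- apply/measurable_EFinP; apply: measurableT_comp; first exact: measurable_indic.
  exact: measurable_coef_pair.
- by move=> q; rewrite lee_fin.
Qed.

Definition post_law (y : n.-tuple K) (E : set (K * G.-tuple K)) : \bar K :=
  \int[post_igp y]_x coef_int E (x, y).

Lemma post_law_ge0 y E : 0 <= post_law y E.
Proof. by apply: integral_ge0 => x _; exact: coef_int_ge0. Qed.

Lemma post_law_le1 y E : measurable E -> post_law y E <= 1.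
Proof.
move=> mE; rewrite -(probability_setT (post_igp y)) -[leRHS]integral_indicT//.
apply: ge0_le_integral => //.
- by move=> x _; exact: coef_int_ge0.
- exact: (measurableT_comp (measurable_coef_int mE)).
- by apply/measurable_EFinP; exact: measurable_indic.
- by move=> x _; rewrite indicE in_setT; exact: coef_int_le1.
Qed.

Lemma measurable_post_law E : measurable E -> measurable_fun setT (post_law ^~ E).
Proof.
by move=> mE; apply: (measurable_post_igp (measurable_coef_int mE)) => p; exact: coef_int_ge0.
Qed.

Lemma post_law_fineK y E : measurable E -> (fine (post_law y E))%:E = post_law y E.
Proof.
move=> mE; rewrite fineK// ge0_fin_numE ?post_law_ge0//.
by rewrite (le_lt_trans (post_law_le1 _ _))// ltry.
Qed.

(** The coefficients are already masked, so the full design X(1, 1) produces the data whatever the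
    states are. *)
Definition add_effects (q : K * (G.-tuple K * n.-tuple K)) : K * (G.-tuple K * n.-tuple K) :=
  (q.1, (q.2.1, tofc (Xmat K n_ true true *m colt q.2.1 + colt q.2.2)%R)).

Lemma measurable_add_effects : measurable_fun setT add_effects.
Proof.
have m2 : measurable_fun [set: K * (G.-tuple K * n.-tuple K)] (fun p => p.2.1).
  exact: (measurableT_comp measurable_fst measurable_snd).
have m3 : measurable_fun [set: K * (G.-tuple K * n.-tuple K)] (fun p => p.2.2).
  exact: (measurableT_comp measurable_snd measurable_snd).
apply: measurable_fun_pair => //; apply: measurable_fun_pair => //; apply: measurable_tofc.
apply: mx_measurableD; last exact: mx_measurable_colt.
by apply: mx_measurableM; [exact: mx_measurable_cst|exact: mx_measurable_colt].
Qed.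

(** This is [node_conjugacy] with the test function composed with the mask on the coefficients; on
    the prior side, X(s, r) = X(1, 1) mask turns the design of the node into [add_effects]. *)
Lemma prior_law_data (f : K * (G.-tuple K * n.-tuple K) -> \bar K) :
  measurable_fun setT f -> (forall t, 0 <= f t) ->
  \int[prior_law n_ h j s r]_q f (add_effects q) =
  \int[gauss K n]_y ((dens y)%:E * \int[post_igp y]_x \int[gauss K G]_e
     f (x, (coef_of htau hupsilon j s r x y e, y))).
Proof.
move=> mf f0; have [trT T0 TA] := cholP n_ htau hupsilon j s r.
have lam0 k : (0 < prec h j (k : 'I_G))%R by exact: prec_gt0.
pose f' (q : K * (G.-tuple K * n.-tuple K)) := f (q.1, (tofc (mask K G s r *m colt q.2.1), q.2.2)).
have mf' : measurable_fun setT f'.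
  apply: (measurableT_comp mf); apply: measurable_fun_pair => //; apply: measurable_fun_pair.
    apply: measurable_tofc; apply: mx_measurableM; first exact: mx_measurable_cst.
    by apply: mx_measurable_colt; exact: (measurableT_comp measurable_fst measurable_snd).
  exact: (measurableT_comp measurable_snd measurable_snd).
have := node_conjugacy lam0 trT T0 TA (shape_gt1 hnu) (rate_gt0 hnu hsigma02) mf' (fun q => f0 _).
rewrite integral_prior_law; last 2 first.
- by apply: measurableT_comp => //; exact: measurable_add_effects.
- by move=> q; exact: f0.
move=> e; apply: etrans (etrans _ e) _.
  apply: eq_integral => x _; apply: eq_integral => c _; apply: eq_integral => t _.
  by rewrite /f' /add_effects/= !tofcK (@XmatE K G n_ s r) mulmxA.
apply: eq_integral => y _; apply: (congr1 (fun t => (dens y)%:E * t)); apply: eq_integral => x _.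
by apply: eq_integral => c _; rewrite /f'/= tofcK.
Qed.

End posterior_node.

Section measurable_recursion.
Context (K : realType) (J G : nat) (n_ : 'I_G -> nat) (h : hyper K J).
Context d (U : measurableType d).

Lemma measurable_xi_step (f : U -> node J -> bool -> bool -> K) v s r :
  (forall s' r', measurable_fun setT (fun y => f y v s' r')) ->
  measurable_fun setT (fun y => xi_step h (f y) v s r).
Proof.
move=> mf; rewrite /xi_step; case: (lev v == 0%N); apply: measurable_sum => s';
  apply: measurable_sum => r'; apply: measurable_funM => //; exact: mf.
Qed.

Lemma measurable_phi_rec (m : U -> node J -> bool -> bool -> K) i v s r :
  (forall v s r, measurable_fun setT (fun y => m y v s r)) ->
  measurable_fun setT (fun y => phi_rec h (m y) i v s r).
Proof.
move=> mm; elim: i v s r => [|i ih] v s r /=; first exact: mm.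
by apply: measurable_funM; [apply: measurable_funM => //|]; apply: measurable_xi_step => *; exact: ih.
Qed.

End measurable_recursion.

Section versions.
Local Open Scope ereal_scope.
Context d (Omega : measurableType d) (K : realType) (P : probability Omega K).

Lemma smeasurable_mix d' d'' (U : measurableType d') (T : measurableType d'') (Gen : set (set Omega))
    (Pi : finType) (pi : Omega -> Pi) (Z : Omega -> U) (f : Pi -> U -> T) :
  (forall p, <<s Gen >> [set w | pi w = p]) -> smeasurable <<s Gen >> Z ->
  (forall p, measurable_fun setT (f p)) -> smeasurable <<s Gen >> (fun w => f (pi w) (Z w)).
Proof.
move=> mpi mZ mf B mB.
rewrite (_ : _ @^-1` _ = \bigcup_(p in setT) ([set w | pi w = p] `&` Z @^-1` (f p @^-1` B))).
  apply: (@fin_bigcup_measurable _ (g_sigma_algebraType Gen)) => [|p _]; first exact: finite_finset.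
  apply: (@measurableI _ (g_sigma_algebraType Gen)); first exact: mpi.
  by apply: mZ; rewrite -[X in measurable X]setTI; exact: mf.
by apply/seteqP; split => [w Bw|w [p _ [/= <-]]//]; exists (pi w).
Qed.

Lemma integral_structured d' (U : measurableType d') (Cf : finType) (H : Omega -> Cf) (Z : Omega -> U)
    (A : set Omega) (f : Omega -> \bar K) :
  (forall c, measurable [set w | H w = c]) -> measurable_fun setT Z -> measurable A ->
  measurable_fun setT f -> (forall w, 0 <= f w) ->
  (forall c B, measurable B ->
     P ([set w | H w = c] `&` Z @^-1` B `&` A) = \int[P]_(w in [set w | H w = c] `&` Z @^-1` B) f w) ->
  forall C, structured H Z C -> P (C `&` A) = \int[P]_(w in C) f w.
Proof.
move=> mH mZ mA mf f0 h _ [D mD ->].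
pose E c := [set w | H w = c] `&` Z @^-1` D c.
have mE c : measurable (E c).
  by apply: measurableI => //; rewrite -[X in measurable X]setTI; exact: mZ.
have EE : [set w | D (H w) (Z w)] = \bigcup_(c in setT) E c.
  by apply/seteqP; split => [w /= Dw|w [c _ [/= <-]]//]; exists (H w).
have mC : measurable [set w | D (H w) (Z w)].
  by rewrite EE; apply: fin_bigcup_measurable => [|c _]; [exact: finite_finset|].
have split_int g : measurable_fun setT g -> (forall w, 0 <= g w) ->
    \int[P]_(w in [set w | D (H w) (Z w)]) g w = \sum_c \int[P]_(w in E c) g w.
  move=> mg g0; rewrite -integral_indicM//.
  transitivity (\int[P]_w \sum_c ((\1_(E c) w)%:E * g w)).
    apply: eq_integral => w _; rewrite (bigD1 (H w))//= big1 ?adde0; last first.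
      move=> c cH; rewrite indicE memNset ?mul0e// => -[/= Hc _].
      by rewrite Hc eqxx in cH.
    congr (_ * _); rewrite !indicE; congr (nat_of_bool _)%:R%:E.
    by apply/idP/idP; rewrite !inE => //; case.
  rewrite ge0_integral_sum//.
  - by apply: eq_bigr => c _; rewrite integral_indicM.
  - move=> c; apply: emeasurable_funM => //; apply/measurable_EFinP; exact: measurable_indic.
  - by move=> c w _; rewrite mule_ge0// lee_fin.
have mi : measurable_fun setT (fun w => (\1_A w)%:E : \bar K).
  by apply/measurable_EFinP; exact: measurable_indic.
rewrite (split_int f)// setIC -integral_indic// split_int//.
apply: eq_bigr => c _; rewrite integral_indic// setIC; exact: h.
Qed.

End versions.

Lemma smeasurable_comp d d' d'' (Omega : measurableType d) (U : measurableType d') (T : measurableType d'')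
    (F : set (set Omega)) (Z : Omega -> U) (f : U -> T) :
  measurable_fun setT f -> smeasurable F Z -> smeasurable F (fun w => f (Z w)).
Proof. by move=> mf mZ B mB; apply: (mZ (f @^-1` B)); rewrite -[X in measurable X]setTI; exact: mf. Qed.

(** * The posterior *)

Section nig_mg.
Context (K : realType) (J G : nat) (n_ : 'I_G -> nat) (h : hyper K J)
    (dO : measure_display) (Omega : measurableType dO) (P : probability Omega K)
    (S R : node J -> {RV P >-> bool})
    (sigma2 z : node J -> {RV P >-> K})
    (beta : node J -> 'I_G -> {RV P >-> K})
    (u d : node J -> {g : 'I_G & 'I_(n_ g)} -> {RV P >-> K}).
Hypotheses (hG : (2 <= G)%N)
    (hnu : 0 < nu h) (hsigma02 : 0 < sigma02 h)
    (htau : 0 < tau0 h) (hupsilon : 0 < upsilon0 h)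
    (hS : markov_tree (fun x => P [set w | forall v, S v w = x v])
            (rho0 h) (rho h))
    (hR : markov_tree (fun x => P [set w | forall v, R v w = x v])
            (kappa0 h) (kappa h))
    (hSR : forall x y : node J -> bool,
       P [set w | (forall v, S v w = x v) /\ (forall v, R v w = y v)] =
       (P [set w | forall v, S v w = x v] *
        P [set w | forall v, R v w = y v])%E)
    (hsigma2 : cond_indep_laws P <<s events_fam S `|` events_fam R >> sigma2
       (fun _ _ => invgamma_law (nu h + 1) (nu h * sigma02 h)))
    (hzbeta : cond_indep_laws P
       <<s events_fam S `|` events_fam R `|` events_fam sigma2 >>
       (fun vg : node J * 'I_G =>
          if (vg.2 == 0%N :> nat) then z vg.1 : Omega -> K else beta vg.1 vg.2)
       (fun vg w =>
          normal_law 0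
            (if (vg.2 == 0%N :> nat)
             then (S vg.1 w)%:R * tau h (lev vg.1) * sigma2 vg.1 w
             else (R vg.1 w)%:R * upsilon h (lev vg.1) * sigma2 vg.1 w)))
    (hbeta1 : forall v (g : 'I_G) w, g = 0%N :> nat -> beta v g w = 0)
    (hu : cond_indep_laws P
       <<s events_fam S `|` events_fam R `|` events_fam sigma2 `|` events_fam z
           `|` events_fam (fun vg : node J * 'I_G => beta vg.1 vg.2) >>
       (fun vo : node J * {g : 'I_G & 'I_(n_ g)} => u vo.1 vo.2)
       (fun vo w => normal_law 0 (sigma2 vo.1 w)))
    (hd : forall v o w, d v o w = z v w + beta v (tag o) w + u v o w).

Local Notation n := (nobs n_).
Local Notation N := #|{: node J}|.
Local Notation config := {ffun node J -> bool * bool}.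
Local Notation obs := {g : 'I_G & 'I_(n_ g)}.
Local Notation Y := (N.-tuple (n.-tuple K)).
Local Notation shape := (nu h + 1).
Local Notation rate := (nu h * sigma02 h).
Local Notation node_law hc v := (prior_law n_ h (lev v) (hc v).1 (hc v).2).
Local Notation dens hc v := (node_dens (n_ := n_) htau hupsilon (lev v) (hc v).1 (hc v).2).
Local Notation plaw hc v := (post_law (n_ := n_) htau hupsilon (lev v) (hc v).1 (hc v).2).
Local Notation claw hc v := (coef_law (n_ := n_) htau hupsilon (lev v) (hc v).1 (hc v).2).
Local Notation evD := (events_fam (fun vo : node J * obs => d vo.1 vo.2 : Omega -> K)).
Local Notation evH := (events_fam (S : node J -> Omega -> bool) `|` events_fam (R : node J -> Omega -> bool)).
Local Notation evHv v := (events (S v : Omega -> bool) `|` events (R v : Omega -> bool)).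
Local Notation GenH := (evH `|` evD).

(** * Joint law of hidden states, variances, coefficients and errors *)

Definition hidden (w : Omega) : config := [ffun v => (S v w, R v w)].

Local Notation hid hc := [set w | hidden w = hc].

Lemma hidE hc : hid hc = [set w | (forall v, S v w = (hc v).1) /\ (forall v, R v w = (hc v).2)].
Proof.
apply/seteqP; split => [w /= <-|w /= [h1 h2]]; first by split => v; rewrite ffunE.
by apply/ffunP => v; rewrite ffunE h1 h2; case: (hc v).
Qed.

Lemma law_hidden (hc : config) : P (hid hc) = (prior_weight h hc)%:E.
Proof.
rewrite hidE hSR; case: hS => _ _ ->; case: hR => _ _ ->.
by rewrite -EFinM.
Qed.

Lemma prior_weight_ge0 (hc : config) : 0 <= prior_weight h hc.
Proof. by rewrite -lee_fin -(law_hidden hc). Qed.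

Lemma sigma_events (Gen : set (set Omega)) d' (T : measurableType d') (I : Type)
    (X : I -> Omega -> T) : events_fam X `<=` Gen ->
  forall i, smeasurable <<s Gen >> (X i).
Proof.
move=> XG i B mB; apply: sub_sigma_algebra; apply: XG; exists i => //.
by exists B => //; rewrite setTI.
Qed.

Lemma events_fam_measurable d' (T : measurableType d') (I : Type) (X : I -> {RV P >-> T}) :
  events_fam (fun i => X i : Omega -> T) `<=` measurable.
Proof. by move=> _ [i _] [B mB <-]; exact: measurable_funP. Qed.

Lemma sigmaI (Gen : set (set Omega)) A B : <<s Gen >> A -> <<s Gen >> B -> <<s Gen >> (A `&` B).
Proof. exact: (@measurableI _ (g_sigma_algebraType Gen)). Qed.

Lemma sigma_forall (Gen : set (set Omega)) (I : finType) (A : I -> set Omega) :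
  (forall i, <<s Gen >> (A i)) -> <<s Gen >> [set w | forall i, A i w].
Proof.
move=> mA; have -> : [set w | forall i, A i w] = \bigcap_(i in setT) A i.
  by apply/seteqP; split => w hw i //=; exact: hw.
by apply: (@fin_bigcap_measurable _ (g_sigma_algebraType Gen) _ setT A) => // i _; exact: mA.
Qed.

Lemma sigma_hid (Gen : set (set Omega)) hc : events_fam S `<=` Gen -> events_fam R `<=` Gen ->
  <<s Gen >> (hid hc).
Proof.
move=> hSG hRG; rewrite hidE.
apply: sigmaI; apply: sigma_forall => v.
- exact: (@sigma_events _ _ _ _ _ hSG v [set (hc v).1] I).
- exact: (@sigma_events _ _ _ _ _ hRG v [set (hc v).2] I).
Qed.

Lemma measurable_hid hc : measurable (hid hc).
Proof.
apply: (@sub_g_sigma _ _ (events_fam S `|` events_fam R)).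
  by rewrite subUset; split; exact: events_fam_measurable.
apply: sigma_hid; [exact: subsetUl|exact: subsetUr].
Qed.

(** The nodes are listed in a tuple so that the powers and boxes defined on tuples apply to families
    indexed by the tree. *)
Definition sigma_tuple (w : Omega) : N.-tuple K := [tuple sigma2 (enum_val i) w | i < N].

Lemma measurable_mktuple d1 d2 (U : measurableType d1) (T : measurableType d2) m
    (f : 'I_m -> U -> T) : (forall i, measurable_fun setT (f i)) ->
  measurable_fun setT (fun x => [tuple f i x | i < m]).
Proof.
move=> mf; apply/measurable_fun_tnthP => i.
by rewrite (_ : _ \o _ = f i)//; apply/funext => x /=; rewrite tnth_mktuple.
Qed.

Lemma prod_enum_val (F : node J -> \bar K) :
  (\prod_(i < N) F (enum_val i) = \prod_v F v)%E.
Proof.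
rewrite [RHS](reindex (@enum_val _ {: node J}))//.
exact: onW_bij (enum_val_bij _).
Qed.

(** [hsigma2] gives the law of the variances on boxes; the pi-system argument extends it to all
    events, then to integrals, and products are integrated factor by factor. *)
Lemma law_sigma (hc : config) (F : node J -> K -> \bar K) :
  (forall v, measurable_fun setT (F v)) -> (forall v x, 0 <= F v x)%E ->
  (\int[P]_(w in hid hc) \prod_v F v (sigma2 v w) =
   (prior_weight h hc)%:E * \prod_v \int[igp shape rate]_x F v x)%E.
Proof.
move=> mF F0.
have sh1 := shape_gt1 hnu; have rt0 := rate_gt0 hnu hsigma02.
have mst : measurable_fun setT sigma_tuple by exact: measurable_mktuple.
have mw1 : measurable_fun setT (\1_(hid hc) : Omega -> K).
  by apply: measurable_indic; exact: measurable_hid.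
have w10 w : 0 <= \1_(hid hc) w :> K by [].
pose m2 := ipow (igp shape rate) N.
have mw2 : measurable_fun [set: N.-tuple K] (fun=> prior_weight h hc) by [].
have w20 (t : N.-tuple K) : 0 <= prior_weight h hc by exact: prior_weight_ge0.
have total : (\int[P]_x (\1_(hid hc) x)%:E < +oo)%E.
  apply: (@le_lt_trans _ _ (P setT)); last by rewrite probability_setT ltry.
  rewrite integral_indic//; last exact: measurable_hid.
  by apply: le_measure => //; rewrite inE//; apply: measurableI => //; exact: measurable_hid.
have e := measure_pi_system mst (@measurable_id _ (N.-tuple K) setT) mw1 mw2 w10 w20
  (@boxesE _ K N) (@boxesI _ K N) (@boxesT _ K N) total.
have {}e B : measurable B -> (\int[P]_(x in sigma_tuple @^-1` B) (\1_(hid hc) x)%:E =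
    \int[m2]_(x in id @^-1` B) (prior_weight h hc)%:E)%E.
  apply: e => {B} _ [B mB ->].
  pose B' v := B (enum_rank v).
  have mB' v : measurable (B' v) by exact: mB.
  have [_ hs] := hsigma2 mB'.
  have mpre : measurable (sigma_tuple @^-1` box B).
    by rewrite -[X in measurable X]setTI; apply: mst => //; exact: measurable_box.
  rewrite integral_indic//; last exact: measurable_hid.
  have -> : sigma_tuple @^-1` box B = [set w | forall v, B' v (sigma2 v w)].
    apply/seteqP; split => w /= hw i.
      by have := hw (enum_rank i); rewrite tnth_mktuple enum_rankK.
    by rewrite tnth_mktuple; have := hw (enum_val i); rewrite /B' enum_valK.
  etransitivity; first by apply: hs; apply: sigma_hid; [exact: subsetUl|exact: subsetUr].
  rewrite integral_cst; last exact: measurable_hid.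
  rewrite preimage_id integral_cst; last exact: measurable_box.
  rewrite [X in (_ * X)%E = _](law_hidden hc) muleC; congr (_ * _)%E.
  rewrite -[RHS](_ : \int[m2]_t (\1_(box B) t)%:E = _)%E; last first.
    by rewrite integral_indic ?setIT//; exact: measurable_box.
  under eq_integral do rewrite (@indic_forall K _ _ _ B (fun i t => tnth t i)).
  etransitivity; last first.
    apply/esym/(@integral_ipow_prod _ _ _ (igp shape rate) N (fun i x => (\1_(B i) x)%:E)) => i.
    - by apply/measurable_EFinP; exact: measurable_indic.
    - by move=> x; rewrite lee_fin.
  rewrite -(prod_enum_val (fun v => invgamma_law shape rate (B' v))).
  apply: eq_bigr => i _; rewrite integral_indic// setIT /B' enum_valK.
  by apply/esym/igpE.
pose f (t : N.-tuple K) := (\prod_(i < N) F (enum_val i) (tnth t i))%E.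
have mf : measurable_fun setT f.
  apply: emeasurable_prod => i; exact: measurableT_comp (mF _) (measurable_tnth i).
have f0 t : (0 <= f t)%E by exact: prode_ge0'.
have := integral_transfer mst (@measurable_id _ (N.-tuple K) setT) mw1 mw2 w10 w20 e mf f0.
rewrite integral_mul_indic setTI => e2.
transitivity (\int[P]_(x in hid hc) f (sigma_tuple x))%E.
  apply: eq_integral => w _; rewrite /f -(prod_enum_val (fun v => F v (sigma2 v w))).
  by apply: eq_bigr => i _; rewrite tnth_mktuple.
rewrite e2 ge0_integralZr//; last by rewrite lee_fin prior_weight_ge0.
rewrite muleC; congr (_ * _)%E.
etransitivity; first exact: (@integral_ipow_prod _ _ _ (igp shape rate) N (fun i => F (enum_val i))).
exact: (prod_enum_val (fun v => \int[igp shape rate]_x F v x)%E).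
Qed.

Definition regr (v : node J) (g : 'I_G) (w : Omega) : K :=
  if g == 0%N :> nat then z v w else beta v g w.

Lemma measurable_regr v g : measurable_fun setT (regr v g).
Proof. by rewrite /regr; case: (g == 0%N :> nat); exact: measurable_funP. Qed.

Definition coef_var (hc : config) (v : node J) (g : 'I_G) : K :=
  if g == 0%N :> nat then (hc v).1%:R * tau h (lev v) else (hc v).2%:R * upsilon h (lev v).

(** The conditional hypotheses are chained from the innermost outwards: [hu] integrates out the
    errors, [hzbeta] the coefficients, and [law_sigma] the variances. *)
Lemma law_boxes (hc : config) (A : node J -> set K) (B : node J -> 'I_G -> set K)
    (C : node J -> obs -> set K) :
  (forall v, measurable (A v)) -> (forall v g, measurable (B v g)) ->
  (forall v o, measurable (C v o)) ->
  P (hid hc `&` [set w | forall v, A v (sigma2 v w)] `&`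
     [set w | forall v g, B v g (regr v g w)] `&`
     [set w | forall v o, C v o (u v o w)]) =
  ((prior_weight h hc)%:E * \prod_v \int[igp shape rate]_x ((\1_(A v) x)%:E *
    (\prod_g normal_law 0 (coef_var hc v g * x) (B v g) * \prod_o normal_law 0 x (C v o))))%E.
Proof.
move=> mA mB mC.
set sA := [set w | forall v, A v (sigma2 v w)].
have -> : [set w | forall v g, B v g (regr v g w)] =
    [set w | forall vg : node J * 'I_G, B vg.1 vg.2
      ((if (vg.2 == 0%N :> nat) then z vg.1 : Omega -> K else beta vg.1 vg.2) w)].
  apply/seteqP; split => [w /= H [v g]|w /= H v g]; last have := H (v, g).
    by have := H v g; rewrite /regr/=; case: ifP.
  by rewrite /regr/=; case: ifP.
have -> : [set w | forall v o, C v o (u v o w)] =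
    [set w | forall vo : node J * obs, C vo.1 vo.2 (u vo.1 vo.2 w)].
  by apply/seteqP; split => [w /= H [v o]|w /= H v o]; [exact: H|exact: (H (v, o))].
set zB := [set w | forall vg : node J * 'I_G, _].
set uC := [set w | forall vo : node J * obs, _].
pose GenS := events_fam S `|` events_fam R.
pose GenZ := GenS `|` events_fam sigma2.
have GZm : GenZ `<=` measurable.
  by rewrite !subUset; do !split; exact: events_fam_measurable.
have sZ v : smeasurable <<s GenZ >> (sigma2 v).
  by apply: (@sigma_events GenZ _ _ _ sigma2) => E EH; right.
have FsA : <<s GenZ >> (hid hc `&` sA).
  apply: sigmaI.
    by apply: sigma_hid => E EH; left; [left|right].
  by apply: sigma_forall => v; exact: sZ.
have Fz : <<s GenZ `|` events_fam z `|` events_fam (fun vg : node J * 'I_G => beta vg.1 vg.2) >> (hid hc `&` sA `&` zB).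
  apply: sigmaI.
    move: FsA; apply: (@sub_sigma_algebra2 _ setT) => E EH; by left; left.
  apply: sigma_forall => -[v g] /=; case: ifP => g0.
    by apply: (@sigma_events _ _ _ _ z _ v _ (mB v g)) => E EH; left; right.
  by apply: (@sigma_events _ _ _ _ (fun vg : node J * 'I_G => beta vg.1 vg.2) _ (v, g) _ (mB v g)) => E EH; right.
have mu' (vo : node J * obs) : measurable (C vo.1 vo.2) by [].
have [_ hu'] := hu mu'.
etransitivity; first exact: (hu' _ Fz).
have mz' (vg : node J * 'I_G) : measurable (B vg.1 vg.2) by [].
have hz := hzbeta mz'.
set gz := (X in cond_prob _ _ _ X) in hz.
(* [cond_prob_freeze] takes a real-valued version, and a product of probabilities is finite. *)
have gzE : gz = EFin \o (fun w => fine (gz w)).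
  apply/funext => w /=; rewrite /gz.
  under eq_bigr => vg _ do rewrite -(normal_law_fineK _ _ (mz' vg)).
  by rewrite prod_EFin.
have gz0 w : (0 <= gz w)%E by apply: prode_ge0' => vg; exact: normal_law_ge0.
rewrite gzE in hz.
etransitivity.
  (* The conditional probability of the errors depends on the variances alone, so it behaves as a
     constant while conditioning on the hidden states and the variances. *)
  apply: (cond_prob_freeze GZm _ FsA _ hz).
  - rewrite [X in measurable X](_ : _ = [set w | forall vg : node J * 'I_G, B vg.1 vg.2 (regr vg.1 vg.2 w)]); last first.
      by apply/seteqP; split => w /= H vg; have := H vg; rewrite /regr; case: ifP.
    apply: (@sub_g_sigma _ _ (events_fam (fun vg : node J * 'I_G => regr vg.1 vg.2))).
      move=> _ [[v g] _ [D mD <-]]; exact: measurable_regr.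
    apply: sigma_forall => vg.
    exact: (@sigma_events _ _ _ _ (fun vg : node J * 'I_G => regr vg.1 vg.2) _ vg _ (mz' vg)).
  - by move=> w; rewrite fine_ge0.
  - apply/smeasurableP; apply: emeasurable_prod => vo.
    have ms : measurable_fun [set: g_sigma_algebraType GenZ] (sigma2 vo.1).
      by apply/smeasurableP; exact: sZ.
    exact: (measurableT_comp (measurable_normal_law1 (mu' vo)) ms).
  - by move=> w; apply: prode_ge0' => vo; exact: normal_law_ge0.
transitivity (\int[P]_(w in hid hc) \prod_v ((\1_(A v) (sigma2 v w))%:E *
    (\prod_g normal_law 0 (coef_var hc v g * sigma2 v w)%R (B v g) *
     \prod_o normal_law 0 (sigma2 v w) (C v o))))%E.
  rewrite -integral_mul_indic; apply: eq_integral => w /[!inE] hw.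
  rewrite (indic_forall K A (fun v w => sigma2 v w)).
  rewrite !big_split/= muleC; congr (_ * _)%E; rewrite muleC; congr (_ * _)%E.
    have <- : gz w = (fine (gz w))%:E by rewrite [in LHS]gzE.
    rewrite /gz pair_bigA/=; apply: eq_bigr => vg _; congr (normal_law 0 _ _).
    rewrite /coef_var -hw ffunE/=; case: ifP => _ //.
  by rewrite pair_bigA.
apply: (@law_sigma hc (fun v x => ((\1_(A v) x)%:E * (\prod_g normal_law 0 (coef_var hc v g * x)%R (B v g) * \prod_o normal_law 0 x (C v o)))%E)).
- move=> v; apply: emeasurable_funM; first by apply/measurable_EFinP; exact: measurable_indic.
  apply: emeasurable_funM; apply: emeasurable_prod => i; first exact: measurable_normal_law.
  exact: measurable_normal_law1.
- move=> v x; rewrite mule_ge0 ?lee_fin// mule_ge0//; apply: prode_ge0' => i; exact: normal_law_ge0.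
Qed.

Definition node_rv (v : node J) (w : Omega) : K * (G.-tuple K * n.-tuple K) :=
  (sigma2 v w, ([tuple regr v g w | g < G], [tuple u v (tagnat.sig l) w | l < n])).

Lemma measurable_node_rv v : measurable_fun setT (node_rv v).
Proof.
apply: measurable_fun_pair => //; apply: measurable_fun_pair.
  by apply: measurable_mktuple => g; exact: measurable_regr.
by apply: measurable_mktuple.
Qed.

Definition node_sets : set (set (K * (G.-tuple K * n.-tuple K))) :=
  rectangles measurable (rectangles (@boxes _ K G) (@boxes _ K n)).

Lemma node_setsE : measurable = <<s node_sets >>.
Proof.
have mp : measurable = <<s rectangles (@boxes _ K G) (@boxes _ K n) >>.
  by apply: rectanglesE; [exact: boxesE|exact: boxesE|exact: boxesT|exact: boxesT].
apply: (rectanglesE _ mp) => //; last by apply: rectanglesT; exact: boxesT.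
exact: sigma_measurableE.
Qed.

Lemma node_setsI : setI_closed node_sets.
Proof.
apply: rectanglesI; first exact: measurableI.
by apply: rectanglesI; exact: boxesI.
Qed.

Lemma node_setsT : node_sets setT.
Proof. by apply: rectanglesT => //; apply: rectanglesT; exact: boxesT. Qed.

Lemma measurable_forall (I : finType) (A : I -> set Omega) :
  (forall i, measurable (A i)) -> measurable [set w | forall i, A i w].
Proof.
move=> mA; have -> : [set w | forall i, A i w] = \bigcap_(i in setT) A i.
  by apply/seteqP; split => w hw i //=; exact: hw.
by apply: fin_bigcap_measurable.
Qed.

Lemma prior_law_le1 j s r (A : set (K * (G.-tuple K * n.-tuple K))) : measurable A ->
  (prior_law n_ h j s r A <= 1)%E.
Proof.
move=> mA; apply: probability_le1; rewrite -[X in measurable X]setTI.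
exact: measurable_prior_map.
Qed.

Lemma law_nodes_boxes (hc : config) (E : node J -> set (K * (G.-tuple K * n.-tuple K))) :
  (forall v, node_sets (E v)) ->
  P (hid hc `&` [set w | forall v, E v (node_rv v w)]) =
  ((prior_weight h hc)%:E * \prod_v node_law hc v (E v))%E.
Proof.
move=> hE.
have /choice[f hf] v : exists q : set K * (('I_G -> set K) * ('I_n -> set K)),
    [/\ measurable q.1, forall g, measurable (q.2.1 g), forall l, measurable (q.2.2 l) &
        E v = q.1 `*` (box q.2.1 `*` box q.2.2)].
  have [A mA [_ [_ [B mB ->] [_ [C mC ->] ->]] ->]] := hE v.
  by exists (A, (B, C)).
have mA v : measurable (f v).1 by have [] := hf v.
have mB v g : measurable ((f v).2.1 g) by have [] := hf v.
have mC v l : measurable ((f v).2.2 l) by have [] := hf v.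
have mC' v (o : obs) : measurable ((f v).2.2 (tagnat.rank o)) by [].
have := law_boxes hc mA mB mC'.
move=> e; apply: etrans (etrans _ e) _.
  congr (P _); apply/seteqP; split => w /=.
    move=> [hw H]; split; [split; [split=> // v|move=> v g]|move=> v o].
    - by have [_ _ _ Ev] := hf v; have := H v; rewrite Ev => -[].
    - by have [_ _ _ Ev] := hf v; have := H v; rewrite Ev => -[_ [/= + _]] => /(_ g); rewrite tnth_mktuple.
    - by have [_ _ _ Ev] := hf v; have := H v; rewrite Ev => -[_ [/= _ +]] => /(_ (tagnat.rank o)); rewrite tnth_mktuple tagnat.rankK.
  move=> [[[hw H1] H2] H3]; split => // v; have [_ _ _ ->] := hf v.
  split; first exact: H1; split => [g|l] /=; rewrite tnth_mktuple; first exact: H2.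
  by have := H3 v (tagnat.sig l); rewrite tagnat.sigK.
congr (_ * _)%E; apply: eq_bigr => v _; have [_ _ _ ->] := hf v.
etransitivity; last exact/esym/prior_law_box.
apply: eq_integral => x _; congr (_ * (_ * _))%E.
rewrite (reindex (@tagnat.sig G n_))/=; last by exists tagnat.rank => ? _; rewrite ?tagnat.sigK ?tagnat.rankK.
by apply: eq_bigr => l _; rewrite tagnat.sigK.
Qed.

(** From rectangles to arbitrary events, one node at a time by [measurable_families_eq]: with the
    other events fixed, each side is a measure of the event at the node i. *)
Lemma law_nodes (hc : config) (E : node J -> set (K * (G.-tuple K * n.-tuple K))) :
  (forall v, measurable (E v)) ->
  P (hid hc `&` [set w | forall v, E v (node_rv v w)]) =
  ((prior_weight h hc)%:E * \prod_v node_law hc v (E v))%E.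
Proof.
pose phi1 F := P (hid hc `&` [set w | forall v, F v (node_rv v w)]).
pose phi2 F := ((prior_weight h hc)%:E * \prod_v node_law hc v (F v))%E.
rewrite -[LHS]/(phi1 E) -[RHS]/(phi2 E); move: E.
apply: (measurable_families_eq node_setsE node_setsI node_setsT); last first.
  by move=> F; exact: law_nodes_boxes.
move=> E i mE.
pose D := hid hc `&` [set w | forall v, upd E i setT v (node_rv v w)].
have mD : measurable D.
  apply: measurableI; first exact: measurable_hid.
  apply: measurable_forall => v; rewrite -[X in measurable X]setTI; apply: measurable_node_rv => //.
  by rewrite /upd; case: ifP.
(* The prior weight and the masses of the other nodes, gathered into a real factor that scales the
   law of node i. *)
pose c := prior_weight h hc * \prod_(v | v != i) fine (node_law hc v (E v)).
have c0 : 0 <= c.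
  rewrite mulr_ge0 ?(prior_weight_ge0)//.
  by apply: prodr_ge0 => v _; rewrite fine_ge0.
exists (image_measure (mrestr P mD) (measurable_node_rv i)), (mscale (NngNum c0) (node_law hc i)).
split.
- apply: le_lt_trans (ltry 1).
  by apply: probability_le1; rewrite preimage_setT setTI.
- move=> A mA; congr (P _); apply/seteqP; split => w /=.
    move=> [Ai [hw H]]; split => // v; have := H v.
    by rewrite /upd; case: eqP => // ->.
  move=> [hw H]; split; first by have := H i; rewrite /upd eqxx.
  by split => // v; have := H v; rewrite /upd; case: eqP.
- move=> A mA; rewrite /phi2 (bigD1 i)//= {1}/upd eqxx.
  rewrite /mscale/= /c EFinM -prod_EFin -muleA; congr (_ * _)%E; rewrite muleC; congr (_ * _)%E.
  apply: eq_bigr => v vi; rewrite /upd (negbTE vi) fineK// ge0_fin_numE//.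
  by apply: le_lt_trans (ltry 1); exact: prior_law_le1.
Qed.

(** * Joint law of parameters and data *)

Definition coef_rv (v : node J) (w : Omega) : G.-tuple K := [tuple regr v g w | g < G].
Definition data_rv (v : node J) (w : Omega) : n.-tuple K := [tuple d v (tagnat.sig l) w | l < n].

Lemma measurable_coef_rv v : measurable_fun setT (coef_rv v).
Proof. by apply: measurable_mktuple => g; exact: measurable_regr. Qed.

Lemma measurable_data_rv v : measurable_fun setT (data_rv v).
Proof. by apply: measurable_mktuple. Qed.

Lemma add_effects_node_rv v w :
  add_effects (node_rv v w) = (sigma2 v w, (coef_rv v w, data_rv v w)).
Proof.
congr (_, (_, _)); apply: eq_from_tnth => l; rewrite !tnth_mktuple !mxE !tnth_mktuple hd.
congr (_ + _); pose g0 := Ordinal (ltnW hG).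
have g0E (g : 'I_G) : (g == 0%N :> nat) = (g == g0) by [].
rewrite (bigD1 g0)//= !mxE/= tnth_mktuple mul1r /regr/=; congr (_ + _).
(* An observation of the reference group meets no column of index g > 0, and its group effect
   vanishes by [hbeta1]; the index 0 is taken by [z]. *)
have [t0|t0] := eqVneq (tag (tagnat.sig l)) g0.
  rewrite hbeta1 ?t0// big1// => g gn0; rewrite !mxE tnth_mktuple g0E (negbTE gn0) mul1r.
  by rewrite /tagnat.sig1 t0 eq_sym (negbTE gn0) mul0r.
rewrite (bigD1 (tag (tagnat.sig l)))//= !mxE tnth_mktuple g0E (negbTE t0) mul1r eqxx mul1r.
rewrite big1 ?addr0// => g /andP[gn0 gt]; rewrite !mxE g0E (negbTE gn0) mul1r.
by rewrite eq_sym (negbTE gt) mul0r.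
Qed.

(** [law_nodes] for the preimages of the events under [add_effects], followed by [prior_law_data] at
    each node. *)
Lemma law_data_boxes (hc : config) (E : node J -> set (K * G.-tuple K)) (C : node J -> set (n.-tuple K)) :
  (forall v, measurable (E v)) -> (forall v, measurable (C v)) ->
  P (hid hc `&` [set w | forall v, C v (data_rv v w)] `&` [set w | forall v, E v (sigma2 v w, coef_rv v w)]) =
  ((prior_weight h hc)%:E * \prod_v \int[gauss K n]_y
     ((\1_(C v) y)%:E * ((dens hc v y)%:E * plaw hc v y (E v))))%E.
Proof.
move=> mE mC.
pose F v : set (K * (G.-tuple K * n.-tuple K)) := [set q | E v (q.1, q.2.1) /\ C v q.2.2].
have mF v : measurable (F v).
  apply: measurableI; rewrite -[X in measurable X]setTI.
    apply: (measurable_fun_pair measurable_fst _ measurableT (mE v)).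
    exact: (measurableT_comp measurable_fst measurable_snd).
  exact: (measurableT_comp measurable_snd measurable_snd measurableT (mC v)).
pose F' v := add_effects (n_ := n_) @^-1` F v.
have mF' v : measurable (F' v).
  rewrite -[X in measurable X]setTI; exact: measurable_add_effects.
have e := law_nodes hc mF'.
apply: etrans (etrans _ e) _.
  congr (P _); apply/seteqP; split => w /=; rewrite /F'/=.
    by move=> [[hw H1] H2]; split => // v; rewrite add_effects_node_rv.
  move=> [hw H]; split; first split => // v; last move=> v.
  - by have := H v; rewrite add_effects_node_rv => -[].
  - by have := H v; rewrite add_effects_node_rv => -[].
congr (_ * _)%E; apply: eq_bigr => v _.
transitivity (\int[node_law hc v]_q (\1_(F v) (add_effects q))%:E)%E.
  exact/esym/(integral_indicT (node_law hc v) (mF' v)).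
have m1 : measurable_fun setT (fun q => (\1_(F v) q)%:E : \bar K).
  by apply/measurable_EFinP; exact: measurable_indic.
etransitivity; first exact: (prior_law_data hnu hsigma02 htau hupsilon (lev v) (hc v).1 (hc v).2 m1 (fun q => _)).
apply: eq_integral => y _; rewrite [RHS]muleCA; apply: (congr1 (fun t => (dens hc v y)%:E * t)%E).
have FE x c : \1_(F v) (x, (c, y)) = \1_(E v) (x, c) * \1_(C v) y :> K.
  rewrite !indicE -natrM mulnb; congr (nat_of_bool _)%:R.
  by apply/idP/andP; rewrite !inE.
under eq_integral do under eq_integral do rewrite FE.
have [Cy|Cy] := boolP (y \in C v); rewrite !indicE ?Cy ?(negbTE Cy).
  rewrite mul1e; apply: eq_integral => x _; apply: eq_integral => c _.
  by rewrite mulr1.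
rewrite mul0e; apply: integral0_eq => x _; apply: integral0_eq => c _.
by rewrite mulr0.
Qed.

Definition all_data (w : Omega) : N.-tuple (n.-tuple K) := [tuple data_rv (enum_val i) w | i < N].
Definition datum (v : node J) (y : N.-tuple (n.-tuple K)) : n.-tuple K := tnth y (enum_rank v).

(** The density of the data on {hidden = hc} relative to [data_base]; see [law_hid_data]. *)
Definition post_weight (hc : config) (y : N.-tuple (n.-tuple K)) : K :=
  prior_weight h hc * \prod_v dens hc v (datum v y).

Definition data_base := ipow (gauss K n) N.

Lemma measurable_all_data : measurable_fun setT all_data.
Proof. by apply: measurable_mktuple => i; exact: measurable_data_rv. Qed.

Lemma measurable_datum v : measurable_fun setT (datum v).
Proof. exact: measurable_tnth. Qed.

Lemma datum_all_data v w : datum v (all_data w) = data_rv v w.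
Proof. by rewrite /datum tnth_mktuple enum_rankK. Qed.

Lemma measurable_post_weight hc : measurable_fun setT (post_weight hc).
Proof.
apply: measurable_funM => //; apply: measurable_prod => v _.
exact: (measurableT_comp (measurable_node_dens htau hupsilon _ _ _) (measurable_datum v)).
Qed.

Lemma post_weight_ge0 hc y : 0 <= post_weight hc y.
Proof.
rewrite mulr_ge0 ?(prior_weight_ge0)//; apply: prodr_ge0 => v _; apply: ltW.
exact: node_dens_gt0.
Qed.

(** On boxes of data the integral factors over the nodes and [law_data_boxes] applies; the pi-system
    argument extends the identity to data events that couple the nodes. *)
Lemma law_posterior (hc : config) (E : node J -> set (K * G.-tuple K)) (C : set (N.-tuple (n.-tuple K))) :
  (forall v, measurable (E v)) -> measurable C ->
  P (hid hc `&` all_data @^-1` C `&` [set w | forall v, E v (sigma2 v w, coef_rv v w)]) =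
  (\int[data_base]_(y in C) (post_weight hc y * \prod_v fine (plaw hc v (datum v y) (E v)))%:E)%E.
Proof.
move=> mE mC.
set A := [set w | forall v, E v (sigma2 v w, coef_rv v w)].
have mA : measurable A.
  apply: measurable_forall => v; rewrite -[X in measurable X]setTI.
  by apply: measurable_fun_pair => //; exact: measurable_coef_rv.
have mhA : measurable (hid hc `&` A) by apply: measurableI => //; exact: measurable_hid.
have mall := measurable_all_data.
have mw1 : measurable_fun setT (\1_(hid hc `&` A) : Omega -> K) by exact: measurable_indic.
pose w2 y := post_weight hc y * \prod_v fine (plaw hc v (datum v y) (E v)).
have mw2 : measurable_fun setT w2.
  apply: measurable_funM; first exact: measurable_post_weight.
  apply: measurable_prod => v _; apply: (measurableT_comp (f := fine)) => //.
  exact: (measurableT_comp (measurable_post_law hnu hsigma02 htau hupsilon _ _ _ (mE v)) (measurable_datum v)).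
have w20 y : 0 <= w2 y.
  rewrite mulr_ge0 ?post_weight_ge0//; apply: prodr_ge0 => v _.
  by rewrite fine_ge0// post_law_ge0.
have total : (\int[P]_w (\1_(hid hc `&` A) w)%:E < +oo)%E.
  by rewrite integral_indicT// (le_lt_trans (probability_le1 _ mhA))// ltry.
have w10 w : 0 <= \1_(hid hc `&` A) w :> K by [].
have H := measure_pi_system (m1 := P) (m2 := data_base) mall (@measurable_id _ (N.-tuple (n.-tuple K)) setT)
  mw1 mw2 w10 w20 (@boxesE _ _ N) (@boxesI _ _ N) (@boxesT _ _ N) total.
have -> : hid hc `&` all_data @^-1` C `&` A = hid hc `&` A `&` all_data @^-1` C by rewrite setIAC.
transitivity (\int[P]_(w in all_data @^-1` C) (\1_(hid hc `&` A) w)%:E)%E.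
  by rewrite integral_indic// -[X in measurable X]setTI; exact: mall.
apply: (H _ C mC) => _ [B mB ->].
pose F v (y : n.-tuple K) : \bar K :=
  ((\1_(B (enum_rank v)) y)%:E * ((dens hc v y)%:E * plaw hc v y (E v)))%E.
have mF v : measurable_fun setT (F v).
  apply: emeasurable_funM; first by apply/measurable_EFinP; exact: measurable_indic.
  apply: emeasurable_funM; last exact: measurable_post_law.
  apply/measurable_EFinP; exact: measurable_node_dens.
have F0 v y : (0 <= F v y)%E.
  rewrite !mule_ge0 ?lee_fin//; last exact: post_law_ge0.
  by rewrite ltW// node_dens_gt0.
transitivity ((prior_weight h hc)%:E * \prod_v \int[gauss K n]_y F v y)%E.
  have mB' v : measurable (B (enum_rank v)) by [].
  have mpre : measurable (all_data @^-1` box B).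
    by rewrite -[X in measurable X]setTI; apply: mall => //; exact: measurable_box.
  rewrite integral_indic//.
  apply: etrans (law_data_boxes hc mE mB'); congr (P _); rewrite setIAC; congr (_ `&` _ `&` _).
  apply/seteqP; split => w /= H' v.
    by have := H' (enum_rank v); rewrite tnth_mktuple enum_rankK.
  by have := H' (enum_val v); rewrite tnth_mktuple enum_valK.
rewrite preimage_id -integral_indicM; last exact: measurable_box.
rewrite -(prod_enum_val (fun v => \int[gauss K n]_y F v y)%E).
have := @integral_ipow_prod _ _ _ (gauss K n) N (fun i => F (enum_val i)) (fun i => mF _) (fun i => F0 _).
move=> <-; rewrite -ge0_integralZl//; last 3 first.
- apply: emeasurable_prod => i; exact: measurableT_comp (mF _) (measurable_tnth i).
- by move=> y _; exact: prode_ge0'.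
- by rewrite lee_fin (prior_weight_ge0).
apply: eq_integral => y _.
rewrite [in RHS](@indic_forall K _ _ _ B (fun i y => tnth y i) y).
rewrite /w2 /post_weight -mulrA -big_split/= [X in _ = (_ * X)%E]EFinM [RHS]muleCA; congr (_ * _)%E.
rewrite -prod_EFin -(prod_enum_val (fun v => (dens hc v (datum v y) * fine (plaw hc v (datum v y) (E v)))%:E)) -big_split/=.
apply: eq_bigr => i _; rewrite /F /datum enum_valK [in RHS]EFinM.
by rewrite (post_law_fineK htau hupsilon).
Qed.

Lemma post_law_setT j s r y : post_law (n_ := n_) htau hupsilon j s r y setT = 1%E.
Proof.
rewrite /post_law; transitivity (\int[post_igp h j s r y]_x (\1_setT x)%:E : \bar K)%E.
  apply: eq_integral => x _; rewrite /coef_int indicE in_setT.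
  transitivity (\int[gauss K G]_e (\1_setT e)%:E : \bar K)%E.
    by apply: eq_integral => e _; rewrite !indicE !in_setT.
  exact: etrans (integral_indicT _ measurableT) (probability_setT (gauss K G)).
exact: etrans (integral_indicT _ measurableT) (probability_setT _).
Qed.

Lemma law_hid_data (hc : config) (C : set (N.-tuple (n.-tuple K))) : measurable C ->
  P (hid hc `&` all_data @^-1` C) = (\int[data_base]_(y in C) (post_weight hc y)%:E)%E.
Proof.
move=> mC; have e := law_posterior hc (fun v => measurableT) mC.
apply: etrans (etrans _ e) _.
  by congr (P _); apply/seteqP; split => w /=; [move=> H; split|case].
apply: eq_integral => y _; rewrite big1 ?mulr1// => v _.
by rewrite (post_law_setT (lev v) (hc v).1 (hc v).2).
Qed.

Lemma integral_hid_data (hc : config) (g : N.-tuple (n.-tuple K) -> \bar K) :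
  measurable_fun setT g -> (forall y, 0 <= g y)%E ->
  (\int[P]_(w in hid hc) g (all_data w) = \int[data_base]_y (g y * (post_weight hc y)%:E))%E.
Proof.
move=> mg g0.
have mw1 : measurable_fun setT (\1_(hid hc) : Omega -> K).
  by apply: measurable_indic; exact: measurable_hid.
have w10 w : 0 <= \1_(hid hc) w :> K by [].
have H (B : set (N.-tuple (n.-tuple K))) : measurable B ->
    (\int[P]_(w in all_data @^-1` B) (\1_(hid hc) w)%:E =
     \int[data_base]_(y in id @^-1` B) (post_weight hc y)%:E)%E.
  move=> mB; rewrite preimage_id -law_hid_data// integral_indic//; last exact: measurable_hid.
  by rewrite -[X in measurable X]setTI; exact: measurable_all_data.
rewrite -(integral_transfer measurable_all_data (@measurable_id _ _ setT) mw1
  (measurable_post_weight hc) w10 (post_weight_ge0 hc) H mg g0).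
by rewrite integral_mul_indic setTI.
Qed.

Lemma measurable_nodes (E : node J -> set (K * G.-tuple K)) : (forall v, measurable (E v)) ->
  measurable [set w | forall v, E v (sigma2 v w, coef_rv v w)].
Proof.
move=> mE; apply: measurable_forall => v; rewrite -[X in measurable X]setTI.
by apply: measurable_fun_pair => //; exact: measurable_coef_rv.
Qed.

(** The density in [law_posterior] is [post_weight] times the posterior laws, and [post_weight] is
    itself the density of the data on {hidden = hc}; so the integral is that of the posterior laws
    under P. *)
Lemma cond_nodes (hc : config) (E : node J -> set (K * G.-tuple K)) (C : set (N.-tuple (n.-tuple K))) :
  (forall v, measurable (E v)) -> measurable C ->
  P (hid hc `&` all_data @^-1` C `&` [set w | forall v, E v (sigma2 v w, coef_rv v w)]) =
  (\int[P]_(w in hid hc `&` all_data @^-1` C) \prod_v plaw hc v (data_rv v w) (E v))%E.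
Proof.
move=> mE mC; rewrite law_posterior//.
pose g y := ((\1_C y)%:E * \prod_v plaw hc v (datum v y) (E v))%E.
have mg : measurable_fun setT g.
  apply: emeasurable_funM; first by apply/measurable_EFinP; exact: measurable_indic.
  apply: emeasurable_prod => v.
  exact: (measurableT_comp (measurable_post_law hnu hsigma02 htau hupsilon _ _ _ (mE v)) (measurable_datum v)).
have g0 y : (0 <= g y)%E.
  by rewrite mule_ge0 ?lee_fin//; apply: prode_ge0' => v; exact: post_law_ge0.
transitivity (\int[P]_(w in hid hc) g (all_data w))%E; last first.
  rewrite -[RHS]integral_mul_indic; apply: eq_integral => w _; rewrite /g [RHS]muleC.
  apply: (congr1 (fun t => (\1_C (all_data w))%:E * t)%E).
  by apply: eq_bigr => v _; rewrite datum_all_data.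
rewrite integral_hid_data// -integral_indicM//; apply: eq_integral => y _.
rewrite /g -muleA; congr (_ * _)%E; rewrite EFinM muleC; congr (_ * _)%E.
by rewrite -prod_EFin; apply: eq_bigr => v _; rewrite (post_law_fineK htau hupsilon).
Qed.

(** The density on {hidden = hc} of the variance at v together with all data, relative to
    [joint_base]. At v the density of the data is replaced by [sigma_weight], from which the
    variance has not been integrated out. *)
Definition joint_weight (hc : config) (v : node J) (p : K * Y) : K :=
  prior_weight h hc * \prod_(x | x != v) dens hc x (datum x p.2) *
  sigma_weight (n_ := n_) htau hupsilon (lev v) (hc v).1 (hc v).2 (p.1, datum v p.2).

Lemma joint_weight_ge0 hc v p : 0 <= joint_weight hc v p.
Proof.
rewrite mulr_ge0//; last exact: sigma_weight_ge0.
rewrite mulr_ge0 ?(prior_weight_ge0)//.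
by apply: prodr_ge0 => x _; apply: ltW; exact: node_dens_gt0.
Qed.

Lemma measurable_sigma_datum v : measurable_fun setT (fun p : K * Y => (p.1, datum v p.2)).
Proof.
apply: measurable_fun_pair => //; exact: (measurableT_comp (measurable_datum v) measurable_snd).
Qed.

Lemma measurable_joint_weight (hc : config) (v : node J) : measurable_fun setT (joint_weight hc v).
Proof.
apply: measurable_funM.
  apply: measurable_funM => //; rewrite (_ : (fun p : K * Y => _) =
      (fun p => \prod_x if x != v then dens hc x (datum x p.2) else 1)); last first.
    by apply/funext => p; rewrite big_mkcond.
  apply: measurable_prod => x _; case: (x != v) => //.
  apply: (measurableT_comp (measurable_node_dens htau hupsilon _ _ _)).
  exact: (measurableT_comp (measurable_datum x) measurable_snd).
exact: (measurableT_comp (measurable_sigma_weight htau hupsilon _ _ _) (measurable_sigma_datum v)).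
Qed.

Definition sigma_data (v : node J) (w : Omega) : K * Y := (sigma2 v w, all_data w).

Lemma measurable_sigma_data v : measurable_fun setT (sigma_data v).
Proof. by apply: measurable_fun_pair => //; exact: measurable_all_data. Qed.

Definition joint_base : probability (K * Y)%type K := (igp shape rate \x data_base)%E.

Lemma coef_int_setX (hc : config) (v : node J) (A : set K) (B : set (G.-tuple K)) p : measurable B ->
  coef_int (n_ := n_) htau hupsilon (lev v) (hc v).1 (hc v).2 (A `*` B) p =
  ((\1_A p.1)%:E * claw hc v p.1 p.2 B)%E.
Proof.
move=> mB; rewrite coef_lawE// /coef_int -ge0_integralZl//.
- by apply: eq_integral => e _; rewrite indic_setX.
- apply/measurable_EFinP; apply: measurableT_comp; first exact: measurable_indic.
  exact: measurable_coef_of_inner.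
Qed.

Lemma measurable_claw (hc : config) (v : node J) (B : set (G.-tuple K)) : measurable B ->
  measurable_fun setT (fun p : K * n.-tuple K => claw hc v p.1 p.2 B).
Proof.
move=> mB; rewrite (_ : (fun p => _) =
    coef_int (n_ := n_) htau hupsilon (lev v) (hc v).1 (hc v).2 (setT `*` B)).
  by apply: measurable_coef_int; exact: measurableX.
by apply/funext => p; rewrite coef_int_setX// indicE in_setT mul1e.
Qed.

(** On a rectangle, [law_posterior] with a constraint at v only gives the value, and
    [node_posterior] rewrites the posterior of the variance as a density relative to its prior. *)
Lemma law_sigma_data (hc : config) (v : node J) (B : set (G.-tuple K)) (C : set (K * Y)) :
  measurable B -> measurable C ->
  P (hid hc `&` sigma_data v @^-1` C `&` coef_rv v @^-1` B) =
  (\int[joint_base]_(p in C) (fine (claw hc v p.1 (datum v p.2) B) * joint_weight hc v p)%:E)%E.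
Proof.
move=> mB mC.
have mcB : measurable (coef_rv v @^-1` B).
  by rewrite -[X in measurable X]setTI; exact: measurable_coef_rv.
have mhB : measurable (hid hc `&` coef_rv v @^-1` B).
  by apply: measurableI => //; exact: measurable_hid.
have mw1 : measurable_fun setT (\1_(hid hc `&` coef_rv v @^-1` B) : Omega -> K).
  exact: measurable_indic.
have w10 w : 0 <= \1_(hid hc `&` coef_rv v @^-1` B) w :> K by [].
pose w2 p := fine (claw hc v p.1 (datum v p.2) B) * joint_weight hc v p.
have mw2 : measurable_fun setT w2.
  apply: measurable_funM; last exact: measurable_joint_weight.
  apply: (measurableT_comp (f := fine)) => //.
  exact: (measurableT_comp (measurable_claw hc v mB) (measurable_sigma_datum v)).
have w20 p : 0 <= w2 p by rewrite mulr_ge0 ?joint_weight_ge0// fine_ge0.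
have total : (\int[P]_w (\1_(hid hc `&` coef_rv v @^-1` B) w)%:E < +oo)%E.
  by rewrite integral_indicT// (le_lt_trans (probability_le1 _ mhB))// ltry.
pose rect : set (set (K * Y)) := rectangles measurable measurable.
have rectE : measurable = <<s rect >>.
  by apply: rectanglesE => //; exact: sigma_measurableE.
have rectI : setI_closed rect by apply: rectanglesI; exact: measurableI.
have rectT : rect setT by exact: rectanglesT.
have H := measure_pi_system (m1 := P) (m2 := joint_base) (measurable_sigma_data v)
  (@measurable_id _ (K * Y)%type setT) mw1 mw2 w10 w20 rectE rectI rectT total.
transitivity (\int[P]_(w in sigma_data v @^-1` C) (\1_(hid hc `&` coef_rv v @^-1` B) w)%:E)%E.
  rewrite integral_indic//; first by rewrite setIAC.
  by rewrite -[X in measurable X]setTI; exact: measurable_sigma_data.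
apply: (H _ C mC) => _ [A mA [C' mC' ->]].
rewrite integral_indic//; last first.
  rewrite -[X in measurable X]setTI; apply: measurable_sigma_data => //; exact: measurableX.
pose E x := if x == v then A `*` B else setT.
have mE x : measurable (E x) by rewrite /E; case: ifP => // _; exact: measurableX.
have e := law_posterior hc mE mC'.
apply: etrans (etrans _ e) _.
  congr (P _); apply/seteqP; split => w /=.
    move=> [[hw cB] [sA dC]]; split => // x; rewrite /E; by case: eqP => // ->.
  move=> [[hw dC] HE]; have := HE v; rewrite /E eqxx => -[/= sA cB].
  by split.
have mAC : measurable (A `*` C') by exact: measurableX.
pose f p := ((\1_(A `*` C') p)%:E * (w2 p)%:E)%E.
have mf : measurable_fun setT f.
  apply: emeasurable_funM; last exact/measurable_EFinP.
  by apply/measurable_EFinP; exact: measurable_indic.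
have f0 p : (0 <= f p)%E by rewrite mule_ge0 ?lee_fin.
transitivity (\int[joint_base]_p f p)%E; last by rewrite preimage_id -integral_indicM.
apply: etrans; last first.
  exact/esym/(fubini_tonelli2 (m1 := igp shape rate) (m2 := data_base) f mf f0).
rewrite -integral_indicM//; apply: eq_integral => y _; rewrite /fubini_G.
pose c := prior_weight h hc * \prod_(x | x != v) dens hc x (datum x y).
have c0 : 0 <= c.
  rewrite mulr_ge0 ?(prior_weight_ge0)//.
  by apply: prodr_ge0 => x _; apply: ltW; exact: node_dens_gt0.
have mAB : measurable (A `*` B) by exact: measurableX.
pose ci x := coef_int (n_ := n_) htau hupsilon (lev v) (hc v).1 (hc v).2 (A `*` B) (x, datum v y).
pose sw x := sigma_weight (n_ := n_) htau hupsilon (lev v) (hc v).1 (hc v).2 (x, datum v y).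
have mci : measurable_fun setT ci.
  exact: (measurableT_comp (measurable_coef_int htau hupsilon _ _ _ mAB)).
have ci0 x : (0 <= ci x)%E by exact: coef_int_ge0.
have msw : measurable_fun setT sw.
  exact: (measurableT_comp (measurable_sigma_weight htau hupsilon _ _ _)).
have sw0 x : 0 <= sw x by exact: sigma_weight_ge0.
transitivity (\int[igp shape rate]_x ((\1_C' y * c)%:E * (ci x * (sw x)%:E)))%E; last first.
  apply: eq_integral => x _; rewrite /f indic_setX/= /w2 /joint_weight /ci coef_int_setX//.
  rewrite -(fineK (x := claw hc v x (datum v y) B)) ?fin_num_measure//.
  by rewrite -/c -!EFinM; congr EFin; rewrite /sw /=; ring.
rewrite ge0_integralZl//; last 3 first.
- by apply: emeasurable_funM => //; exact/measurable_EFinP.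
- by move=> x _; rewrite mule_ge0// lee_fin.
- by rewrite lee_fin mulr_ge0.
rewrite -[X in _ = (_ * X)%E](node_posterior hnu hsigma02 htau hupsilon (lev v) (hc v).1 (hc v).2 (datum v y) mci ci0).
rewrite -[X in (_ = _ * (_ * X))%E](post_law_fineK htau hupsilon (lev v) (hc v).1 (hc v).2 (datum v y) mAB).
rewrite -!EFinM; congr EFin; rewrite /post_weight (bigD1 v)//= [X in _ * (_ * X) = _](bigD1 v)//=.
rewrite [X in _ * (_ * (_ * X)) = _]big1; last first.
  by move=> x xv; rewrite /E (negbTE xv) (post_law_setT (lev x) (hc x).1 (hc x).2).
by rewrite /E eqxx /c; ring.
Qed.

Lemma integral_hid_sigma (hc : config) (v : node J) (g : K * Y -> \bar K) :
  measurable_fun setT g -> (forall y, 0 <= g y)%E ->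
  (\int[P]_(w in hid hc) g (sigma_data v w) = \int[joint_base]_p (g p * (joint_weight hc v p)%:E))%E.
Proof.
move=> mg g0.
have mw1 : measurable_fun setT (\1_(hid hc) : Omega -> K).
  by apply: measurable_indic; exact: measurable_hid.
have w10 w : 0 <= \1_(hid hc) w :> K by [].
have H (B : set (K * Y)) : measurable B ->
    (\int[P]_(w in sigma_data v @^-1` B) (\1_(hid hc) w)%:E =
     \int[joint_base]_(y in id @^-1` B) (joint_weight hc v y)%:E)%E.
  move=> mB; rewrite preimage_id integral_indic//; last 2 first.
  - by rewrite -[X in measurable X]setTI; exact: measurable_sigma_data.
  - exact: measurable_hid.
  have e := law_sigma_data hc v measurableT mB.
  apply: etrans (etrans _ e) _.
    by rewrite preimage_setT setIT.
  apply: eq_integral => p _; rewrite (probability_setT (claw hc v p.1 (datum v p.2)))/=.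
  by rewrite mul1r.
rewrite -(integral_transfer (measurable_sigma_data v) (@measurable_id _ _ setT) mw1
  (measurable_joint_weight hc v) w10 (joint_weight_ge0 hc v) H mg g0).
by rewrite integral_mul_indic setTI.
Qed.

Lemma cond_coef (hc : config) (v : node J) (B : set (G.-tuple K)) (C : set (K * Y)) :
  measurable B -> measurable C ->
  P (hid hc `&` sigma_data v @^-1` C `&` coef_rv v @^-1` B) =
  (\int[P]_(w in hid hc `&` sigma_data v @^-1` C) claw hc v (sigma2 v w) (data_rv v w) B)%E.
Proof.
move=> mB mC; rewrite law_sigma_data//.
pose g p := ((\1_C p)%:E * claw hc v p.1 (datum v p.2) B)%E.
have mg : measurable_fun setT g.
  apply: emeasurable_funM; first by apply/measurable_EFinP; exact: measurable_indic.
  exact: (measurableT_comp (measurable_claw hc v mB) (measurable_sigma_datum v)).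
have g0 y : (0 <= g y)%E by rewrite mule_ge0 ?lee_fin.
transitivity (\int[P]_(w in hid hc) g (sigma_data v w))%E; last first.
  rewrite -[RHS]integral_mul_indic; apply: eq_integral => w _; rewrite /g [RHS]muleC.
  by rewrite /= datum_all_data.
rewrite integral_hid_sigma// -integral_indicM//; apply: eq_integral => p _.
rewrite /g -muleA; congr (_ * _)%E; rewrite EFinM; congr (_ * _)%E.
by rewrite fineK// fin_num_measure.
Qed.

(** * Posterior of the hidden states *)

Definition cols (y : Y) (v : node J) : 'cV[K]_n := colt (datum v y).

Lemma cols_all_data w : cols (all_data w) = (fun v => dvec (fun o => d v o w)).
Proof.
apply/funext => v; apply/colP => l; rewrite /cols datum_all_data !mxE tnth_mktuple //.
Qed.

Lemma measurable_gauss_pdf : measurable_fun setT (@gauss_pdf K G n_).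
Proof.
apply: measurable_funM => //; apply: measurableT_comp => //; apply: measurableT_comp => //.
by apply: measurable_funM => //; apply: measurable_sqn; exact: mx_measurable_colt.
Qed.

Lemma measurable_marg_lik v s r : measurable_fun setT (fun y => marg_lik h (lev v) (cols y v) s r).
Proof.
rewrite (_ : (fun y => _) = (fun y => node_dens htau hupsilon (lev v) s r (datum v y) * gauss_pdf (datum v y))).
  apply: measurable_funM; first exact: (measurableT_comp (measurable_node_dens htau hupsilon _ _ _) (measurable_datum v)).
  exact: (measurableT_comp measurable_gauss_pdf (measurable_datum v)).
by apply/funext => y; exact: (marg_likE hnu hsigma02 htau hupsilon).
Qed.

Lemma measurable_phi v s r : measurable_fun setT (fun y => phi h (cols y) v s r).
Proof.
apply: (@measurable_phi_rec K J h _ Y (fun y v s r => marg_lik h (lev v) (cols y v) s r)) => *.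
exact: measurable_marg_lik.
Qed.

Lemma measurable_xi v s r : measurable_fun setT (fun y => xi h (cols y) v s r).
Proof. by apply: (@measurable_xi_step K J h _ Y (fun y => phi h (cols y))) => *; exact: measurable_phi. Qed.

Lemma measurable_post_init e : measurable_fun setT (fun y => post_init h (cols y) e).
Proof.
apply: measurable_funM => //; apply: measurable_funM; first exact: measurable_phi.
by apply: (measurableT_comp (@measurable_inv K)); exact: measurable_xi.
Qed.

Lemma measurable_post_trans v e e' : measurable_fun setT (fun y => post_trans h (cols y) v e e').
Proof.
apply: measurable_funM => //; apply: measurable_funM; first exact: measurable_phi.
by apply: (measurableT_comp (@measurable_inv K)); exact: measurable_xi.
Qed.

Let prho0 : prob_vector (rho0 h). Proof. by case: hS. Qed.
Let pkappa0 : prob_vector (kappa0 h). Proof. by case: hR. Qed.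
Let prho v : (0 < lev v)%N -> forall e, prob_vector (rho h v e).
Proof. by case: hS => _ + _; exact. Qed.
Let pkappa v : (0 < lev v)%N -> forall e, prob_vector (kappa h v e).
Proof. by case: hR => _ + _; exact. Qed.
Let mpos y v s r : 0 < marg_lik h (lev v) (cols y v) s r.
Proof. exact: marg_lik_gt0. Qed.

Lemma post_init_prob y : prob_vector (post_init h (cols y)).
Proof. exact: (post_init_pv prho0 pkappa0 prho pkappa (mpos y)). Qed.

Lemma post_trans_prob y v e : (0 < lev v)%N -> prob_vector (post_trans h (cols y) v e).
Proof. exact: (post_trans_pv prho0 pkappa0 prho pkappa (mpos y)). Qed.

Local Notation chain y := (chain_weight (post_init h (cols y)) (post_trans h (cols y))).

(** The marginal density of the data relative to [data_base]: [xi] at the root, whose state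
    arguments are dummies, is their density relative to Lebesgue measure, and the product changes
    the reference measure. *)
Definition chain_scale (y : Y) : K :=
  xi h (cols y) tree_root false false / \prod_(v : node J) gauss_pdf (datum v y).

Lemma post_weight_chain (hc : config) y :
  post_weight hc y = chain_scale y * chain y hc.
Proof.
rewrite /chain_weight (post_weightE prho0 pkappa0 prho pkappa (mpos y)).
rewrite /post_weight /chain_scale.
under [X in _ = _ * (_ * X / _)]eq_bigr do rewrite (marg_likE hnu hsigma02 htau hupsilon).
rewrite [X in _ = _ * (_ * X / _)]big_split/=.
field; apply/andP; split.
  by rewrite gt_eqF// (xi_gt0 prho0 pkappa0 prho pkappa (mpos y)).
by rewrite gt_eqF// prodr_gt0// => v _; exact: gauss_pdf_gt0.
Qed.

(** The hypothesis on [f] is that of [bayes] divided by the factor [chain_scale y] common to all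
    configurations, so it speaks only of the Markov tree with the announced transitions.
    Conditioning on states in addition to the data is expressed by [pi]. *)
Lemma cond_hidden (Q : pred config) (Pi : finType) (pi : config -> Pi) (f : config -> Y -> K) :
  (forall hc, measurable_fun setT (f hc)) -> (forall hc y, 0 <= f hc y) ->
  (forall p y, \sum_(hc | pi hc == p) f hc y * chain y hc =
               \sum_(hc | pi hc == p) (Q hc)%:R * chain y hc) ->
  forall C, structured (pi \o hidden) all_data C ->
  P (C `&` [set w | Q (hidden w)]) =
  (\int[P]_(w in C) (f (hidden w) (all_data w))%:E)%E.
Proof.
move=> mf f0 hf _ [D mD ->].
have mQ : measurable [set w | Q (hidden w)].
  rewrite (_ : [set w | _] = \bigcup_(hc in setT) (if Q hc then hid hc else set0)).
    apply: fin_bigcup_measurable => [|hc _]; first exact: finite_finset.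
    by case: ifP => // _; exact: measurable_hid.
  apply/seteqP; split => [w /= Qw|w [hc _]]; first by exists (hidden w) => //; rewrite Qw.
  by case: ifP => // Qh /= ->.
have law_w hc B : measurable B -> P (hid hc `&` all_data @^-1` B) =
    (\int[data_base]_(y in B) (post_weight hc y)%:E)%E.
  by move=> mB; exact: (law_hid_data).
apply: (@bayes _ Omega K P _ Y data_base _ (hidden) all_data (measurable_hid)
   (measurable_all_data) [set w | Q (hidden w)] (fun hc y => post_weight hc y)
   (fun hc y => (Q hc)%:R * post_weight hc y) f Pi pi D) => //.
- by move=> hc; exact: measurable_post_weight.
- by move=> hc y; exact: (post_weight_ge0).
- by move=> hc; apply: measurable_funM => //; exact: measurable_post_weight.
- by move=> hc y; rewrite mulr_ge0// (post_weight_ge0).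
- move=> hc B mB; case Qh: (Q hc).
    under eq_integral do rewrite mul1r.
    rewrite -law_w//; congr (P _); apply/seteqP; split => w /=; first by case.
    by move=> [hw Bw]; split => //; rewrite hw.
  rewrite integral0_eq => [|y _]; last by rewrite mul0r.
  rewrite (_ : _ `&` _ = set0) ?measure0//; apply/seteqP; split => w //= -[[hw _]].
  by rewrite hw Qh.
- move=> p y; have := hf p y; move/(congr1 (fun t => chain_scale y * t)).
  rewrite !mulr_sumr => e; apply: etrans (etrans _ e) _; apply: eq_bigr => hc _.
    by rewrite post_weight_chain mulrCA.
  by rewrite post_weight_chain mulrCA.
Qed.

(** The map [g] recovers the data from the conditioning variable, which is either the data or the
    pair [sigma_data v]. *)
Lemma evD_structured Pi (pi : Omega -> Pi) d' (U : measurableType d') (f : Omega -> U) (g : U -> Y) :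
  measurable_fun setT g -> (forall w, g (f w) = all_data w) ->
  evD `<=` structured pi f.
Proof.
move=> mg gE _ [[v o] _ [B mB <-]]; rewrite setTI.
rewrite (_ : _ @^-1` _ = f @^-1` ((fun y => tnth (datum v (g y)) (tagnat.rank o)) @^-1` B)).
  apply: structured_Z; rewrite -[X in measurable X]setTI.
  apply: (measurableT_comp (measurableT_comp (measurable_tnth _) (measurable_datum v)) mg) => //.
apply/seteqP; split => w /=; rewrite gE datum_all_data tnth_mktuple tagnat.rankK //.
Qed.

Lemma evH_structured d' (U : measurableType d') (f : Omega -> U) : evH `<=` structured (hidden) f.
Proof.
rewrite subUset; split => _ [v _ [B mB <-]]; rewrite setTI.
- rewrite (_ : _ @^-1` _ = hidden @^-1` [set c : config | B (c v).1]); first exact: structured_pi.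
  by apply/seteqP; split => w /=; rewrite ffunE.
- rewrite (_ : _ @^-1` _ = hidden @^-1` [set c : config | B (c v).2]); first exact: structured_pi.
  by apply/seteqP; split => w /=; rewrite ffunE.
Qed.

Lemma evHv_structured v d' (U : measurableType d') (f : Omega -> U) :
  evHv v `<=` structured ((fun c : config => c v) \o hidden) f.
Proof.
rewrite subUset; split => _ [B mB <-]; rewrite setTI.
- rewrite (_ : _ @^-1` _ = ((fun c : config => c v) \o hidden) @^-1` [set c | B c.1]); first exact: structured_pi.
  by apply/seteqP; split => w /=; rewrite ffunE.
- rewrite (_ : _ @^-1` _ = ((fun c : config => c v) \o hidden) @^-1` [set c | B c.2]); first exact: structured_pi.
  by apply/seteqP; split => w /=; rewrite ffunE.
Qed.

Lemma evD_measurable : evD `<=` measurable.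
Proof. by move=> _ [[v o] _ [B mB <-]]; exact: measurable_funP. Qed.

Lemma evH_measurable : evH `<=` measurable.
Proof. by rewrite subUset; split; exact: events_fam_measurable. Qed.

Lemma evHv_sub v : evHv v `<=` evH.
Proof. by rewrite subUset; split => E [B mB <-]; [left|right]; exists v => //; exists B. Qed.

Lemma smeasurable_all_data (Gen : set (set Omega)) : evD `<=` Gen ->
  smeasurable <<s Gen >> all_data.
Proof.
move=> DG; apply/smeasurableP; apply: measurable_mktuple => i; apply: measurable_mktuple => l.
apply/smeasurableP.
exact: (@sigma_events Gen _ _ _ (fun vo : node J * obs => d vo.1 vo.2 : Omega -> K) DG (enum_val i, tagnat.sig l)).
Qed.

Lemma sigma_hidden_at (Gen : set (set Omega)) v p : evHv v `<=` Gen ->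
  <<s Gen >> [set w | hidden w v = p].
Proof.
move=> HG; rewrite (_ : [set w | _] = S v @^-1` [set p.1] `&` R v @^-1` [set p.2]).
  apply: sigmaI; apply: sub_sigma_algebra; apply: HG.
  - by left; exists [set p.1] => //; rewrite setTI.
  - by right; exists [set p.2] => //; rewrite setTI.
by apply/seteqP; split => w /=; rewrite ffunE; [move=> <-|move=> [-> ->]; case: p].
Qed.

Lemma measurable_chain (c : config) : measurable_fun setT (fun y : Y => chain y c).
Proof.
apply: measurable_funM; first exact: measurable_post_init.
rewrite (_ : (fun y : Y => _) = (fun y => \prod_v if (0 < lev v)%N then
    post_trans h (cols y) v (c (parent v)) (c v) else 1)); last first.
  by apply/funext => y; rewrite big_mkcond.
by apply: measurable_prod => v _; case: (0 < lev v)%N => //; exact: measurable_post_trans.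
Qed.

Let init_pv y := post_init_prob y.
Let trans_pv y v (v0 : (0 < lev v)%N) e :=
  post_trans_prob y e v0.

Let evD_str Pi (pi : Omega -> Pi) : evD `<=` structured pi all_data.
Proof. exact: (@evD_structured Pi pi _ Y all_data id). Qed.

Let bayes_rule := cond_hidden.

Lemma posterior_tree :
  exists p : Omega -> (node J -> bool * bool) -> \bar K,
    (forall w, markov_tree (p w) (post_init h (cols (all_data w))) (post_trans h (cols (all_data w)))) /\
    (forall x : node J -> bool * bool,
       cond_prob P <<s evD >> [set w | forall v, (S v w, R v w) = x v] (fun w => p w x)).
Proof.
exists (fun w x => (post_init h (cols (all_data w)) (x tree_root) *
   \prod_(v : node J | (0 < lev v)%N) post_trans h (cols (all_data w)) v (x (parent v)) (x v))%:E).
split=> [w|x]; first by split => // v v0 e; exact: trans_pv.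
pose xf : config := [ffun v => x v].
have xE y : (post_init h (cols y) (x tree_root) *
    \prod_(v : node J | (0 < lev v)%N) post_trans h (cols y) v (x (parent v)) (x v)) = chain y xf.
  by rewrite /chain_weight ffunE; congr (_ * _); apply: eq_bigr => v _; rewrite !ffunE.
rewrite (_ : (fun w => _) = (fun w => (chain (all_data w) xf)%:E)); last first.
  by apply/funext => w; rewrite xE.
split.
  apply: (smeasurable_comp (Z := all_data) (f := fun y => (chain y xf)%:E)).
    by apply/measurable_EFinP; exact: measurable_chain.
  exact: smeasurable_all_data.
move=> C FC.
rewrite (_ : [set w | forall v, _] = [set w | pred1 xf (hidden w)]); last first.
  apply/seteqP; split => w /=.
    by move=> H; apply/eqP/ffunP => v; rewrite !ffunE H.
  by move=> /eqP H v; have := congr1 (fun c : config => c v) H; rewrite !ffunE.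
(* Conditioning is on the data alone, so [pi] is constant and the identity to check is that the
   chain weights sum to 1. *)
apply: (bayes_rule (Q := pred1 xf) (pi := fun=> tt) (f := fun=> (fun y => chain y xf))).
- by move=> _; exact: measurable_chain.
- by move=> _ y; exact: (chain_weight_ge0 (init_pv y) (trans_pv y)).
- move=> p y; rewrite -mulr_sumr /=.
  rewrite (eq_bigl xpredT); last by move=> c; case: p.
  rewrite [RHS](eq_bigl xpredT); last by move=> c; case: p.
  rewrite (sum_chain_weight (init_pv y) (trans_pv y)) mulr1 (bigD1 xf)//= eqxx mul1r big1 ?addr0// => c /negbTE ->.
  by rewrite mul0r.
- apply: (structured_sigma _ FC); exact: evD_str.
Qed.

Lemma posterior_transition v : (0 < lev v)%N -> forall s' r' : bool,
  cond_prob P <<s evHv (parent v) `|` evD >> [set w | S v w = s' /\ R v w = r']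
    (fun w => (post_trans h (cols (all_data w)) v (S (parent v) w, R (parent v) w) (s', r'))%:E).
Proof.
move=> v0 s' r'.
split.
  pose pi w := hidden w (parent v).
  rewrite (_ : (fun w => _) = (fun w => (post_trans h (cols (all_data w)) v (pi w) (s', r'))%:E)); last first.
    by apply/funext => w; rewrite /pi ffunE.
  apply: (smeasurable_mix (pi := pi) (Z := all_data)
    (f := fun p y => (post_trans h (cols y) v p (s', r'))%:E)).
  - by move=> p; apply: sigma_hidden_at => E; left.
  - by apply: smeasurable_all_data => E; right.
  - by move=> p; apply/measurable_EFinP; exact: measurable_post_trans.
move=> C FC.
rewrite (_ : [set w | _ /\ _] = [set w | (fun c : config => c v == (s', r')) (hidden w)]); last first.
  apply/seteqP; split => w /=; rewrite ffunE; first by move=> [-> ->].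
  by move=> /eqP [-> ->].
under eq_integral => w _.
  rewrite (_ : (S (parent v) w, R (parent v) w) = hidden w (parent v)); last by rewrite ffunE.
  over.
(* The fibres of [pi] fix the state of the parent; the identity to check is
   [sum_chain_transition]. *)
apply: (bayes_rule (Q := fun c => c v == (s', r')) (pi := fun c => c (parent v))
   (f := fun c y => post_trans h (cols y) v (c (parent v)) (s', r'))).
- by move=> c; exact: measurable_post_trans.
- by move=> c y; have [+ _] := trans_pv y v0 (c (parent v)); exact.
- move=> p y.
  have := @sum_chain_transition _ _ _ (post_init h (cols y)) (post_trans h (cols y)) (init_pv y) (trans_pv y) v p (s', r') v0.
  move=> e; rewrite [LHS]big_mkcond [RHS]big_mkcond/=.
  apply: etrans (etrans (esym e) _).
    rewrite mulr_sumr; apply: eq_bigr => c _; case: eqP => [->|_]; first by rewrite mul1r.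
    by rewrite mul0r mulr0.
  apply: eq_bigr => c _; case: eqP => _; first by rewrite mul1r.
  by rewrite !mul0r.
- apply: (structured_sigma _ FC); rewrite subUset; split; first exact: evHv_structured.
  exact: evD_str.
Qed.

Lemma posterior_root (s r : bool) :
  cond_prob P <<s evD >> [set w | S tree_root w = s /\ R tree_root w = r]
    (fun w => (post_init h (cols (all_data w)) (s, r))%:E).
Proof.
split.
  apply: (smeasurable_comp (Z := all_data) (f := fun y => (post_init h (cols y) (s, r))%:E)).
    by apply/measurable_EFinP; exact: measurable_post_init.
  exact: smeasurable_all_data.
move=> C FC.
rewrite (_ : [set w | _ /\ _] = [set w | (fun c : config => c tree_root == (s, r)) (hidden w)]); last first.
  apply/seteqP; split => w /=; rewrite ffunE; first by move=> [-> ->].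
  by move=> /eqP [-> ->].
apply: (bayes_rule (Q := fun c => c tree_root == (s, r)) (pi := fun=> tt)
   (f := fun=> (fun y => post_init h (cols y) (s, r)))).
- by move=> c; exact: measurable_post_init.
- by move=> c y; have [+ _] := init_pv y; exact.
- move=> p y; rewrite -mulr_sumr /=.
  rewrite (eq_bigl xpredT); last by move=> c; case: p.
  rewrite [RHS](eq_bigl xpredT); last by move=> c; case: p.
  rewrite (sum_chain_weight (init_pv y) (trans_pv y)) mulr1.
  by rewrite (sum_chain_root (init_pv y) (trans_pv y)).
- apply: (structured_sigma _ FC); exact: evD_str.
Qed.

(** * Posterior of the variances and coefficients *)

Let GenH_measurable : GenH `<=` measurable.
Proof. by rewrite subUset; split; [exact: evH_measurable|exact: evD_measurable]. Qed.

Lemma smeasurable_plaw (Gen : set (set Omega)) v E : evHv v `<=` Gen -> evD `<=` Gen -> measurable E ->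
  smeasurable <<s Gen >> (fun w => plaw (hidden w) v (data_rv v w) E).
Proof.
move=> HG DG mE.
rewrite (_ : (fun w => _) = (fun w => post_law (n_ := n_) htau hupsilon (lev v)
    (hidden w v).1 (hidden w v).2 (datum v (all_data w)) E)); last first.
  by apply/funext => w; rewrite datum_all_data.
apply: (smeasurable_mix (pi := fun w => hidden w v) (Z := all_data)
   (f := fun p y => post_law (n_ := n_) htau hupsilon (lev v) p.1 p.2 (datum v y) E)).
- by move=> p; exact: sigma_hidden_at.
- exact: smeasurable_all_data.
- move=> p; exact: (measurableT_comp (measurable_post_law hnu hsigma02 htau hupsilon _ _ _ mE) (measurable_datum v)).
Qed.

Let evHv_GenH v : evHv v `<=` GenH.
Proof. by move=> U hU; left; exact: (evHv_sub hU). Qed.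

Let evD_GenH : evD `<=` GenH.
Proof. by move=> U hU; right. Qed.

Lemma cond_nodes_structured (E : node J -> set (K * G.-tuple K)) :
  (forall v, measurable (E v)) -> forall C, structured (hidden) all_data C ->
  P (C `&` [set w | forall v, E v (sigma2 v w, coef_rv v w)]) =
  (\int[P]_(w in C) \prod_v plaw (hidden w) v (data_rv v w) (E v))%E.
Proof.
move=> mE; apply: integral_structured.
- exact: measurable_hid.
- exact: measurable_all_data.
- exact: measurable_nodes.
- apply: emeasurable_prod => v; apply: (measurable_gen_fun GenH_measurable).
  exact: (smeasurable_plaw (evHv_GenH (v := v)) evD_GenH (mE v)).
- by move=> w; apply: prode_ge0' => v; exact: post_law_ge0.
- move=> c B mB.
  etransitivity; first exact: (cond_nodes c mE mB).
  by apply: eq_integral => w /[!inE] -[/= hw _]; rewrite hw.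
Qed.

Definition only (v : node J) (E : set (K * G.-tuple K)) (x : node J) := if x == v then E else setT.

Lemma cond_node_structured v (E : set (K * G.-tuple K)) : measurable E ->
  forall C, structured (hidden) all_data C ->
  P (C `&` [set w | E (sigma2 v w, coef_rv v w)]) =
  (\int[P]_(w in C) plaw (hidden w) v (data_rv v w) E)%E.
Proof.
move=> mE C hC; have mE' x : measurable (only v E x) by rewrite /only; case: ifP.
rewrite (_ : [set w | E _] = [set w | forall x, only v E x (sigma2 x w, coef_rv x w)]); last first.
  apply/seteqP; split => w /=; last by move=> /(_ v); rewrite /only eqxx.
  by move=> Ew x; rewrite /only; case: eqP => // ->.
rewrite cond_nodes_structured//; apply: eq_integral => w _.
rewrite (bigD1 v)//= {1}/only eqxx big1 ?mule1// => x xv.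
by rewrite /only (negbTE xv) post_law_setT.
Qed.

Lemma GenH_structured C : <<s GenH >> C -> structured (hidden) all_data C.
Proof.
apply: structured_sigma; rewrite subUset; split; first exact: evH_structured.
exact: (@evD_structured _ _ _ Y all_data id).
Qed.

Lemma node_event v (A : set Omega) :
  <<s events (z v : Omega -> K) `|` events_fam (fun g => beta v g : Omega -> K) `|` events (sigma2 v : Omega -> K) >> A ->
  exists E, measurable E /\ A = [set w | E (sigma2 v w, coef_rv v w)].
Proof.
have mt g : measurable_fun setT (fun q : K * G.-tuple K => tnth q.2 g).
  exact: (measurableT_comp (measurable_tnth g) measurable_snd).
move=> /(@structured_sigma _ _ _ _ (fun=> tt) (fun w => (sigma2 v w, coef_rv v w))).
case=> [|D mD ->]; last by exists (D tt).
rewrite !subUset; split; first split.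
- move=> _ [B mB <-]; rewrite setTI.
  rewrite (_ : _ @^-1` _ = (fun w => (sigma2 v w, coef_rv v w)) @^-1` ((fun q => tnth q.2 (Ordinal (ltnW hG))) @^-1` B)).
    by apply: structured_Z; rewrite -[X in measurable X]setTI; exact: mt.
  by apply/seteqP; split => w /=; rewrite tnth_mktuple.
- move=> _ [g _ [B mB <-]]; rewrite setTI.
  (* The slot 0 of [coef_rv] holds [z]; the coefficient [beta] of index 0 is identically 0, so its
     events are trivial. *)
  have [g0|g0] := eqVneq (g : nat) 0%N.
    rewrite (_ : _ @^-1` _ = (fun=> tt) @^-1` [set _ | B 0]); first exact: structured_pi.
    by apply/seteqP; split => w /=; rewrite hbeta1.
  rewrite (_ : _ @^-1` _ = (fun w => (sigma2 v w, coef_rv v w)) @^-1` ((fun q => tnth q.2 g) @^-1` B)).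
    by apply: structured_Z; rewrite -[X in measurable X]setTI; exact: mt.
  by apply/seteqP; split => w /=; rewrite tnth_mktuple /regr (negbTE g0).
- move=> _ [B mB <-]; rewrite setTI.
  rewrite (_ : _ @^-1` _ = (fun w => (sigma2 v w, coef_rv v w)) @^-1` (fst @^-1` B)) //.
  by apply: structured_Z; rewrite -[X in measurable X]setTI; exact: measurable_fst.
Qed.

Lemma posterior_cond_indep :
  cond_indep P <<s GenH >> (fun v : node J => <<s events (z v : Omega -> K) `|`
    events_fam (fun g => beta v g : Omega -> K) `|` events (sigma2 v : Omega -> K) >>).
Proof.
move=> A f hA hf.
have /choice[E hE] v : exists E, measurable E /\ A v = [set w | E (sigma2 v w, coef_rv v w)].
  exact: node_event.
have mE v : measurable (E v) by have [] := hE v.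
have AE : A = fun v => [set w | E v (sigma2 v w, coef_rv v w)].
  by apply/funext => v; have [] := hE v.
pose g v w := plaw (hidden w) v (data_rv v w) (E v).
have gv v : cond_prob P <<s GenH >> (A v) (g v).
  split; first exact: (smeasurable_plaw (evHv_GenH (v := v)) evD_GenH (mE v)).
  by move=> C FC; rewrite AE; apply: cond_node_structured => //; exact: GenH_structured.
have mA v : measurable (A v).
  rewrite AE -[X in measurable X]setTI.
  apply: (@measurable_fun_pair _ _ _ _ _ _ (sigma2 v) (coef_rv v)) => //; exact: measurable_coef_rv.
(* The given versions [f v] are arbitrary; almost everywhere they agree with the explicit versions
   [g v], whose product is a version for the intersection. *)
have fg : {ae P, forall w, forall v, f v w = g v w}.
  apply: filter_forall => v.
  exact: (cond_prob_ae_unique GenH_measurable (mA v) (hf v) (gv v)).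
have mf v : smeasurable <<s GenH >> (f v) by have [] := hf v.
have mpf : smeasurable <<s GenH >> (fun w => (\prod_v f v w)%E).
  apply/smeasurableP; apply: emeasurable_prod => v; apply/smeasurableP; exact: mf.
split; first exact: mpf.
move=> C FC; rewrite AE cond_nodes_structured//; last exact: GenH_structured.
have mpg : smeasurable <<s GenH >> (fun w => (\prod_v g v w)%E).
  apply/smeasurableP; apply: emeasurable_prod => v; apply/smeasurableP; exact: (gv v).1.
apply: ae_eq_integral.
- exact: (sub_g_sigma GenH_measurable).
- apply: measurable_funTS; exact: (measurable_gen_fun GenH_measurable mpg).
- apply: measurable_funTS; exact: (measurable_gen_fun GenH_measurable mpf).
- by apply: filterS fg => w e _; apply: eq_bigr => v _; rewrite e.
Qed.

Lemma post_law_sigma j s r y (B : set K) : measurable B ->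
  post_law (n_ := n_) htau hupsilon j s r y (B `*` setT) =
  invgamma_law (shape + n%:R / 2) (rate + Upsilon h j (colt y) s r) B.
Proof.
move=> mB; rewrite -(post_igpE hnu hsigma02 htau hupsilon j s r y mB).
transitivity (\int[post_igp h j s r y]_x (\1_B x)%:E : \bar K)%E; last exact: integral_indicT.
apply: eq_integral => x _.
transitivity (\int[gauss K G]_e (\1_B x)%:E : \bar K)%E.
  by apply: eq_integral => e _; rewrite indic_setX/= indicT mule1.
by rewrite integral_cst// [X in (_ * X)%E](probability_setT (gauss K G)) mule1.
Qed.

(** The law depends only on the states at v and on the data, so it is measurable for the smaller
    sigma-algebra, while the integral identity holds on all events of the larger one. One
    computation therefore serves both. *)
Lemma posterior_sigma v (F : set (set Omega)) :
  F = <<s GenH >> \/ F = <<s evHv v `|` evD >> ->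
  cond_law P F (sigma2 v)
    (fun w => invgamma_law (shape + n%:R / 2)
       (rate + Upsilon h (lev v) (cols (all_data w) v) (S v w) (R v w))).
Proof.
move=> hF B mB.
rewrite (_ : (fun w => _) = (fun w => plaw (hidden w) v (data_rv v w) (B `*` setT))); last first.
  apply/funext => w; apply: etrans (esym (post_law_sigma (lev v) _ _ (data_rv v w) mB)).
  by rewrite ffunE /cols datum_all_data.
have mBT : measurable (B `*` [set: G.-tuple K]) by exact: measurableX.
have sub : <<s evHv v `|` evD >> `<=` <<s GenH >>.
  by apply: sub_sigma_algebra2; rewrite subUset; split; [exact: evHv_GenH|exact: evD_GenH].
split.
  have sm : smeasurable <<s evHv v `|` evD >> (fun w => plaw (hidden w) v (data_rv v w) (B `*` setT)).
    by apply: smeasurable_plaw.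
  by case: hF => -> U mU; [apply: sub|]; exact: sm.
move=> C FC; have {}FC : <<s GenH >> C by case: hF => e; rewrite e in FC => //; exact: sub.
apply: etrans (cond_node_structured v mBT (GenH_structured FC)).
by congr (P (_ `&` _)); apply/seteqP; split => w //= -[].
Qed.

(** [hsigma2] on the whole space gives the unconditional law, whose density vanishes on the
    nonpositive numbers. [coef_law_mvnormal] is available for positive variances, which is why (iii)
    holds almost everywhere. *)
Lemma sigma2_gt0 v : {ae P, forall w, 0 < sigma2 v w}.
Proof.
pose B x := if x == v then [set t : K | t <= 0] else setT.
have mle : measurable [set t : K | t <= 0].
  rewrite (_ : [set t | _] = `]-oo, 0]%classic); first exact: measurable_itv.
  by apply/seteqP; split => t /=; rewrite in_itv.
have mB x : measurable (B x) by rewrite /B; case: ifP.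
have [_ hs] := hsigma2 mB.
have := hs setT (@measurableT _ (g_sigma_algebraType (events_fam S `|` events_fam R))).
rewrite integral0_eq => [e|w _]; last first.
  rewrite (bigD1 v)//= {1}/B eqxx /invgamma_law integral0_eq ?mul0e// => t /= t0.
  by rewrite /invgamma_pdf ltNge t0.
have ms : measurable [set w | sigma2 v w <= 0].
  have mf : measurable_fun setT (sigma2 v) by [].
  by rewrite -[X in measurable X]setTI; exact: (mf measurableT _ mle).
exists [set w | sigma2 v w <= 0]; split => //; last first.
  by move=> w /=; rewrite ltNge => /negP; rewrite negbK.
apply: etrans e; congr (P _); apply/seteqP; split => w /=.
  by move=> sw; split => // x; rewrite /B; case: eqP => // ->.
by move=> [_ /(_ v)]; rewrite /B eqxx.
Qed.

(** The variance at v joins the data in the conditioning variable [sigma_data v], and [cond_coef] is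
    the identity on the basic events; the two sigma-algebras are handled as in [posterior_sigma]. *)
Lemma posterior_coef v (F : set (set Omega)) :
  F = <<s events (sigma2 v : Omega -> K) `|` evH `|` evD >> \/
  F = <<s events (sigma2 v : Omega -> K) `|` evHv v `|` evD >> ->
  exists mu : Omega -> probability (G.-tuple K) K,
    {ae P, forall w,
       is_mvnormal (mu w)
         (mu_star h (lev v) (cols (all_data w) v) (S v w) (R v w))
         (sigma2 v w *:
          hadamard (Mmat K G (S v w) (R v w))
            (invmx (Lambda_star h n_ (lev v) (S v w) (R v w))))}
    /\ cond_law P F (coef_rv v) mu.
Proof.
move=> hF.
exists (fun w => claw (hidden w) v (sigma2 v w) (data_rv v w)); split.
  apply: filterS (sigma2_gt0 v) => w s0; have := coef_law_mvnormal htau hupsilon (lev v) (hidden w v).1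
    (hidden w v).2 (data_rv v w) s0.
  by rewrite /cols datum_all_data ffunE.
move=> B mB.
pose Big := events (sigma2 v : Omega -> K) `|` evH `|` evD.
pose Small := events (sigma2 v : Omega -> K) `|` evHv v `|` evD.
have SmallBig : Small `<=` Big.
  by move=> U [[hU|hU]|hU]; [left; left|left; right; exact: (evHv_sub hU)|right].
have Bigm : Big `<=` measurable.
  rewrite 2!subUset; split; first split; [|exact: evH_measurable|exact: evD_measurable].
  by move=> _ [D mD <-]; exact: measurable_funP.
have sub : <<s Small >> `<=` <<s Big >> by exact: sub_sigma_algebra2.
have ssd : smeasurable <<s Small >> (sigma_data v).
  apply/smeasurableP; apply: measurable_fun_pair; apply/smeasurableP.
    move=> D mD; apply: sub_sigma_algebra; left; left; exists D => //; by rewrite setTI.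
  by apply: smeasurable_all_data => U hU; right.
have mcl p : measurable_fun setT (fun q : K * Y =>
    coef_law (n_ := n_) htau hupsilon (lev v) p.1 p.2 q.1 (datum v q.2) B).
  rewrite (_ : (fun q => _) = (fun q => claw ([ffun=> p] : config) v q.1 (datum v q.2) B)).
    exact: (measurableT_comp (measurable_claw _ v mB) (measurable_sigma_datum v)).
  by apply/funext => q; rewrite ffunE.
have sm : smeasurable <<s Small >> (fun w => claw (hidden w) v (sigma2 v w) (data_rv v w) B).
  rewrite (_ : (fun w => _) = (fun w => coef_law (n_ := n_) htau hupsilon (lev v)
    (hidden w v).1 (hidden w v).2 (sigma_data v w).1
    (datum v (sigma_data v w).2) B)); last first.
    by apply/funext => w; rewrite datum_all_data.
  apply: (smeasurable_mix (pi := fun w => hidden w v) (Z := sigma_data v)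
    (f := fun p q => coef_law (n_ := n_) htau hupsilon (lev v) p.1 p.2 q.1 (datum v q.2) B)) => //.
  by move=> p; apply: sigma_hidden_at => U hU; left; right.
split; first by case: hF => -> U mU; [apply: sub|]; exact: sm.
move=> C FC; have {}FC : <<s Big >> C by case: hF => e; rewrite e in FC => //; exact: sub.
apply: (integral_structured (H := hidden) (Z := sigma_data v)).
- exact: measurable_hid.
- exact: measurable_sigma_data.
- rewrite -[X in measurable X]setTI; exact: measurable_coef_rv.
- exact: (measurable_gen_fun Bigm (fun U mU => sub _ (sm U mU))).
- by move=> w.
- move=> c D mD.
  etransitivity; first exact: (cond_coef c v mB mD).
  by apply: eq_integral => w /[!inE] -[/= hw _]; rewrite hw.
- move: FC; apply: structured_sigma; rewrite 2!subUset; split; first split.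
  + move=> _ [D mD <-]; rewrite setTI.
    rewrite (_ : _ @^-1` _ = sigma_data v @^-1` (fst @^-1` D)) //.
    by apply: structured_Z; rewrite -[X in measurable X]setTI; exact: measurable_fst.
  + exact: evH_structured.
  + exact: (@evD_structured _ _ _ (K * Y)%type (sigma_data v) snd).
Qed.

End nig_mg.

Theorem theorem2 (K : realType) (J G : nat) (n_ : 'I_G -> nat) (h : hyper K J)
    (dO : measure_display) (Omega : measurableType dO) (P : probability Omega K)
    (S R : node J -> {RV P >-> bool})
    (sigma2 z : node J -> {RV P >-> K})
    (beta : node J -> 'I_G -> {RV P >-> K})
    (u d : node J -> {g : 'I_G & 'I_(n_ g)} -> {RV P >-> K})
    (hG : (2 <= G)%N) (hn : forall g, (1 <= n_ g)%N)
    (hnu : 0 < nu h) (hsigma02 : 0 < sigma02 h) (halpha : 0 < alpha h)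
    (htau : 0 < tau0 h) (hupsilon : 0 < upsilon0 h)
    (hS : markov_tree (fun x => P [set w | forall v, S v w = x v])
            (rho0 h) (rho h))
    (hR : markov_tree (fun x => P [set w | forall v, R v w = x v])
            (kappa0 h) (kappa h))
    (hSR : forall x y : node J -> bool,
       P [set w | (forall v, S v w = x v) /\ (forall v, R v w = y v)] =
       (P [set w | forall v, S v w = x v] *
        P [set w | forall v, R v w = y v])%E)
    (hsigma2 : cond_indep_laws P <<s events_fam S `|` events_fam R >> sigma2
       (fun _ _ => invgamma_law (nu h + 1) (nu h * sigma02 h)))
    (hzbeta : cond_indep_laws P
       <<s events_fam S `|` events_fam R `|` events_fam sigma2 >>
       (fun vg : node J * 'I_G =>
          if (vg.2 == 0%N :> nat) then z vg.1 : Omega -> K else beta vg.1 vg.2)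
       (fun vg w =>
          normal_law 0
            (if (vg.2 == 0%N :> nat)
             then (S vg.1 w)%:R * tau h (lev vg.1) * sigma2 vg.1 w
             else (R vg.1 w)%:R * upsilon h (lev vg.1) * sigma2 vg.1 w)))
    (hbeta1 : forall v (g : 'I_G) w, g = 0%N :> nat -> beta v g w = 0)
    (hu : cond_indep_laws P
       <<s events_fam S `|` events_fam R `|` events_fam sigma2 `|` events_fam z
           `|` events_fam (fun vg : node J * 'I_G => beta vg.1 vg.2) >>
       (fun vo : node J * {g : 'I_G & 'I_(n_ g)} => u vo.1 vo.2)
       (fun vo w => normal_law 0 (sigma2 vo.1 w)))
    (hd : forall v o w, d v o w = z v w + beta v (tag o) w + u v o w) :
  let n2 : K := (nobs n_)%:R / 2 in
  let D (w : Omega) (v : node J) : 'cV[K]_(nobs n_) :=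
    dvec (fun o => d v o w) in
  let evD : set (set Omega) :=
    events_fam (fun vo : node J * {g : 'I_G & 'I_(n_ g)} => d vo.1 vo.2) in
  let evH : set (set Omega) := events_fam S `|` events_fam R in
  let evHv (v : node J) : set (set Omega) := events (S v) `|` events (R v) in
  (* (z, beta^(2), ..., beta^(G)) *)
  let coef (v : node J) (w : Omega) : G.-tuple K :=
    [tuple (if (g == 0%N :> nat) then z v w else beta v g w) | g < G] in
  (* (i) *)
  [/\ (exists p : Omega -> (node J -> bool * bool) -> \bar K,
         (forall w, markov_tree (p w) (post_init h (D w)) (post_trans h (D w)))
         /\ (forall x : node J -> bool * bool,
               cond_prob P <<s evD >>
                 [set w | forall v, (S v w, R v w) = x v] (fun w => p w x)))
      /\ (forall v : node J, (0 < lev v)%N -> forall s' r' : bool,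
            cond_prob P <<s evHv (parent v) `|` evD >>
              [set w | S v w = s' /\ R v w = r']
              (fun w => (post_trans h (D w) v
                           (S (parent v) w, R (parent v) w) (s', r'))%:E))
      /\ (forall s r : bool,
            cond_prob P <<s evD >> [set w | S tree_root w = s /\ R tree_root w = r]
              (fun w => (post_init h (D w) (s, r))%:E)),
  (* (ii) *)
      cond_indep P <<s evH `|` evD >>
        (fun v : node J =>
           <<s events (z v) `|` events_fam (beta v) `|` events (sigma2 v) >>)
      /\ (forall v : node J, forall F : set (set Omega),
            F = <<s evH `|` evD >> \/ F = <<s evHv v `|` evD >> ->
            cond_law P F (sigma2 v)
              (fun w => invgamma_law (nu h + 1 + n2)
                 (nu h * sigma02 h +
                  Upsilon h (lev v) (D w v) (S v w) (R v w))))
  (* (iii) *)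
    & forall v : node J, forall F : set (set Omega),
        F = <<s events (sigma2 v) `|` evH `|` evD >> \/
        F = <<s events (sigma2 v) `|` evHv v `|` evD >> ->
        exists mu : Omega -> probability (G.-tuple K) K,
          {ae P, forall w,
             is_mvnormal (mu w)
               (mu_star h (lev v) (D w v) (S v w) (R v w))
               (sigma2 v w *:
                hadamard (Mmat K G (S v w) (R v w))
                  (invmx (Lambda_star h n_ (lev v) (S v w) (R v w))))}
          /\ cond_law P F (coef v) mu].
Proof.
move=> n2 D evD evH evHv coef.
have DE : D = (fun w => cols (all_data d w)) by apply/funext => w; rewrite cols_all_data.
rewrite DE.
split.
- split; first exact: (posterior_tree hG hnu hsigma02 htau hupsilon hS hR hSR hsigma2 hzbeta hbeta1 hu hd).
  split; first exact: (posterior_transition hG hnu hsigma02 htau hupsilon hS hR hSR hsigma2 hzbeta hbeta1 hu hd).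
  exact: (posterior_root hG hnu hsigma02 htau hupsilon hS hR hSR hsigma2 hzbeta hbeta1 hu hd).
- split; first exact: (posterior_cond_indep hG hnu hsigma02 htau hupsilon hS hR hSR hsigma2 hzbeta hbeta1 hu hd).
  exact: (posterior_sigma hG hnu hsigma02 htau hupsilon hS hR hSR hsigma2 hzbeta hbeta1 hu hd).
- exact: (posterior_coef hG hnu hsigma02 htau hupsilon hS hR hSR hsigma2 hzbeta hbeta1 hu hd).
Qed.
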